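(* Let $A=(a_1\le\cdots\le a_n)$ be integers with $a_1\ge2$, and let $1\le i\le n-1$. Put $$A'=(a_1,\ldots,a_{i-1},\underbrace{a_i,\ldots,a_i}_{n-i-1}),\qquad A''=(a_{i+1}-a_i+1,\,a_{i+2}-a_i+1,\ldots,a_n-a_i+1).$$ Then there is an embedding of $\mathfrak{sl}_2\otimes(\mathbb C[t]/t^n)$-modules $S_{i,i+1}(A)\hookrightarrow M^{A'}\otimes M^{A''}$ whose image is generated from the vector $v_{A'}\otimes v_{A''}$ by the action of $\mathbb C[e_0,\ldots,e_{n-3},e^{(2)}_{n-i-1}]$, where $e^{(2)}_{n-i-1}$ acts on $M^{A'}\otimes M^{A''}$ as $\mathrm{Id}\otimes e_{n-i-1}$.
   Context: Fusion products. Let $e,h,f$ be the standard basis of $\mathfrak{sl}_2(\mathbb C)$ and write $x_j=x\otimes t^j$. For positive integers $A=(a_1,\ldots,a_n)$ choose pairwise distinct $z_1,\ldots,z_n\in\mathbb C$, let $\mathbb C^{a}$ be the $a$-dimensional irreducible $\mathfrak{sl}_2$-module, and $\mathbb C^{a_i}(z_i)$ the $\mathfrak{sl}_2\otimes\mathbb C[t]$-module on which $x_j$ acts as $z_i^jx$. Let $\overline{v_A}\in\bigotimes_i\mathbb C^{a_i}(z_i)$ be the tensor product of lowest weight vectors and $F_s$ the span of all $x^{(1)}_{i_1}\cdots x^{(k)}_{i_k}\overline{v_A}$ with $x^{(j)}\in\mathfrak{sl}_2$, $i_1+\cdots+i_k\le s$. The fusion product is the associated graded $\mathfrak{sl}_2\otimes\mathbb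 C[t]$-module $M^A=\bigoplus_sF_s/F_{s-1}$, with $v_A$ the image of $\overline{v_A}$ (for the empty sequence $M^{\emptyset}=\mathbb C$, trivial). Known facts: up to isomorphism $M^A$ is independent of the $z_i$ and of the order of the $a_i$; $\mathfrak{sl}_2\otimes t^j$ acts by $0$ for $j\ge n$; $M^A=\mathbb C[e_0,\ldots,e_{n-1}]v_A\simeq\mathbb C[e_0,\ldots,e_{n-1}]/I_A$ with $I_A$ generated by $\sum_{i_1+\cdots+i_k=s}e_{n-1-i_1}\cdots e_{n-1-i_k}$ for $k\ge1$, $s<\sum_{j=1}^n\max(k+1-a_j,0)$; $\dim M^A=\prod a_i$. Submodules $S_{i,i+1}(A)$. Let $A_{i,i+1}=(a_1,\ldots,a_{i-1},a_i-1,a_{i+1}+1,a_{i+2},\ldots,a_n)$. There is a surjection of $\mathfrak{sl}_2\otimes\mathbb C[t]$-modules $M^A\to M^{A_{i,i+1}}$, $v_A\mapsto v_{A_{i,i+1}}$, and $S_{i,i+1}(A)$ is its kernel. On a tensor product, $e_j$ without superscript acts as $e_j\otimes\mathrm{Id}+\mathrm{Id}\otimes e_j$. *)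

(* Defs.v *)
From HB Require Import structures.
From mathcomp Require Import all_boot all_order all_algebra.
From mathcomp Require Import zify ring.
From mathcomp Require Import boolp.

Set Implicit Arguments.
Unset Strict Implicit.
Unset Printing Implicit Defensive.

Import Order.TTheory GRing.Theory Num.Theory.
Local Open Scope ring_scope.

Section Span.
Variables (K : fieldType) (V : vectType K).

Lemma span_exists (S : V -> Prop) :
  exists X : seq V, (forall u, u \in X -> S u) /\ (forall u, S u -> u \in <<X>>%VS).
Proof.
pose good d := exists X : seq V, (forall u, u \in X -> S u) /\ \dim <<X>> = d.
have exg : exists d, `[< good d >] by exists 0%N; apply/asboolP; exists [::]; rewrite span_nil dimv0.
have bd d : `[< good d >] -> (d <= \dim {:V})%N.
  by move=> /asboolP [X [_ <-]]; apply: dimvS; apply: subvf.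
case: (ex_maxnP exg bd) => d /asboolP [X [XS dX]] dmax.
exists X; split=> // u Su; apply/negPn/negP => uX.
have : (\dim <<u :: X>> <= d)%N.
  apply: dmax; apply/asboolP; exists (u :: X); split=> // w.
  by rewrite inE => /orP [/eqP ->|/XS].
apply/negP; rewrite -ltnNge -dX.
rewrite (ltn_leqif (dimv_leqif_sup _)); last by apply: sub_span => w wX; rewrite inE wX orbT.
by apply: contra uX => /subvP; apply; rewrite memv_span // mem_head.
Qed.

Definition spanS (S : V -> Prop) : {vspace V} :=
  <<projT1 (cid (span_exists S))>>%VS.

Lemma mem_spanS (S : V -> Prop) u : S u -> u \in spanS S.
Proof. by rewrite /spanS; case: cid => X /= [_ h]; apply: h. Qed.

Lemma spanS_sub (S : V -> Prop) (U : {vspace V}) :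
  (forall u, S u -> u \in U) -> (spanS S <= U)%VS.
Proof.
by rewrite /spanS; case: cid => X /= [XS _] h; apply/span_subvP => u /XS /h.
Qed.

End Span.

Section Subquotient.
Variables (K : fieldType) (V : vectType K) (G H : {vspace V}).

(* The quotient G / H (for H contained in G), realized on the complement
   G :\: H of H in G; subquot_pi is the canonical projection, see
   subquot_pi_ker and subquot_pi_surj. *)
Definition subquot : vectType K := subvs_of (G :\: H)%VS.

Definition subquot_pi : 'Hom(V, subquot) :=
  (linfun (vsproj (G :\: H)) \o addv_pi1 G H)%VF.
Definition subquot_lift : 'Hom(subquot, V) := linfun (@vsval K V (G :\: H)).

Lemma subquot_liftP u : subquot_lift u \in G.
Proof. by rewrite lfunE /=; apply: (subvP (diffvSl G H)); apply: subvsP. Qed.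

Lemma subquot_lift_pi u : subquot_lift (subquot_pi u) = addv_pi1 G H u.
Proof.
rewrite /subquot_lift (lfunE vsval) /subquot_pi comp_lfunE (lfunE (vsproj _)).
by apply: vsprojK; apply: memv_pi.
Qed.

Lemma subquot_lift_inj : injective subquot_lift.
Proof.
move=> u w; rewrite /subquot_lift (lfunE vsval) (lfunE vsval).
exact: val_inj.
Qed.

Lemma subquot_piK u : u \in G -> u - subquot_lift (subquot_pi u) \in H.
Proof.
move=> uG; rewrite subquot_lift_pi.
have uGH : u \in (G + H)%VS by apply: (subvP (addvSl G H)).
by rewrite -{1}(addv_pi1_pi2 uGH) addrC addKr memv_pi2.
Qed.

Lemma subquot_liftK u : subquot_pi (subquot_lift u) = u.
Proof.
apply: subquot_lift_inj; rewrite subquot_lift_pi.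
rewrite /addv_pi1 daddv_pi_id ?capv_diff //.
by rewrite /subquot_lift (lfunE vsval); apply: subvsP.
Qed.

Lemma subquot_pi_ker u : (H <= G)%VS -> u \in G ->
  (subquot_pi u == 0) = (u \in H).
Proof.
move=> HG uG; apply/eqP/idP => [u0|uH].
  by have := subquot_piK uG; rewrite u0 linear0 subr0.
apply: subquot_lift_inj; rewrite subquot_lift_pi linear0.
have uGH : u \in (G + H)%VS by apply: (subvP (addvSr G H)).
have := addv_pi1_pi2 uGH; rewrite (addv_pi2_id _ uH) => /(canRL (addrK _)) ->.
by rewrite subrr.
Qed.

Lemma subquot_pi_surj u : exists2 w, w \in G & subquot_pi w = u.
Proof. by exists (subquot_lift u); [apply: subquot_liftP | apply: subquot_liftK]. Qed.

(* The operator induced on G / H by an operator preserving G and H. *)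
Definition subquot_end (f : 'End(V)) : 'End(subquot) :=
  (subquot_pi \o f \o subquot_lift)%VF.

Lemma subquot_end_pi (f : 'End(V)) u :
  (H <= G)%VS -> (f @: G <= G)%VS -> (f @: H <= H)%VS -> u \in G ->
  subquot_end f (subquot_pi u) = subquot_pi (f u).
Proof.
move=> HG fG fH uG; rewrite /subquot_end 2!comp_lfunE.
apply/eqP; rewrite -subr_eq0 -(linearB subquot_pi) -(linearB f).
rewrite subquot_pi_ker //.
  by rewrite -memvN -(linearN f) opprB (subvP fH) ?memv_img ?subquot_piK.
apply: (subvP fG); apply: memv_img; apply: memvB => //.
exact: subquot_liftP.
Qed.

End Subquotient.

Section Tensor.
Variables (K : fieldType).

Definition coords (U : vectType K) (u : U) := passmx.rVof (vbasis {:U}) u.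
Definition coords_mx (U : vectType K) (f : 'End(U)) :=
  passmx.mxof (vbasis {:U}) (vbasis {:U}) f.

Lemma coords_app (U : vectType K) (f : 'End(U)) u :
  coords (f u) = coords u *m coords_mx f.
Proof. by rewrite /coords (passmx.rVof_app _ (vbasisP _)). Qed.

Lemma coords_mx_comp (U : vectType K) (f g : 'End(U)) :
  coords_mx (f \o g)%VF = coords_mx g *m coords_mx f.
Proof. exact: passmx.mxof_comp (vbasisP _) _ _. Qed.

Lemma coords_mx1 (U : vectType K) : coords_mx (\1%VF : 'End(U)) = 1%:M.
Proof.
apply/row_matrixP => i; rewrite !rowE mulmx1 /coords_mx passmx.mul_mxof.
by rewrite id_lfunE passmx.vecofK // vbasisP.
Qed.

Lemma coords_mxP (U : vectType K) a (f g : 'End(U)) :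
  coords_mx (a *: f + g) = a *: coords_mx f + coords_mx g.
Proof. exact: passmx.mxof_linear. Qed.

Lemma coords_mxB (U : vectType K) (f g : 'End(U)) :
  coords_mx (f - g) = coords_mx f - coords_mx g.
Proof. by rewrite addrC -scaleN1r coords_mxP scaleN1r addrC. Qed.

Variables U W : vectType K.

(* U (x) W in coordinates: the matrices of coefficients on the tensor products
   of the vectors of the bases vbasis {:U} and vbasis {:W}. *)
Definition tensv : vectType K := 'M[K]_(\dim {:U}, \dim {:W}).

Definition tens (u : U) (w : W) : tensv := (coords u)^T *m coords w.

Lemma tens_basis (i : 'I_(\dim {:U})) (j : 'I_(\dim {:W})) :
  tens (vbasis {:U})`_i (vbasis {:W})`_j = delta_mx i j.
Proof.
rewrite /tens /coords !passmx.rVofE ?vbasisP // trmx_delta.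
by rewrite mul_delta_mx.
Qed.

Definition tens_fun (f : 'End(U)) (g : 'End(W)) (X : tensv) : tensv :=
  (coords_mx f)^T *m X *m coords_mx g.

Fact tens_fun_linear f g : linear (tens_fun f g).
Proof.
by move=> a X Y; rewrite /tens_fun mulmxDr mulmxDl -scalemxAr -scalemxAl.
Qed.
HB.instance Definition _ f g := GRing.isSemilinear.Build K tensv tensv _
  (tens_fun f g) (GRing.semilinear_linear (tens_fun_linear f g)).

Definition tens_end (f : 'End(U)) (g : 'End(W)) : 'End(tensv) :=
  linfun (tens_fun f g).

Lemma tens_endE f g u w : tens_end f g (tens u w) = tens (f u) (g w).
Proof.
rewrite /tens_end (lfunE (tens_fun f g)) /= /tens_fun /tens.
by rewrite !coords_app trmx_mul !mulmxA.
Qed.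

End Tensor.

Section CurrentModules.
Variable K : fieldType.

Definition traceless : {pred 'M[K]_2} := [pred x | \tr x == 0].

Fact traceless_submod : submod_closed traceless.
Proof.
split=> [|a x y /eqP x0 /eqP y0]; first by rewrite inE mxtrace0.
by rewrite inE linearP /= x0 y0 mulr0 addr0.
Qed.
HB.instance Definition _ :=
  GRing.isSubmodClosed.Build K 'M[K]_2 traceless traceless_submod.

Record sl2 := Sl2 { sl2_mx :> 'M[K]_2; sl2_mxP : sl2_mx \in traceless }.
HB.instance Definition _ := [isSub of sl2 for sl2_mx].
HB.instance Definition _ := [Choice of sl2 by <:].
HB.instance Definition _ := [SubChoice_isSubLmodule of sl2 by <:].

Fact sl2_e_subproof : (delta_mx 0 1 : 'M[K]_2) \in traceless.
Proof. by rewrite inE /mxtrace big_ord_recl big_ord1 !mxE /= addr0. Qed.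
Definition sl2_e := Sl2 sl2_e_subproof.

Fact sl2_bracket_subproof (x y : sl2) : x *m y - y *m x \in traceless.
Proof. by rewrite inE linearB /= mxtrace_mulC subrr. Qed.
Definition sl2_bracket (x y : sl2) := Sl2 (sl2_bracket_subproof x y).

(* Finite-dimensional modules; act j x is the action of x_j = x (x) t^j. *)
Record current_module := CurrentModule {
  carrier :> vectType K;
  act : nat -> sl2 -> 'End(carrier);
  act_linear : forall j, linear (act j);
  act_bracket : forall i j x y,
    act (i + j)%N (sl2_bracket x y) =
      (act i x \o act j y)%VF - (act j y \o act i x)%VF }.

Record current_hom (M N : current_module) := CurrentHom {
  hom_fun :> 'Hom(M, N);
  hom_act : forall j x u, hom_fun (act M j x u) = act N j x (hom_fun u) }.

(* M is a module over sl_2 (x) K[t]/(t^n). *)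
Definition truncated (n : nat) (M : current_module) :=
  forall j x, (n <= j)%N -> act M j x = 0.

Section Submodule.
Variables (M : current_module) (U : {vspace M}).
Hypothesis stabU : forall j x, (act M j x @: U <= U)%VS.

Definition sub_act j x : 'End(subvs_of U) :=
  (linfun (vsproj U) \o act M j x \o linfun (@vsval K M U))%VF.

Lemma sub_actE j x u : vsval (sub_act j x u) = act M j x (vsval u).
Proof.
rewrite /sub_act 2!comp_lfunE (lfunE (vsproj U)) (lfunE vsval) /= vsprojK //.
by apply: (subvP (stabU j x)); rewrite memv_img // subvsP.
Qed.

Fact sub_act_linear j : linear (sub_act j).
Proof.
move=> a x y; apply/lfunP=> u; apply: (@subvs_inj _ _ U); rewrite add_lfunE scale_lfunE.
by rewrite (linearP vsval) sub_actE [in RHS]/= !sub_actE act_linear add_lfunE scale_lfunE.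
Qed.

Fact sub_act_bracket i j x y :
  sub_act (i + j)%N (sl2_bracket x y) =
    (sub_act i x \o sub_act j y)%VF - (sub_act j y \o sub_act i x)%VF.
Proof.
apply/lfunP=> u; apply: (@subvs_inj _ _ U).
rewrite sub_actE add_lfunE opp_lfunE (comp_lfunE (sub_act i x) (sub_act j y)).
rewrite (comp_lfunE (sub_act j y) (sub_act i x)) (linearB vsval) /= !sub_actE.
by rewrite act_bracket add_lfunE opp_lfunE !comp_lfunE.
Qed.

Definition submodule := CurrentModule sub_act_linear sub_act_bracket.
End Submodule.

Fact hom_ker_stable (M N : current_module) (phi : current_hom M N) j x :
  (act M j x @: lker phi <= lker phi)%VS.
Proof.
apply/subvP=> _ /memv_imgP [u uk ->]; move: uk; rewrite !memv_ker => /eqP u0.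
by rewrite hom_act u0 linear0.
Qed.

Definition hom_ker (M N : current_module) (phi : current_hom M N) :=
  submodule (hom_ker_stable phi).

Section TensorModule.
Variables M N : current_module.

Definition tens_act j x : 'End(tensv M N) :=
  tens_end (act M j x) \1 + tens_end \1 (act N j x).

Lemma tens_actE j x (X : tensv M N) : tens_act j x X =
  (coords_mx (act M j x))^T *m X + X *m coords_mx (act N j x).
Proof.
rewrite /tens_act add_lfunE /tens_end (lfunE (tens_fun _ _)).
rewrite (lfunE (tens_fun _ _)) /= /tens_fun.
by rewrite !coords_mx1 trmx1 mulmx1 mul1mx.
Qed.

Fact tens_act_linear j : linear (tens_act j).
Proof.
move=> a x y; apply/lfunP=> X; rewrite tens_actE (add_lfunE (a *: tens_act j x)).
rewrite (scale_lfunE a (tens_act j x)) !tens_actE.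
rewrite !act_linear !coords_mxP linearP /= mulmxDl mulmxDr.
by rewrite -scalemxAl -scalemxAr scalerDr addrACA.
Qed.

Fact tens_act_bracket i j x y :
  tens_act (i + j)%N (sl2_bracket x y) =
    (tens_act i x \o tens_act j y)%VF - (tens_act j y \o tens_act i x)%VF.
Proof.
apply/lfunP=> X; 
rewrite tens_actE (add_lfunE (tens_act i x \o tens_act j y)) opp_lfunE.
rewrite (comp_lfunE (tens_act i x) (tens_act j y)).
rewrite (comp_lfunE (tens_act j y) (tens_act i x)) !tens_actE.
rewrite !act_bracket !coords_mxB !coords_mx_comp linearB /= !trmx_mul.
rewrite !(mulmxDl, mulmxDr, mulmxA, mulNmx, mulmxN).
set p1 := _ *m X; set p2 := _ *m X.
set q1 := X *m _ *m _; set q2 := X *m _ *m _.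
set u1 := _ *m X *m _; set u2 := _ *m X *m _.
rewrite !opprD [RHS](AC (2*2*(2*2)) (1*5*(4*8)*((2*7)*(3*6)))) /=.
by rewrite !subrr !addr0.
Qed.

Definition tens_module := CurrentModule tens_act_linear tens_act_bracket.
End TensorModule.

(* In the basis v_0, ..., v_{a-1} with v_0 of lowest weight:
   e v_l = v_{l+1} (0 if l = a - 1), h v_l = (2 l + 1 - a) v_l, f v_l = l (a - l) v_{l-1};
   this is the irreducible module of dimension a when K has characteristic 0. *)
Definition irr_e a : 'M[K]_a := \matrix_(k, l) (k == l.+1 :> nat)%:R.
Definition irr_h a : 'M[K]_a :=
  \matrix_(k, l) (((l.*2.+1)%:R - a%:R) *+ (k == l)).
Definition irr_f a : 'M[K]_a :=
  \matrix_(k, l) ((l * (a - l))%:R *+ (k.+1 == l :> nat)).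

Definition irr_mx a (x : sl2) : 'M[K]_a :=
  x 0 1 *: irr_e a + x 0 0 *: irr_h a + x 1 0 *: irr_f a.

Fact irr_nat_id l a :
  (l < a)%N -> (l * (a - l) + a = l.*2.+1 + l.+1 * (a - l.+1))%N.
Proof.
by move/subnKC => <-; rewrite addKn addSnnS addKn -addnn mulnS mulSn; lia.
Qed.

Lemma irr_ef a : irr_e a *m irr_f a - irr_f a *m irr_e a = irr_h a.
Proof.
apply/matrixP=> k l; rewrite !mxE.
have -> : \sum_m irr_e a k m * irr_f a m l = (l * (a - l))%:R *+ (k == l).
  case: (posnP k) => [k0|k_gt0].
    rewrite big1 => [|m _]; last by rewrite !mxE k0 mul0r.
    case: eqP => [<-|_]; last by rewrite mulr0n.
    by rewrite k0 mul0n.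
  have km : (k.-1 < a)%N by apply: leq_ltn_trans (leq_pred _) (ltn_ord k).
  rewrite (bigD1 (Ordinal km)) //= big1 ?addr0 => [|m mk].
    by rewrite !mxE /= prednK // eqxx mul1r.
  rewrite !mxE; case: eqP => [k_m|]; last by rewrite mul0r.
  by case/eqP: mk; apply: val_inj; rewrite /= k_m.
have -> : \sum_m irr_f a k m * irr_e a m l =
    (l.+1 * (a - l.+1))%:R *+ (k == l).
  have [la|la] := ltnP l.+1 a.
    rewrite (bigD1 (Ordinal la)) //= big1 ?addr0 => [|m ml].
      by rewrite !mxE /= eqxx mulr1 eqSS.
    rewrite !mxE; case: eqP => [k_m|]; last by rewrite mulr0n mul0r.
    case: eqP => [m_l|]; last by rewrite mulr0.
    by case/eqP: ml; apply: val_inj; rewrite /= m_l.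
  rewrite big1 => [|m _].
    by rewrite (eqP la) muln0 mul0rn.
  rewrite !mxE; case: (m =P l.+1 :> nat) => [m_l|]; last by rewrite mulr0.
  by have := ltn_ord m; rewrite m_l ltnNge la.
rewrite -mulrnBl; congr (_ *+ _).
apply/eqP; rewrite subr_eq addrAC eq_sym subr_eq -!natrD.
by rewrite irr_nat_id // addrC.
Qed.

Lemma irr_he a : irr_h a *m irr_e a - irr_e a *m irr_h a = irr_e a *+ 2.
Proof.
apply/matrixP=> k l; rewrite !mxE.
rewrite (bigD1 k) //= big1 ?addr0 => [|m mk]; last first.
  by rewrite !mxE eq_sym (negPf mk) mulr0n mul0r.
rewrite (bigD1 l) //= big1 ?addr0 => [|m ml]; last first.
  by rewrite !mxE (negPf ml) mulr0n mulr0.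
rewrite !mxE !eqxx !mulr1n; case: eqP => [->|_] /=; last first.
  by rewrite mulr0n mulr0 mul0r subrr addr0.
by rewrite doubleS !mulrS; move: (_ *+ l.*2) => t; ring.
Qed.

Lemma irr_hf a : irr_h a *m irr_f a - irr_f a *m irr_h a = - (irr_f a *+ 2).
Proof.
apply/matrixP=> k l; rewrite !mxE.
rewrite (bigD1 k) //= big1 ?addr0 => [|m mk]; last first.
  by rewrite !mxE eq_sym (negPf mk) mulr0n mul0r.
rewrite (bigD1 l) //= big1 ?addr0 => [|m ml]; last first.
  by rewrite !mxE (negPf ml) mulr0n mulr0.
rewrite !mxE !eqxx !mulr1n; case: eqP => [<-|_] /=; last first.
  by rewrite mulr0n mulr0 mul0r subrr addr0 oppr0.
by rewrite mulr1n doubleS !mulrS; move: (_ *+ k.*2) (_%:R) => t u; ring.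
Qed.

Lemma sl2_11 (x : sl2) : x 1 1 = - x 0 0.
Proof.
have := sl2_mxP x; rewrite inE /mxtrace big_ord_recl big_ord1 addrC addr_eq0.
by move=> /eqP <-; congr (x _ _); apply: val_inj.
Qed.

Fact irr_mx_linear a : linear (irr_mx a).
Proof.
move=> c x y; rewrite /irr_mx !mxE !scalerDr !scalerA !scalerDl.
by rewrite [RHS]addrACA; congr (_ + _); rewrite [RHS]addrACA.
Qed.

Fact irr_mx_bracket a x y :
  irr_mx a (sl2_bracket x y) = irr_mx a x *m irr_mx a y - irr_mx a y *m irr_mx a x.
Proof.
have EF := irr_ef a; have HE := irr_he a; have HF := irr_hf a.
have {}EF : irr_e a *m irr_f a = irr_h a + irr_f a *m irr_e a by rewrite -EF subrK.
have {}HE : irr_h a *m irr_e a = irr_e a *+ 2 + irr_e a *m irr_h a.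
  by rewrite -HE subrK.
have {}HF : irr_h a *m irr_f a = - (irr_f a *+ 2) + irr_f a *m irr_h a.
  by rewrite -HF subrK.
have mulE (u v : sl2) i j : (u *m v) i j = u i 0 * v 0 j + u i 1 * v 1 j.
  rewrite mxE big_ord_recl big_ord1.
  by congr (_ + u i _ * v _ j); apply: val_inj.
have subE i j : (x *m y - y *m x) i j =
    x i 0 * y 0 j + x i 1 * y 1 j - (y i 0 * x 0 j + y i 1 * x 1 j).
  by rewrite -!mulE !mxE.
rewrite /irr_mx /= !subE !sl2_11 !(mulmxDl, mulmxDr) -!scalemxAl -!scalemxAr.
rewrite EF HE HF.
move: (irr_e a *m _) (irr_h a *m _) (irr_f a *m _) (irr_f a *m _)
  (irr_f a *m _) (irr_e a *m _) => B1 B2 B3 B4 B5 B6.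
apply/matrixP => k l; rewrite !mxE; ring.
Qed.

Definition ev_act a (z : K) j x : 'End('cV[K]_a) :=
  linfun (mulmx (z ^+ j *: irr_mx a x)).

Lemma ev_actE a z j x v : ev_act a z j x v = z ^+ j *: (irr_mx a x *m v).
Proof. by rewrite /ev_act lfunE /= scalemxAl. Qed.

Fact ev_act_linear a z j : linear (ev_act a z j).
Proof.
move=> c x y; apply/lfunP=> v; rewrite add_lfunE scale_lfunE !ev_actE.
by rewrite irr_mx_linear mulmxDl -scalemxAl scalerDr !scalerA mulrC.
Qed.

Fact ev_act_bracket a z i j x y :
  ev_act a z (i + j)%N (sl2_bracket x y) =
    (ev_act a z i x \o ev_act a z j y)%VF - (ev_act a z j y \o ev_act a z i x)%VF.
Proof.
apply/lfunP=> v; rewrite ev_actE irr_mx_bracket.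
rewrite (add_lfunE (ev_act a z i x \o ev_act a z j y)) opp_lfunE.
rewrite (comp_lfunE (ev_act a z i x) (ev_act a z j y)).
rewrite (comp_lfunE (ev_act a z j y) (ev_act a z i x)) !ev_actE.
rewrite -!scalemxAr !scalerA -!exprD [(j + i)%N]addnC -scalerBr.
by rewrite mulmxBl !mulmxA.
Qed.

Definition ev_module a z := CurrentModule (@ev_act_linear a z) (@ev_act_bracket a z).

Definition ev_lowest a z : ev_module a z :=
  (\col_(k < a) (k == 0 :> nat)%:R : 'cV[K]_a).

Fact triv_act_linear (j : nat) : linear (fun _ : sl2 => 0 : 'End(K^o)).
Proof. by move=> c x y; rewrite scaler0 addr0. Qed.

Fact triv_act_bracket (i j : nat) (x y : sl2) :
  let o : 'End(K^o) := 0 in o = (o \o o)%VF - (o \o o)%VF.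
Proof. by rewrite /= subrr. Qed.

Definition triv_module :=
  @CurrentModule K^o (fun _ _ => 0) triv_act_linear triv_act_bracket.

(* C^{a_1}(z_1) (x) ... (x) C^{a_n}(z_n), for the list of the (a_i, z_i). *)
Fixpoint ev_tensor (s : seq (nat * K)) : current_module :=
  if s is (a, z) :: s' then tens_module (ev_module a z) (ev_tensor s')
  else triv_module.

Fixpoint ev_tensor_lowest (s : seq (nat * K)) : ev_tensor s :=
  if s is (a, z) :: s' then tens (ev_lowest a z) (ev_tensor_lowest s')
  else (1 : K^o).

Section Graded.
Variables (M : current_module) (v : M).

Definition act_word (w : seq (nat * sl2)) (u : M) : M :=
  foldr (fun p u' => act M p.1 p.2 u') u w.

Definition filt (s : nat) : {vspace M} :=
  spanS (fun u => exists2 w, (sumn (unzip1 w) <= s)%N & u = act_word w v).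

(* F_{s-1}, with F_{-1} = 0 *)
Definition filt_pred (s : nat) : {vspace M} :=
  if s is s'.+1 then filt s' else 0%VS.

Lemma filt_mono s t : (s <= t)%N -> (filt s <= filt t)%VS.
Proof.
move=> st; apply: spanS_sub => _ [w ws ->]; apply: mem_spanS.
by exists w => //; apply: leq_trans st.
Qed.

Lemma filt_predS s : (filt_pred s <= filt s)%VS.
Proof. by case: s => [|s]; [apply: sub0v | apply: filt_mono]. Qed.

Lemma filt_act j x s : (act M j x @: filt s <= filt (j + s))%VS.
Proof.
rewrite /filt {1}/spanS; case: cid => X /= [XS _].
rewrite limg_span; apply/span_subvP => _ /mapP [u /XS [w ws ->] ->].
by apply: mem_spanS; exists ((j, x) :: w) => //=; rewrite leq_add2l.
Qed.

Lemma filt_pred_act j x s : (act M j x @: filt_pred s <= filt_pred (j + s))%VS.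
Proof.
case: s => [|s]; first by rewrite limg0 sub0v.
by rewrite addnS; apply: filt_act.
Qed.

Lemma filt_stable : exists N, forall s, (N <= s)%N -> filt s = filt N.
Proof.
pose good d := exists N, \dim (filt N) = d.
have exg : exists d, `[< good d >].
  by exists (\dim (filt 0)); apply/asboolP; exists 0%N.
have bd d : `[< good d >] -> (d <= \dim {:M})%N.
  by move=> /asboolP [N <-]; apply: dimvS; apply: subvf.
case: (ex_maxnP exg bd) => d /asboolP [N dN] dmax.
exists N => s Ns; apply/eqP; rewrite eq_sym eqEdim filt_mono //= dN.
by apply: dmax; apply/asboolP; exists s.
Qed.

(* F_s = F_N for s >= N, so F_s / F_{s-1} = 0 for s > N and the sum of the
   F_s / F_{s-1} is a quotient of a subspace of M^{N+1}. *)
Definition filt_top : nat := projT1 (cid filt_stable).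

Lemma filt_topP s : (filt_top <= s)%N -> filt s = filt filt_top.
Proof. by rewrite /filt_top; case: cid => N /= h; apply: h. Qed.

Definition grade_space : vectType K := {ffun 'I_filt_top.+1 -> M}.

(* The direct sum of the U s, as a subspace of M^{N+1} *)
Definition pointwise (U : nat -> {vspace M}) : {vspace grade_space} :=
  spanS (fun w : grade_space => forall s : 'I_filt_top.+1, w s \in U s).

Lemma mem_pointwise (U : nat -> {vspace M}) (w : grade_space) :
  (w \in pointwise U) <-> (forall s : 'I_filt_top.+1, w s \in U s).
Proof.
split=> [|h]; last exact: mem_spanS.
rewrite /pointwise /spanS; case: cid => X /= [XS _] wX s.
rewrite (coord_span (X := in_tuple X) wX) sum_ffunE; apply: memv_suml => i _; rewrite ffunE memvZ //.
by apply: XS; rewrite mem_nth.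
Qed.

(* (x_j w)_{j+s} = x_j w_s *)
Definition grade_fun j x (w : grade_space) : grade_space :=
  [ffun s : 'I_filt_top.+1 =>
     if (j <= s)%N then act M j x (w (inord (s - j))) else 0].

Fact grade_fun_linear j x : linear (grade_fun j x).
Proof.
move=> c w w'; apply/ffunP => s; rewrite !ffunE.
by case: ifP => _; rewrite ?linearP // scaler0 addr0.
Qed.
HB.instance Definition _ j x := GRing.isSemilinear.Build K grade_space grade_space _
  (grade_fun j x) (GRing.semilinear_linear (grade_fun_linear j x)).

Definition grade_act j x : 'End(grade_space) := linfun (grade_fun j x).

Lemma grade_act_pointwise (U : nat -> {vspace M}) j x :
  (forall s, (act M j x @: U s <= U (j + s)%N)%VS) ->
  (grade_act j x @: pointwise U <= pointwise U)%VS.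
Proof.
move=> h; apply/subvP => _ /memv_imgP [w /mem_pointwise wU ->].
apply/mem_pointwise => s; rewrite /grade_act lfunE /= ffunE.
case: ifP => [js|_]; last exact: mem0v.
rewrite -[X in U X](subnKC js) (subvP (h _)) // memv_img //.
have := wU (inord (s - j)); rewrite inordK //.
by apply: leq_ltn_trans (leq_subr _ _) (ltn_ord s).
Qed.

Definition filt_sum := pointwise filt.
Definition filt_pred_sum := pointwise filt_pred.

(* The direct sum of the F_s / F_{s-1}, as the quotient of the direct sum of
   the F_s by that of the F_{s-1} *)
Definition gr_space : vectType K := subquot filt_sum filt_pred_sum.
Definition gr_pi : 'Hom(grade_space, gr_space) :=
  subquot_pi filt_sum filt_pred_sum.
Definition gr_act j x : 'End(gr_space) := subquot_end filt_sum filt_pred_sum (grade_act j x).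

Lemma filt_sumS : (filt_pred_sum <= filt_sum)%VS.
Proof.
apply: spanS_sub => w ws; apply: mem_spanS => s.
exact: (subvP (filt_predS s)).
Qed.

Lemma gr_actE j x w : w \in filt_sum ->
  gr_act j x (gr_pi w) = gr_pi (grade_act j x w).
Proof.
move=> wF; apply: subquot_end_pi => //; first exact: filt_sumS.
  by apply: grade_act_pointwise => s; apply: filt_act.
by apply: grade_act_pointwise => s; apply: filt_pred_act.
Qed.

Lemma grade_act_sum j x w : w \in filt_sum -> grade_act j x w \in filt_sum.
Proof.
move=> wF; apply: (subvP (grade_act_pointwise (fun s => filt_act j x s))).
exact: memv_img.
Qed.

Fact grade_act_linear j : linear (grade_act j).
Proof.
move=> c x y; apply/lfunP => w; rewrite add_lfunE scale_lfunE /grade_act.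
rewrite !(lfunE (grade_fun _ _)); apply/ffunP => s; rewrite !ffunE.
case: ifP => _; last by rewrite scaler0 addr0.
by rewrite act_linear add_lfunE scale_lfunE.
Qed.

Fact grade_act_bracket i j x y :
  grade_act (i + j)%N (sl2_bracket x y) =
    (grade_act i x \o grade_act j y)%VF - (grade_act j y \o grade_act i x)%VF.
Proof.
apply/lfunP => w; rewrite (add_lfunE (grade_act i x \o grade_act j y)) opp_lfunE.
rewrite (comp_lfunE (grade_act i x)) (comp_lfunE (grade_act j y)) /grade_act.
rewrite !(lfunE (grade_fun _ _)); apply/ffunP => s; rewrite !ffunE.
have lt k : (s - k < filt_top.+1)%N by apply: leq_ltn_trans (leq_subr _ _) (ltn_ord s).
rewrite !inordK // -!subnDA [(j + i)%N]addnC; case: leqP => ijs.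
  have [is_ js] : (i <= s)%N /\ (j <= s)%N by lia.
  rewrite is_ js !leq_subRL // [(j + i)%N]addnC ijs.
  by rewrite act_bracket add_lfunE opp_lfunE !comp_lfunE.
have z1 : (i <= s)%N -> (j <= s - i)%N = false by lia.
have z2 : (j <= s)%N -> (i <= s - j)%N = false by lia.
case: (leqP i s) => [/z1 ->|_]; case: (leqP j s) => [/z2 ->|_];
  by rewrite !(linear0, oppr0, addr0).
Qed.

Fact gr_act_linear j : linear (gr_act j).
Proof.
move=> c x y; apply/lfunP => u.
have [w wF <-] : exists2 w, w \in filt_sum & gr_pi w = u by apply: subquot_pi_surj.
rewrite (add_lfunE (c *: gr_act j x)) (scale_lfunE c (gr_act j x)) !gr_actE //.
by rewrite grade_act_linear add_lfunE scale_lfunE linearP.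
Qed.

Fact gr_act_bracket i j x y :
  gr_act (i + j)%N (sl2_bracket x y) =
    (gr_act i x \o gr_act j y)%VF - (gr_act j y \o gr_act i x)%VF.
Proof.
apply/lfunP => u.
have [w wF <-] : exists2 w, w \in filt_sum & gr_pi w = u by apply: subquot_pi_surj.
rewrite (add_lfunE (gr_act i x \o gr_act j y)) opp_lfunE.
rewrite (comp_lfunE (gr_act i x)) (comp_lfunE (gr_act j y)).
rewrite !gr_actE ?grade_act_sum //.
rewrite grade_act_bracket (add_lfunE (grade_act i x \o grade_act j y)) opp_lfunE.
by rewrite (comp_lfunE (grade_act i x)) (comp_lfunE (grade_act j y)) linearB.
Qed.

Definition gr_module := CurrentModule gr_act_linear gr_act_bracket.

Definition gr_class (s : nat) (u : M) : gr_module :=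
  gr_pi [ffun t : 'I_filt_top.+1 => if t == s :> nat then u else 0].

End Graded.

Definition fusion (A : seq nat) (z : seq K) : current_module :=
  gr_module (ev_tensor_lowest (zip A z)).
Definition fusion_vec (A : seq nat) (z : seq K) : fusion A z :=
  gr_class (ev_tensor_lowest (zip A z)) 0 (ev_tensor_lowest (zip A z)).

Definition fusion_points (A : seq nat) (z : seq K) :=
  (size z == size A) && uniq z.

(* The images of v under the unital subalgebra of End(V) generated by the
   operators satisfying P. *)
Definition generated (V : vectType K) (P : 'End(V) -> Prop) (v : V) : {vspace V} :=
  spanS (fun u => exists2 w : seq 'End(V), (forall f, f \in w -> P f) &
                    u = foldr (fun (f : 'End(V)) u' => f u') v w).

End CurrentModules.

(* Entries of A are numbered from 1, as in (a_1, ..., a_n). *)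
Definition entry (A : seq nat) (i : nat) : nat := nth 0%N A i.-1.

(* (a_1, ..., a_{i-1}, a_i - 1, a_{i+1} + 1, a_{i+2}, ..., a_n) *)
Definition seq_step (A : seq nat) (i : nat) : seq nat :=
  take i.-1 A ++ [:: (entry A i).-1; (entry A i.+1).+1] ++ drop i.+1 A.

(* (a_1, ..., a_{i-1}, a_i, ..., a_i), with n - i - 1 copies of a_i *)
Definition seq_left (A : seq nat) (i : nat) : seq nat :=
  take i.-1 A ++ nseq (size A - i - 1) (entry A i).

(* (a_{i+1} - a_i + 1, ..., a_n - a_i + 1) *)
Definition seq_right (A : seq nat) (i : nat) : seq nat :=
  [seq (a - entry A i + 1)%N | a <- drop i A].

(* Main.v *)
Require Import Defs.
From HB Require Import structures.
From mathcomp Require Import all_boot all_order all_algebra.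
From mathcomp Require Import boolp reals.
From mathcomp Require Import complex.
From mathcomp Require Import ssrcomplements mpoly zify ring.

(* Put e(z) = e_0 z + e_1 z^2 + ... and say that v satisfies the relations of A
   if [z^s] e(z)^r v = 0 for all s > sum_j min(r, a_j - 1).  A vector killed by
   the f_j, with h_j acting by scalars, that satisfies the relations of A
   generates a module of dimension at most prod_j a_j: with x <= y the two least
   of the a_j - 1 and w = e_{n-1}^x, if an ideal J contains the relations of A
   then J : w and J + (w) contain those obtained by replacing x, y with y - x and
   with x - 1, y + 1.  As v_A satisfies the relations of A and
   dim M^A = prod_j a_j, M^A is presented by them.

   For l >= 1 let d_l be the number of j with a_j > l (a column of A).  Let
   W(d) = M^{(2,...,2)} with d twos, and w_d its generator.  Then v_A |-> (x)_l w_{d_l}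
   defines an embedding of M^A into Z = (x)_l W(d_l), because the generated
   submodule has dimension at least prod_j a_j, by induction on the columns.
   Also w_{d-2} |-> e_{d-1} w_d defines an embedding of W(d-2) into W(d).

   Write Z = Z1 (x) Z2, where Z1 gathers the columns with l < a_i.  Then M^{A''}
   embeds into Z2, and M^{A'} into the tensor product of the W(d_l - 2), l < a_i,
   hence into Z1.  By the presentations, the kernel of M^A -> M^{A_{i,i+1}} is
   generated by the top coefficients of e(z)^k v_A, a_i - 1 <= k <= a_{i+1} - 1.
   In Z they become nonzero multiples of the images of
   v_{A'} (x) e_{n-i-1}^{k-a_i+1} v_{A''}, so S_{i,i+1}(A) and the submodule of
   M^{A'} (x) M^{A''} have the same image in Z. *)

Set Implicit Arguments.
Unset Strict Implicit.
Unset Printing Implicit Defensive.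

Import Order.TTheory GRing.Theory Num.Theory.
Local Open Scope ring_scope.

(** * Ideals and dimension bounds *)

(** The relations are the generators of I_A read backwards: the sum of the e_{n-1-i_1} ...
    e_{n-1-i_k} over i_1 + ... + i_k = s is the coefficient of z^{kn-s} in e(z)^k, and s < sum_j
    max(k+1-a_j, 0) means kn-s > sum_j min(k, a_j-1). Pairing e_j with z^{j+1} makes the bound
    independent of n.

    The obstacle is that S_{i,i+1}(A) is known only as a kernel with several generators, so no
    presentation yields a map out of it. Cyclic modules can be mapped by their relations. Hence
    everything is sent to Z, where it is enough to compare two subspaces generator by generator.

    Columns serve because on W(d) the bound on e(z)^r is d for every r >= 1: a column adds at most
    one to each of its d rows, and the binomial formula adds these up to sum_j min(r, a_j-1).

    The dimension bound is stated for arbitrary ideals satisfying the relations, since the recursion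
    through J : w and J + (w) leaves the ideals of fusion products. No quotient ring is formed:
    bounding dim P/J from above and knowing dim M^A identifies annihilators by counting. *)

Section Ideal.
Variables (K : numFieldType) (P : comAlgType K).

Record ideal (J : P -> Prop) : Prop := Ideal {
  ideal0 : J 0;
  idealD : forall p q, J p -> J q -> J (p + q);
  idealM : forall p q, J q -> J (p * q) }.

Definition colon (J : P -> Prop) w : P -> Prop := fun p => J (p * w).
Definition adjoin (J : P -> Prop) w : P -> Prop := fun p => exists q, J (p - q * w).

(** Bounds dim P/J by N without forming the quotient. *)
Definition spans (J : P -> Prop) (N : nat) := exists bs : seq P,
  (size bs <= N)%N /\ forall p, exists c : nat -> K, J (p - \sum_(i < size bs) c i *: bs`_i).

Lemma ideal_colon J w : ideal J -> ideal (colon J w).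
Proof.
case=> J0 JD JM; split; rewrite /colon ?mul0r // => p q.
  by rewrite mulrDl; apply: JD.
by rewrite -mulrA; apply: JM.
Qed.

Lemma ideal_adjoin J w : ideal J -> ideal (adjoin J w).
Proof.
case=> J0 JD JM; split; first by exists 0; rewrite mul0r subr0.
  by move=> p q [a pa] [b qb]; exists (a + b); rewrite mulrDl opprD addrACA; apply: JD.
by move=> p q [a qa]; exists (p * a); rewrite -mulrA -mulrBr; apply: JM.
Qed.

Variables (J : P -> Prop) (idJ : ideal J).

Lemma idealN p : J p -> J (- p).
Proof. by rewrite -mulN1r; apply: idealM. Qed.
Lemma idealB p q : J p -> J q -> J (p - q).
Proof. by move=> Jp Jq; apply: idealD => //; apply: idealN. Qed.
Lemma idealMr p q : J p -> J (p * q).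
Proof. by rewrite mulrC; apply: idealM. Qed.
Lemma idealZ c p : J p -> J (c *: p).
Proof. by rewrite -mulr_algl; apply: idealM. Qed.
Lemma ideal_sum (I : Type) (r : seq I) (Q : pred I) F :
  (forall i, Q i -> J (F i)) -> J (\sum_(i <- r | Q i) F i).
Proof. by move=> JF; apply: big_ind => //; [apply: ideal0|apply: idealD]. Qed.
Lemma idealMn p m : J p -> J (p *+ m).
Proof. by rewrite -scaler_nat; apply: idealZ. Qed.
Lemma ideal_divn p m : (0 < m)%N -> J (p *+ m) -> J p.
Proof.
move=> m0; rewrite -scaler_nat => /(idealZ (m%:R^-1)).
by rewrite scalerA mulVf ?scale1r // pnatr_eq0 -lt0n.
Qed.
Lemma ideal_congr p q : J (p - q) -> J q -> J p.
Proof. by move=> pq Jq; rewrite -(subrK q p); apply: idealD. Qed.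

Lemma ideal_addl p q : J (p + q) -> J q -> J p.
Proof. by move=> pq Jq; rewrite -(addrK q p); apply: idealB. Qed.

(** The exact sequence 0 -> P/(J:w) -> P/J -> P/(J+(w)) -> 0, whose first map is multiplication by
    w, bounds the middle dimension by the sum of the outer ones. *)
Lemma spans_adjoin w N1 N2 :
  spans (colon J w) N1 -> spans (adjoin J w) N2 -> spans J (N1 + N2).
Proof.
move=> [b1 [s1 h1]] [b2 [s2 h2]].
exists ([seq b * w | b <- b1] ++ b2); split; first by rewrite size_cat size_map leq_add.
move=> p; have [c2 [q hq]] := h2 p; have [c1 hc1] := h1 q.
exists (fun i => if (i < size b1)%N then c1 i else c2 (i - size b1)%N).
rewrite size_cat size_map big_split_ord /= opprD addrA.
have -> : \sum_(i < size b1) (if (i < size b1)%N then c1 i else c2 (i - size b1)%N) *: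
   ([seq b * w | b <- b1] ++ b2)`_i = (\sum_(i < size b1) c1 i *: b1`_i) * w.
  rewrite mulr_suml; apply: eq_bigr => i _.
  by rewrite ltn_ord nth_cat size_map ltn_ord (nth_map 0) // scalerAl.
have -> : \sum_(i < size b2) (if (size b1 + i < size b1)%N then c1 (size b1 + i)%N
      else c2 (size b1 + i - size b1)%N) *: ([seq b * w | b <- b1] ++ b2)`_(size b1 + i)%N
   = \sum_(i < size b2) c2 i *: b2`_i.
  apply: eq_bigr => i _.
  by rewrite ltnNge leq_addr /= nth_cat size_map ltnNge leq_addr /= addKn.
have := idealD idJ hq hc1; rewrite mulrBl; congr (J _).
by rewrite addrA subrK addrAC.
Qed.

Definition degJ (p : {poly P}) D := forall s, (D < s)%N -> J p`_s.

Lemma degJ_leq (p : {poly P}) D D' : (D <= D')%N -> degJ p D -> degJ p D'.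
Proof. by move=> DD h s sD; apply: h; apply: leq_ltn_trans sD. Qed.
Lemma degJ_size (p : {poly P}) D : (size p <= D.+1)%N -> degJ p D.
Proof. by move=> sp s Ds; rewrite nth_default; [apply: ideal0 | apply: leq_trans Ds]. Qed.
Lemma degJ_sum (I : Type) (r : seq I) (Q : pred I) (F : I -> {poly P}) D :
  (forall i, Q i -> degJ (F i) D) -> degJ (\sum_(i <- r | Q i) F i) D.
Proof. by move=> h s sD; rewrite coef_sum; apply: ideal_sum => i Qi; apply: h. Qed.
Lemma degJMn (p : {poly P}) D m : degJ p D -> degJ (p *+ m) D.
Proof. by move=> h s sD; rewrite coefMn; apply: idealMn; apply: h. Qed.
Lemma degJN (p : {poly P}) D : degJ p D -> degJ (- p) D.
Proof. by move=> h s sD; rewrite coefN; apply: idealN; apply: h. Qed.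
Lemma degJM (p q : {poly P}) D D' : degJ p D -> degJ q D' -> degJ (p * q) (D + D').
Proof.
move=> hp hq s sD; rewrite coefM; apply: ideal_sum => i _.
have [Di|iD] := ltnP D i; first by apply: idealMr; apply: hp.
by apply: idealM => //; apply: hq; move: (ltn_ord i) => ?; lia.
Qed.
Lemma degJX (p : {poly P}) D r : degJ p D -> degJ (p ^+ r) (D * r).
Proof.
move=> h; elim: r => [|r IH]; first by apply: degJ_size; rewrite expr0 size_poly1 muln0.
by rewrite exprS mulnS; apply: degJM.
Qed.

Definition eqJ (p q : {poly P}) := forall s, J (p`_s - q`_s).

Lemma eqJ_exp (p q : {poly P}) r : eqJ p q -> eqJ (p ^+ r) (q ^+ r).
Proof.
move=> h s; rewrite -coefB subrXX coefM; apply: ideal_sum => i _.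
by apply: idealMr; rewrite coefB; apply: h.
Qed.
Lemma eqJ_deg (p q : {poly P}) D : eqJ p q -> degJ q D -> degJ p D.
Proof. by move=> h hq s sD; apply: (ideal_congr (h s)); apply: hq. Qed.

Lemma eqJ_sym (p q : {poly P}) : eqJ p q -> eqJ q p.
Proof. by move=> h s; rewrite -opprB; apply: idealN. Qed.

End Ideal.

(** * The relations at each level, and their behaviour under J : w and J + (w) *)

Section Current.
Variables (K : numFieldType) (P : comAlgType K) (e : nat -> P).

(** This is e(z) cut after e_{n-1}, with its first k terms removed and divided by z^k. For every k <
    n its top coefficient is e_{n-1}, so that powers of one element w serve all levels at once. *)
Definition lvl k n : {poly P} := \poly_(i < (n - k).+1) (if i is j.+1 then e (k + j) else 0).

Definition bnd (xi : seq nat) r := (\sum_(x <- xi) minn r x)%N.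

(** Here xi lists the a_j - 1. The number n of variables is kept apart from [size xi], because
    variables are dropped and restored ([cond_shrink], [cond_grow]) while xi stays the same. *)
Definition cond n xi (J : P -> Prop) :=
  (forall j, (n <= j)%N -> J (e j)) /\ forall r, degJ J (lvl 0 n ^+ r) (bnd xi r).

Lemma lvl_split k n : (k <= n)%N -> lvl 0 n = lvl 0 k + 'X^k * lvl k n.
Proof.
move=> kn; apply/polyP => s; rewrite coefD coefXnM !coef_poly !subn0.
case: (ltnP s k) => sk; first by rewrite !ltnS addr0 (ltnW sk) (leq_trans (ltnW sk) kn).
have [->|nsk] := eqVneq s k.
  by rewrite subnn ltnS kn ltnSn /= addr0.
have ks : (k < s)%N by rewrite ltn_neqAle eq_sym nsk.
rewrite (_ : (s < k.+1)%N = false) ?add0r; last by lia.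
rewrite (_ : (s - k < (n - k).+1)%N = (s < n.+1)%N); last by lia.
case: ifP => // _; case: s ks {nsk sk} => // s; rewrite ltnS => ks.
by rewrite subSn //= add0n subnKC.
Qed.

Lemma size_lvl k n : (size (lvl k n) <= (n - k).+1)%N.
Proof. exact: size_poly. Qed.

Lemma bnd_level xi r k : (k <= size xi)%N ->
  (bnd xi r <= r * k + sumn (take (size xi - k) xi))%N.
Proof.
move=> kn; rewrite /bnd -{1}(cat_take_drop (size xi - k) xi) big_cat /= addnC leq_add //.
  apply: leq_trans (_ : \sum_(x <- drop (size xi - k) xi) r <= _)%N.
    by apply: leq_sum => x _; rewrite geq_minl.
  by rewrite big_const_seq count_predT size_drop iter_addn_0 subKn.
by rewrite sumnE; apply: leq_sum => x _; rewrite geq_minr.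
Qed.

(** Expand the r-th power of [lvl 0 n - lvl 0 k]. In the term with i factors [lvl 0 k] the relations
    bound the other factor by k(r-i) plus the first n-k entries, and [lvl 0 k] has degree at most k.
    Dividing by z^{rk} leaves a bound that does not depend on r, as [top_coef_deg] requires. *)
Lemma cond_level n xi J k : ideal J -> size xi = n -> cond n xi J -> (k <= n)%N ->
  forall r, degJ J (lvl k n ^+ r) (sumn (take (n - k) xi)).
Proof.
move=> idJ sx [_ hY] kn r s Ks.
have -> : (lvl k n ^+ r)`_s = (('X^k * lvl k n) ^+ r)`_(r * k + s).
  by rewrite exprMn -exprM coefXnM ltnNge mulnC leq_addr /= addKn.
have -> : 'X^k * lvl k n = lvl 0 n - lvl 0 k by rewrite (lvl_split kn) addrC addKr.
rewrite exprDn; apply: (@degJ_sum _ _ _ idJ _ _ _ _ (r * k + sumn (take (n - k) xi))); last by lia.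
move=> i _; apply: degJMn => //.
have ir : (i <= r)%N by rewrite -ltnS ltn_ord.
apply: (@degJ_leq _ _ _ _ (bnd xi (r - i) + k * i)).
  have := bnd_level (r - i) (k := k) (xi := xi); rewrite sx => /(_ kn).
  have -> : (r * k = (r - i) * k + k * i)%N by rewrite [(k * i)%N]mulnC -mulnDl subnK.
  by lia.
apply: degJM => //; apply: degJX => //; apply: degJN => //.
by apply: degJ_size => //; apply: leq_trans (size_lvl _ _) _; rewrite subn0.
Qed.

(* Comparing the coefficients of y^(r+1) = y y^r and of its derivative
   (r+1) y' y^r in the two highest degrees gives two independent linear
   relations between c [z^(D-1)] y^r and y_(q-1) [z^D] y^r. *)
Lemma top_coef_deg J (y : {poly P}) q D : ideal J -> (size y <= q.+3)%N ->
  (forall r, degJ J (y ^+ r) D) ->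
  forall r s, (D < s + 2)%N -> J ((y ^+ r)`_s * y`_q.+2).
Proof.
move=> idJ sy h r s Ds.
have [sD|sD] := ltnP D s; first by apply: idealMr => //; apply: h.
set a := (y ^+ r)`_s.
have y0 i : (q.+2 < i)%N -> y`_i = 0 by move=> ?; apply: nth_default; apply: leq_trans sy _.
have low t : (D < t)%N -> (y ^+ r)`_t * y`_q.+2 = 0 \/ J ((y ^+ r)`_t).
  by move=> Dt; right; apply: h.
have [sE|sE] : s = D \/ s.+1 = D by lia.
  have := h r.+1 (D + q.+2)%N; rewrite exprSr coefM => /(_ ltac:(lia)).
  have Do : (D < (D + q.+2).+1)%N by lia.
  rewrite (bigD1 (Ordinal Do)) //= addKn => H.
  rewrite /a sE; apply: (ideal_addl idJ H).
  apply: ideal_sum => // i; rewrite -val_eqE /= => iD.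
  have [Di|] := ltnP D i; first by apply: idealMr => //; apply: h.
  move=> Di; rewrite y0 ?mulr0; first exact: ideal0.
  by lia.
set b := (y ^+ r)`_D * y`_q.+1.
have E1 : J (a * y`_q.+2 + b).
  have := h r.+1 (D + q.+1)%N; rewrite exprSr coefM => /(_ ltac:(lia)).
  have so : (s < (D + q.+1).+1)%N by lia.
  have Do : (D < (D + q.+1).+1)%N by lia.
  rewrite (bigD1 (Ordinal so)) //= (bigD1 (Ordinal Do)) /=; last by rewrite -val_eqE /=; lia.
  rewrite addKn (_ : D + q.+1 - s = q.+2)%N; last by lia.
  rewrite addrA => H; apply: (ideal_addl idJ H); apply: ideal_sum => // i.
  rewrite -!val_eqE /= => /andP [is_ iD].
  have [Di|] := ltnP D i; first by apply: idealMr => //; apply: h.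
  move=> Di; rewrite y0 ?mulr0; first exact: ideal0.
  by lia.
have E2 : J (a * y`_q.+2 *+ q.+2 + b *+ q.+1).
  have Jt : J ((y ^+ r.+1)`_(D + q.+1)) by apply: h; lia.
  have : J (((y ^+ r.+1)^`())`_(D + q)).
    by rewrite coef_deriv -addnS; apply: idealMn.
  rewrite deriv_exp mulrC -mulrnAr /= coefMn => /(ideal_divn idJ (ltn0Sn r)).
  have so : (s < (D + q).+1)%N by lia.
  have Do : (D < (D + q).+1)%N by lia.
  rewrite coefM (bigD1 (Ordinal so)) //= (bigD1 (Ordinal Do)) /=; last by rewrite -val_eqE /=; lia.
  rewrite addKn (_ : D + q - s = q.+1)%N; last by lia.
  rewrite !coef_deriv -!mulrnAr addrA => H; apply: (ideal_addl idJ H); apply: ideal_sum => // i.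
  rewrite -!val_eqE /= => /andP [is_ iD].
  have [Di|] := ltnP D i; first by apply: idealMr => //; apply: h.
  move=> Di; rewrite coef_deriv y0 ?mul0rn ?mulr0; first exact: ideal0.
  by lia.
have -> : a * y`_q.+2 = (a * y`_q.+2 *+ q.+2 + b *+ q.+1) - (a * y`_q.+2 + b) *+ q.+1.
  by rewrite mulrnDl opprD addrACA subrr addr0 -mulrnBr // subSnn.
by apply: idealB => //; apply: idealMn.
Qed.

Lemma lvl_trunc J k n : ideal J -> J (e n) -> (k <= n)%N -> eqJ J (lvl k n) (lvl k n.+1).
Proof.
move=> idJ Jn kn s; rewrite !coef_poly subSn //.
have -> : (s < (n - k).+2)%N = (s == (n - k).+1) || (s < (n - k).+1)%N.
  by rewrite [LHS]ltnS leq_eqVlt.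
case: (eqVneq s (n - k).+1) => [->|_] /=; last by rewrite subrr; apply: ideal0.
by rewrite ltnn sub0r subnKC //; apply: idealN.
Qed.

Lemma size_lvl_top k n : (k < n)%N -> (lvl k n)`_(n - k) = e n.-1.
Proof.
by case: n => // n; rewrite ltnS => kn; rewrite coef_poly subSn // ltnSn /= subnKC.
Qed.

(** Each factor of the top coefficient c = y_{q+2} lowers the common degree bound of the powers of y
    by two: by [top_coef_deg], the hypothesis passes from J and D to J : c and D - 2. *)
Lemma colon_exp_deg J (y : {poly P}) q D m : ideal J -> (size y <= q.+3)%N ->
  (forall r, degJ J (y ^+ r) D) ->
  forall r s, (D < s + m.*2)%N -> J ((y ^+ r)`_s * y`_q.+2 ^+ m).
Proof.
move=> idJ sy; elim: m J D idJ => [|m IH] J D idJ h r s.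
  by rewrite addn0 expr0 mulr1; apply: h.
rewrite doubleS => Ds; rewrite exprS mulrCA mulrC.
(* For D < 2 the subtraction D - 2 would truncate; but then c lies in J, being the coefficient of y
   in degree q+2 > D. *)
have [D2|D2] := ltnP D 2.
  by apply: (idealM idJ); have := h 1%N q.+2; rewrite expr1; apply; lia.
have idc := ideal_colon y`_q.+2 idJ.
apply: (IH _ (D - 2)%N idc _ r s) => [{}r {}s {}Ds|]; last by lia.
by apply: (top_coef_deg idJ sy h); lia.
Qed.

Lemma bnd_sorted xi r : sorted leq xi ->
  bnd xi r = (r * (size xi - find (leq r) xi) + sumn (take (find (leq r) xi) xi))%N.
Proof.
rewrite /bnd; elim: xi => [|x xi IH]; first by rewrite big_nil muln0.
rewrite big_cons => /= pxi; case: (leqP r x) => rx /=.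
  rewrite addn0 mulnS; congr addn.
  rewrite big_seq (eq_bigr (fun=> r)); last first.
    move=> y yxi; apply/minn_idPl; apply: leq_trans rx _.
    exact: (allP (order_path_min leq_trans pxi)).
  by rewrite -big_seq big_const_seq count_predT iter_addn_0.
rewrite IH ?(path_sorted pxi) // subSS; lia.
Qed.

(** Converse of [cond_level]. For given r take as level k the number of entries that are at least r:
    for sorted xi, [bnd xi r] is then exactly k r plus the sum of the other entries. *)
Lemma cond_of_level n xi J : ideal J -> size xi = n -> sorted leq xi ->
  (forall j, (n <= j)%N -> J (e j)) ->
  (forall k, (k < n)%N -> forall r, degJ J (lvl k n ^+ r) (sumn (take (n - k) xi))) ->
  cond n xi J.
Proof.
move=> idJ sx sxi Jn h; split=> // r; rewrite bnd_sorted // sx.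
set f := find _ _; have fn : (f <= n)%N by rewrite -sx find_size.
have -> : take f xi = take (n - (n - f)) xi by rewrite subKn.
set k := (n - f)%N; have kn : (k <= n)%N by rewrite leq_subr.
have hk i : degJ J (lvl k n ^+ i) (sumn (take (n - k) xi)).
  have [/h //|nk] := ltnP k n.
  have -> : k = n by apply/eqP; rewrite eqn_leq kn.
  apply: degJ_size => //; rewrite subnn take0 /=.
  have -> : lvl n n = 0.
    by apply/polyP => -[|s]; rewrite coef_poly coef0 // subnn.
  by rewrite expr0n; case: eqP => _; rewrite ?size_poly1 ?size_poly0.
rewrite (lvl_split kn) exprDn; apply: degJ_sum => // i _; apply: degJMn => //.
have ir : (i <= r)%N by rewrite -ltnS ltn_ord.
rewrite exprMn; apply: (@degJ_leq _ _ _ _ (k * (r - i) + (k * i + sumn (take (n - k) xi)))).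
  by rewrite addnA -mulnDr subnK // [(k * r)%N]mulnC.
apply: degJM => //.
  by apply: degJX => //; apply: degJ_size => //; have := size_lvl 0 k; rewrite subn0.
apply: degJM => //; apply: degJ_size => //.
by rewrite -exprM size_polyXn.
Qed.

Lemma cond_perm n xi xi' J : perm_eq xi xi' -> cond n xi J -> cond n xi' J.
Proof.
move=> pxi [Jn h]; split=> // r; have -> : bnd xi' r = bnd xi r by apply/esym/perm_big.
exact: h.
Qed.

Lemma cond_shrink n xi J : ideal J -> J (e n) -> cond n.+1 xi J -> cond n xi J.
Proof.
move=> idJ Jn [Js h]; split=> [j|r].
  by rewrite leq_eqVlt => /orP [/eqP <- //|]; apply: Js.
by apply: (eqJ_deg idJ) (h r); apply: eqJ_exp => //; apply: lvl_trunc.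
Qed.

Lemma cond_grow n m xi J : ideal J -> (n <= m)%N -> cond n xi J -> cond m xi J.
Proof.
move=> idJ; elim: m => [|m IH]; first by rewrite leqn0 => /eqP ->.
rewrite leq_eqVlt => /orP [/eqP -> //|nm] h; have [Jm hm] := IH nm h.
split=> [j mj|r]; first by apply: Jm; apply: ltnW.
apply: (eqJ_deg idJ) (hm r); apply: eqJ_exp => //; apply: eqJ_sym => //.
by apply: lvl_trunc => //; apply: Jm.
Qed.

(** At level n only e_n z is left of e(z), and the degree bound is the first entry m, whatever the
    order of the list. *)
Lemma cond_top n xi J m : ideal J -> cond n.+1 (m :: xi) J -> size xi = n ->
  J (e n ^+ m.+1).
Proof.
move=> idJ h sx; have := cond_level (k := n) idJ (_ : size (m :: xi) = n.+1) h.
rewrite /= sx subSnn /= take0 /= addn0 => /(_ erefl (leqnSn _) m.+1 m.+1 (ltnSn m)).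
have -> : lvl n n.+1 = e n *: 'X.
  apply/polyP => s; rewrite coef_poly subSnn coefZ coefX.
  by case: s => [|[|s]] //=; rewrite ?mulr0 ?mulr1 ?addn0.
by rewrite exprZn coefZ coefXn eqxx mulr1.
Qed.

(** At a level k <= n the bound contains both x and y. Multiplying by the x-th power of the top
    coefficient lowers it by 2x, which leaves y - x in place of x + y. Moreover e_{n+1} itself lies
    in J : e_{n+1}^x, so one variable disappears together with one entry. *)
Lemma cond_colon n x y xi J : ideal J -> size xi = n -> sorted leq [:: x, y & xi] ->
  cond n.+2 [:: x, y & xi] J -> cond n.+1 (y - x :: xi)%N (colon J (e n.+1 ^+ x)).
Proof.
move=> idJ sx sxi h.
have idc := ideal_colon (e n.+1 ^+ x) idJ.
have Jn : colon J (e n.+1 ^+ x) (e n.+1).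
  by rewrite /colon -exprS; apply: (cond_top idJ h); rewrite /= sx.
apply: cond_of_level; rewrite //= ?sx //.
- move: sxi => /= /andP [xy]; case: xi {sx h} => //= z xi /andP [yz ->].
  by rewrite (leq_trans (leq_subr _ _) yz).
- move=> j; rewrite leq_eqVlt => /orP [/eqP <- //|nj].
  by apply: (idealMr idJ); apply: h.1.
move=> k; rewrite ltnS => kn r.
apply: (eqJ_deg idc (eqJ_exp idc r (lvl_trunc idc Jn (leqW kn)))) => s.
rewrite subSn //= => Ks; rewrite /colon.
have -> : e n.+1 = (lvl k n.+2)`_(n - k).+2.
  by rewrite -(@size_lvl_top k n.+2) ?ltnS ?(leqW kn) // !subSn // leqW.
have hk : (k <= n.+2)%N by rewrite !leqW.
have sxy : (x <= y)%N by case/andP: sxi.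
apply: (colon_exp_deg idJ _ (cond_level idJ _ h hk)); rewrite /= ?sx //.
  by apply: leq_trans (size_lvl _ _) _; rewrite !subSn // leqW.
by move: Ks; rewrite !subSn ?leqW //= -!addnn; lia.
Qed.

Lemma adjoin_sub (J : P -> Prop) w p : ideal J -> J p -> adjoin J w p.
Proof. by move=> idJ Jp; exists 0; rewrite mul0r subr0. Qed.

(** The old and new bounds differ only for x < r <= y, and there by one, so a single new coefficient
    must be shown to vanish, that of degree s = r(n+1) + x + 1. Split off the last term e_{n+1}
    z^{n+2} of e(z): products with more than x such factors are multiples of w = e_{n+1}^{x+1}, and
    those with i <= x factors have degree at most r(n+1) + i < s. *)
Lemma cond_adjoin n x y xi J : ideal J -> size xi = n ->
  all (leq y) xi -> (x < y)%N ->
  cond n.+2 [:: x.+1, y & xi] J -> cond n.+2 [:: x, y.+1 & xi] (adjoin J (e n.+1 ^+ x.+1)).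
Proof.
move=> idJ sx yxi xy [Jn h]; have ida := ideal_adjoin (e n.+1 ^+ x.+1) idJ.
split=> [j nj|r s Ds]; first by apply: adjoin_sub => //; apply: Jn.
have [Ds'|Ds'] := ltnP (bnd [:: x.+1, y & xi] r) s; first by apply: adjoin_sub => //; apply: h.
have bl zs : (bnd zs r <= r * size zs)%N.
  apply: leq_trans (_ : \sum_(z <- zs) r <= _)%N.
    by apply: leq_sum => z _; rewrite geq_minl.
  by rewrite big_const_seq count_predT iter_addn_0.
have [rx ry] : (x < r)%N /\ (r <= y)%N.
  by move: Ds Ds'; rewrite /bnd !big_cons; lia.
have bxi : bnd xi r = (r * n)%N.
  rewrite /bnd big_seq (eq_bigr (fun=> r)); last first.
    by move=> z zxi; apply/minn_idPl/(leq_trans ry)/(allP yxi).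
  by rewrite -big_seq big_const_seq count_predT iter_addn_0 sx.
have sE : s = (r * n.+1 + x.+1)%N.
  by move: Ds Ds'; rewrite /bnd !big_cons -/(bnd xi r) bxi; lia.
rewrite (lvl_split (leqnSn n.+1)) exprDn coef_sum.
apply: ideal_sum => // i _; rewrite coefMn; apply: idealMn => //.
have -> : lvl n.+1 n.+2 = e n.+1 *: 'X.
  apply/polyP => t; rewrite coef_poly subSnn coefZ coefX.
  by case: t => [|[|t]] //=; rewrite ?mulr0 ?mulr1 ?addn0.
rewrite -scalerAr exprZn -scalerAr coefZ.
have ir : (i <= r)%N by rewrite -ltnS ltn_ord.
have [xi_|ix] := ltnP x i.
  move: (nth 0 _ s) => c; exists (e n.+1 ^+ (i - x.+1) * c).
  by rewrite mulrAC -exprD subnK // subrr; apply: ideal0.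
apply: adjoin_sub => //; apply: (idealM idJ).
rewrite nth_default; first exact: ideal0.
apply: leq_trans (size_polyMleq _ _) _.
rewrite -exprSr -exprM size_polyXn addnS /=.
have sl : (size (lvl 0 n.+1 ^+ (r - i)) <= (n.+1 * (r - i)).+1)%N.
  apply: leq_trans (size_poly_exp_leq _ _) _; rewrite ltnS leq_mul2r.
  by apply/orP; right; have := size_lvl 0 n.+1; rewrite subn0; lia.
have : (n.+1 * (r - i) + n.+2 * i = r * n.+1 + i)%N.
  by have := subnK ir; move: (r - i)%N => d; nia.
move: sl; move: (n.+1 * (r - i))%N (n.+2 * i)%N (r * n.+1)%N sE => a b c -> sl abc.
by apply: leq_trans (leq_add sl (leqnn _)) _; rewrite addSn abc -addnS leq_add2l.
Qed.

(** Expresses that the e_j generate P as a unital algebra: modulo all of them only scalars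
    remain. *)
Hypothesis gen : forall J, ideal J -> (forall j, J (e j)) -> spans J 1.

(* With x <= y the two least entries of xi and w = e_(n-1)^x, the count is
   (x+1)(y+1) = (y-x+1) + x(y+2), the two terms bounding J : w and J + (w). *)
Lemma cond_spans n xi J : ideal J -> size xi = n -> cond n xi J ->
  spans J (\prod_(x <- xi) x.+1).
Proof.
elim: n xi J => [|n IH] xi J idJ sx h.
  by rewrite (size0nil sx) big_nil; apply: gen => // j; apply: h.1.
have [xi' pxi sxi'] : exists2 xi', perm_eq xi xi' & sorted leq xi'.
  by exists (sort leq xi); [rewrite perm_sym perm_sort|apply: sort_sorted; apply: leq_total].
have -> : (\prod_(x <- xi) x.+1 = \prod_(x <- xi') x.+1)%N by apply: perm_big.
have {h} := cond_perm pxi h; move: sx; rewrite (perm_size pxi).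
case: xi' sxi' {pxi} => // x l /(order_path_min leq_trans) xl [sl].
elim: x l J idJ sl xl => [|x IHx] l J idJ sl xl h.
  rewrite big_cons mul1n; apply: IH => //; apply: cond_shrink => //.
    by have := cond_top idJ h sl; rewrite expr1.
  by case: h => Jn h; split=> // r; have := h r; rewrite /bnd big_cons minn0.
case: n IH IHx sl h => [|n] IH IHx sl h.
  (* With a single entry there is no y to pair with. Then w = e_0 is used, which lowers the entry by
     one and leaves a quotient of dimension at most one. *)
  rewrite (size0nil sl) big_seq1; have he := cond_top idJ h sl.
  rewrite -add1n addnC; apply: (@spans_adjoin _ _ _ idJ (e 0%N)); last first.
    apply: gen; first exact: ideal_adjoin.
    case=> [|j]; first by exists 1; rewrite mul1r subrr; apply: ideal0.
    by apply: adjoin_sub => //; apply: h.1.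
  have -> : x.+1 = (\prod_(x <- [:: x]) x.+1)%N by rewrite big_seq1.
  apply: IHx => //; first exact: ideal_colon.
  apply: cond_of_level => //; first exact: ideal_colon.
    by move=> j j0; apply: (idealMr idJ); apply: h.1.
  case=> // _ r s; rewrite /= addn0 => xs; rewrite /colon.
  have -> : lvl 0 1 = e 0%N *: 'X.
    apply/polyP => t; rewrite coef_poly subn0 coefZ coefX.
    by case: t => [|[|t]] //=; rewrite ?mulr0 ?mulr1.
  rewrite exprZn coefZ coefXn; case: eqP => [sr|_]; last first.
    by rewrite mulr0 mul0r; apply: ideal0.
  rewrite mulr1 -exprSr -(subnK (_ : (x.+2 <= r.+1)%N)); last by rewrite -sr ltnS.
  by rewrite exprD; apply: (idealM idJ).
have [l' pl sl'] : exists2 l', perm_eq l l' & sorted leq l'.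
  by exists (sort leq l); [rewrite perm_sym perm_sort|apply: sort_sorted; apply: leq_total].
move: sl xl; rewrite (perm_size pl) (perm_all _ pl) => sl xl.
have {h} h : cond n.+2 (x.+1 :: l') J by apply: cond_perm h; rewrite perm_cons.
rewrite big_cons (perm_big _ pl) -(big_cons _ _ x.+1 l' xpredT (fun x => x.+1)).
case: l' {pl} sl' sl xl h => // y l' sl' [sl] xl h.
have yl' := order_path_min leq_trans sl'.
have xy : (x < y)%N by case/andP: xl.
have -> : (\prod_(z <- [:: x.+1, y & l']) z.+1 =
   \prod_(z <- (y - x.+1 :: l')%N) z.+1 + \prod_(z <- [:: x, y.+1 & l']) z.+1)%N.
  rewrite !big_cons; move: (\prod_(_ <- _) _)%N => N.
  rewrite !mulnA -mulnDl; congr muln.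
  by have := subnK xy; move: (y - x.+1)%N => d <-; ring.
apply: (spans_adjoin idJ (w := e n.+1 ^+ x.+1)).
  apply: IH; first exact: ideal_colon.
    by rewrite /= sl.
  by apply: cond_colon => //=; rewrite xy.
apply: IHx; first exact: ideal_adjoin.
- by rewrite /= sl.
- by rewrite /= (ltnW (leqW xy)); apply/allP => z /(allP yl'); apply: leq_trans (ltnW xy).
exact: cond_adjoin.
Qed.

End Current.

(** * Polynomials acting through commuting operators *)

Section PolyVars.
Variables (K : numFieldType) (N : nat).

Definition pvar (j : nat) : {mpoly K[N]} :=
  if insub j is Some i then 'X_i else 0.

Lemma pvar_ge j : (N <= j)%N -> pvar j = 0.
Proof. by move=> Nj; rewrite /pvar insubF // ltnNge Nj. Qed.

Lemma pvar_ord (i : 'I_N) : pvar i = 'X_i.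
Proof. by rewrite /pvar valK. Qed.

Lemma pvar_gen (J : {mpoly K[N]} -> Prop) : ideal J -> (forall j, J (pvar j)) -> spans J 1.
Proof.
move=> idJ Jv; exists [:: 1]; split=> // p; exists (fun=> p@_0%MM).
rewrite big_ord1 /= {1}[p]mpolyE -mpolyX0.
have -> : p@_0%MM *: 'X_[0] = \sum_(m <- msupp p | m == 0%MM) p@_m *: 'X_[m] :> {mpoly K[N]}.
  rewrite (eq_bigr (fun=> p@_0%MM *: 'X_[0])) => [|m /eqP -> //].
  rewrite -big_filter; have [p0|p0] := boolP (0%MM \in msupp p).
    by rewrite (filter_pred1_uniq (msupp_uniq p) p0) big_seq1.
  by rewrite (memN_msupp_eq0 p0) scale0r big1.
rewrite (bigID (fun m => m == 0%MM)) /= addrC addrK.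
apply: ideal_sum => // m m0; apply: idealZ => //.
have [i mi] : exists i, m i != 0%N.
  apply/existsP; apply: contraR m0 => /existsPn mi.
  by apply/eqP/mnmP => i; rewrite mnm0E; apply/eqP/negPn/mi.
have iem : (U_(i) <= m)%MM by rewrite lep1mP.
by rewrite -(submK iem) mpolyXD; apply: idealM => //; rewrite -pvar_ord.
Qed.

Lemma pvar_level (J : {mpoly K[N]} -> Prop) xi : ideal J -> (size xi <= N)%N ->
  (forall r, degJ J (lvl pvar 0 N ^+ r) (bnd xi r)) -> cond pvar (size xi) xi J.
Proof.
move=> idJ sN h; suff H d n : (N - n)%N = d -> (size xi <= n <= N)%N -> cond pvar n xi J.
  by apply: (H (N - size xi)%N) => //; rewrite leqnn.
elim: d n => [|d IH] n En /andP [sn nN].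
  have -> : n = N by lia.
  split=> // j Nj; rewrite pvar_ge //; exact: ideal0.
apply: cond_shrink => //.
  have nN' : (n.+1 < N.+1)%N by lia.
  have := h 1%N n.+1; rewrite expr1 coef_poly subn0 nN' /=; apply.
  apply: leq_ltn_trans (_ : \sum_(x <- xi) 1 < _)%N.
    by apply: leq_sum => x _; rewrite geq_minl.
  by rewrite sum1_size.
by apply: IH => //; lia.
Qed.

End PolyVars.

Section PolyAction.
Variables (K : numFieldType) (V : vectType K) (N : nat) (E : nat -> 'End(V)).
Hypothesis commE : forall i j u, E i (E j u) = E j (E i u).

Definition monact (m : 'X_{1..N}) (u : V) : V :=
  foldr (fun (i : 'I_N) w => iter (m i) (E i) w) u (enum 'I_N).

Definition pact (p : {mpoly K[N]}) (u : V) : V :=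
  \sum_(m <- msupp p) p@_m *: monact m u.

Lemma pactE p k u : (msize p <= k)%N ->
  pact p u = \sum_(m : 'X_{1..N < k}) p@_m *: monact m u.
Proof.
move=> le_pk; set I : subFinType _ := 'X_{1..N < k}.
rewrite /pact (big_mksub I) ?msupp_uniq //=; first last.
  by move=> x /msize_mdeg_lt /leq_trans; apply.
by rewrite big_rmcond //= => j /memN_msupp_eq0 ->; rewrite scale0r.
Qed.

Lemma pactP c p q u : pact (c *: p + q) u = c *: pact p u + pact q u.
Proof.
set k := maxn (msize (c *: p + q)) (maxn (msize p) (msize q)).
rewrite !(pactE (k := k)) /k ?leq_max ?leqnn ?orbT //.
rewrite scaler_sumr -big_split /=; apply: eq_bigr => m _.
by rewrite mcoeffD mcoeffZ scalerDl scalerA.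
Qed.

Lemma pact0 u : pact 0 u = 0.
Proof. by rewrite /pact msupp0 big_nil. Qed.
Lemma pactD p q u : pact (p + q) u = pact p u + pact q u.
Proof. by have := pactP 1 p q u; rewrite !scale1r. Qed.
Lemma pactZ c p u : pact (c *: p) u = c *: pact p u.
Proof. by have := pactP c p 0 u; rewrite pact0 !addr0. Qed.
Lemma pact_sum (I : Type) (r : seq I) (Q : pred I) F u :
  pact (\sum_(i <- r | Q i) F i) u = \sum_(i <- r | Q i) pact (F i) u.
Proof.
elim/big_rec2: _ => [|i x y _ <-]; first exact: pact0.
exact: pactD.
Qed.
Lemma pactX m u : pact 'X_[m] u = monact m u.
Proof. by rewrite /pact msuppX big_seq1 mcoeffX eqxx scale1r. Qed.

Lemma monact_linear m : linear (monact m).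
Proof.
rewrite /monact => c u w; elim: (enum _) => //= i s ->.
by elim: (m i) => //= k ->; rewrite linearP.
Qed.

Lemma iterEC i k j l u : iter k (E i) (iter l (E j) u) = iter l (E j) (iter k (E i) u).
Proof.
elim: k => //= k ->; elim: l => //= l IH.
by rewrite commE IH.
Qed.

Lemma monactD m1 m2 u : monact (m1 + m2) u = monact m1 (monact m2 u).
Proof.
rewrite /monact; elim: (enum 'I_N) => //= i s ->.
rewrite mnmDE iterD; congr (iter _ _ _).
move: (foldr _ u s) => w; by elim: s => //= j s <-; rewrite iterEC.
Qed.

Lemma pactM p q u : pact (p * q) u = pact p (pact q u).
Proof.
rewrite [p]mpolyE mulr_suml !pact_sum; apply: eq_bigr => m _.
rewrite -scalerAl !pactZ; congr (_ *: _).
rewrite [q]mpolyE mulr_sumr !pact_sum pactX.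
have lin0 : monact m 0 = 0.
  by have := monact_linear m 1 0 0; rewrite !scale1r !addr0 => h; rewrite -(addrK (monact m 0) (monact m 0)) -h subrr.
elim/big_rec2: _ => [|m' x y _ ->]; first by rewrite lin0.
rewrite -scalerAr !pactZ !pactX monact_linear -monactD; congr (_ *: _ + _).
by rewrite -mpolyXD pactX.
Qed.

Lemma pact1 u : pact 1 u = u.
Proof.
rewrite -mpolyX0 pactX /monact; elim: (enum _) => //= i s ->.
by rewrite mnm0E.
Qed.

Lemma pact_var j u : pact (pvar K N j) u = if (j < N)%N then E j u else 0.
Proof.
case: ltnP => jN; last by rewrite pvar_ge // pact0.
rewrite (pvar_ord K (Ordinal jN)) pactX /monact.
set i0 : 'I_N := Ordinal jN.
have : i0 \in enum 'I_N by rewrite mem_enum.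
have := enum_uniq 'I_N; elim: (enum _) => //= i s IH /andP [ns us].
rewrite inE => /orP [/eqP i0i|i0s]; last first.
  rewrite IH // mnm1E; case: eqP => //= ii; by move: ns; rewrite -ii i0s.
rewrite -i0i mnm1E eqxx /=; congr (E _ _).
move: ns; rewrite -i0i; elim: s {IH us} => //= i' s IH.
rewrite inE negb_or => /andP [i0i' /IH ->].
by rewrite mnm1E (negPf i0i').
Qed.

(* [ypow r s] is the coefficient of z^s in (\sum_j E_j z^(j+1))^r. *)
Fixpoint ypow r s (u : V) : V :=
  if r is r'.+1 then \sum_(j < s) E j (ypow r' (s - j.+1)%N u) else if s is 0 then u else 0.

Lemma ypowS r s u : ypow r.+1 s u = \sum_(j < s) E j (ypow r (s - j.+1)%N u).
Proof. by []. Qed.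

Hypothesis truncE : forall j, (N <= j)%N -> E j = 0.

Lemma pact_pvar j u : pact (pvar K N j) u = E j u.
Proof. by rewrite pact_var; case: ltnP => // /truncE ->; rewrite lfunE. Qed.

Lemma pact_lvl r s u : pact ((lvl (pvar K N) 0 N ^+ r)`_s) u = ypow r s u.
Proof.
elim: r s => [|r IH] s.
  by rewrite expr0 coef1; case: s => [|s] /=; rewrite ?pact1 ?pact0.
rewrite exprS coefM big_ord_recl coef_poly /= mul0r add0r pact_sum.
apply: eq_bigr => j _; rewrite pactM IH coef_poly subn0 /= /bump leq0n add1n ltnS add0n.
by case: ltnP => jN; rewrite ?pact_pvar // pact0 truncE // lfunE.
Qed.

(** The annihilator of the class of u in V/H, for H stable under the operators; no quotient module
    is needed. *)
Definition annih (H : {vspace V}) u (p : {mpoly K[N]}) : Prop := pact p u \in H.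

Lemma annih_ideal (H : {vspace V}) u : (forall j, (E j @: H <= H)%VS) -> ideal (annih H u).
Proof.
move=> stH; split; rewrite /annih ?pact0 ?mem0v // => p q.
  by rewrite pactD; apply: memvD.
rewrite pactM => qH.
have stM m w : w \in H -> monact m w \in H.
  move=> wH; rewrite /monact; elim: (enum _) => //= i s ih.
  by elim: (m i) => //= k ih'; apply: (subvP (stH i)); apply: memv_img.
rewrite /pact; apply: memv_suml => m _; apply: memvZ; exact: stM.
Qed.

End PolyAction.

(** * Modules presented by the relations *)

Section Spans.
Variables (K : fieldType) (V : vectType K).

Lemma spanS_ind (S : V -> Prop) (Q : V -> Prop) :
  Q 0 -> (forall c u w, Q u -> Q w -> Q (c *: u + w)) -> (forall u, S u -> Q u) ->
  forall u, u \in spanS S -> Q u.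
Proof.
move=> Q0 QP QS u; rewrite /spanS; case: cid => X /= [XS _] uX.
rewrite (coord_span (X := in_tuple X) uX) /=.
have QZ c w : Q w -> Q (c *: w) by move=> Qw; rewrite -[_ *: _]addr0; apply: QP.
have QD w w' : Q w -> Q w' -> Q (w + w') by move=> *; rewrite -[w]scale1r; apply: QP.
by apply: big_ind => // i _; apply: QZ; apply: QS; apply: XS; rewrite mem_nth.
Qed.

Variables (P : 'End(V) -> Prop) (v : V).

Lemma generated_self : v \in generated P v.
Proof. by apply: mem_spanS; exists [::]. Qed.

Lemma generated_stable f : P f -> (f @: generated P v <= generated P v)%VS.
Proof.
move=> Pf; apply/subvP => _ /memv_imgP [u uG ->]; move: u uG; apply: spanS_ind.
- by rewrite linear0 mem0v.
- by move=> c u w fu fw; rewrite linearP memvD ?memvZ.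
move=> _ [w wP ->]; apply: mem_spanS; exists (f :: w) => // g.
by rewrite inE => /orP [/eqP ->|/wP].
Qed.

Lemma generated_ind (Q : V -> Prop) :
  Q 0 -> (forall c u w, Q u -> Q w -> Q (c *: u + w)) -> Q v ->
  (forall f u, P f -> Q u -> Q (f u)) -> forall u, u \in generated P v -> Q u.
Proof.
move=> Q0 QP Qv Qf; apply: spanS_ind => // _ [w wP ->].
elim: w wP => //= f w IH fwP; apply: Qf; first by apply: fwP; rewrite mem_head.
by apply: IH => g gw; apply: fwP; rewrite inE gw orbT.
Qed.

Lemma generated_sub (U : {vspace V}) : v \in U ->
  (forall f, P f -> (f @: U <= U)%VS) -> (generated P v <= U)%VS.
Proof.
move=> vU fU; apply/subvP; apply: generated_ind => //; first exact: mem0v.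
  by move=> c u w uU wU; rewrite memvD ?memvZ.
by move=> f u /fU h uU; apply: (subvP h); rewrite memv_img.
Qed.

End Spans.

Section Sl2.
Variable K : numFieldType.
Notation e := (sl2_e K).

Fact sl2_h_subproof : (delta_mx 0 0 - delta_mx 1 1 : 'M[K]_2) \in @traceless K.
Proof.
rewrite inE /mxtrace big_ord_recl big_ord1 !mxE /= !subr0 sub0r.
by rewrite subrr.
Qed.
Definition sl2_h := Sl2 sl2_h_subproof.
Fact sl2_f_subproof : (delta_mx 1 0 : 'M[K]_2) \in @traceless K.
Proof. by rewrite inE /mxtrace big_ord_recl big_ord1 !mxE /= addr0. Qed.
Definition sl2_f := Sl2 sl2_f_subproof.

Lemma mx2P (A B : 'M[K]_2) :
  A 0 0 = B 0 0 -> A 0 1 = B 0 1 -> A 1 0 = B 1 0 -> A 1 1 = B 1 1 -> A = B.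
Proof.
move=> h00 h01 h10 h11; apply/matrixP => i j.
have ord2 (k : 'I_2) : k = 0 \/ k = 1 by case: k => -[|[|//]] ?; [left|right]; apply: val_inj.
by case: (ord2 i) => ->; case: (ord2 j) => ->.
Qed.

Lemma mx2_mul (A B : 'M[K]_2) i j : (A *m B) i j = A i 0 * B 0 j + A i 1 * B 1 j.
Proof.
rewrite mxE big_ord_recl big_ord1; congr (_ + A i _ * B _ j); exact: val_inj.
Qed.

Lemma sl2_decomp (x : sl2 K) : x = x 0 1 *: e + (x 0 0 *: sl2_h + x 1 0 *: sl2_f).
Proof.
apply: val_inj; apply: mx2P; rewrite /= !mxE /= ?sl2_11;
  by rewrite ?(mulr0, mulr1, mulrN1, subr0, addr0, add0r, sub0r).
Qed.

Lemma sl2_bracket_ee : sl2_bracket e e = 0.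
Proof. by apply: val_inj; rewrite /= subrr. Qed.
Lemma sl2_bracket_he : sl2_bracket sl2_h e = 2%:R *: e.
Proof.
apply: val_inj; apply: mx2P; rewrite /= [LHS]mxE [X in _ + X]mxE !mx2_mul !mxE /=; ring.
Qed.
Lemma sl2_bracket_fe : sl2_bracket sl2_f e = - sl2_h.
Proof.
apply: val_inj; apply: mx2P; rewrite /= [LHS]mxE [X in _ + X]mxE !mx2_mul !mxE /=; ring.
Qed.

Section Module.
Variable M : current_module K.

Definition opE j : 'End(M) := act M j e.

Lemma actP j c x y (u : M) : act M j (c *: x + y) u = c *: act M j x u + act M j y u.
Proof. by rewrite act_linear add_lfunE scale_lfunE. Qed.
Lemma act0 j (u : M) : act M j 0 u = 0.
Proof. by have := actP j (-1) 0 0 u; rewrite scaler0 addr0 scaleN1r addNr. Qed.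
Lemma actZ j c x (u : M) : act M j (c *: x) u = c *: act M j x u.
Proof. by have := actP j c x 0 u; rewrite act0 !addr0. Qed.
Lemma actN j x (u : M) : act M j (- x) u = - act M j x u.
Proof. by rewrite -scaleN1r actZ scaleN1r. Qed.

Lemma act_comm i j x y (u : M) :
  act M i x (act M j y u) = act M j y (act M i x u) + act M (i + j)%N (sl2_bracket x y) u.
Proof. by rewrite act_bracket add_lfunE opp_lfunE !comp_lfunE addrC subrK. Qed.

Lemma opE_comm i j u : opE i (opE j u) = opE j (opE i u).
Proof. by rewrite /opE act_comm sl2_bracket_ee act0 addr0. Qed.
Lemma act_he i j (u : M) : act M i sl2_h (opE j u) = opE j (act M i sl2_h u) + 2%:R *: opE (i + j) u.
Proof. by rewrite /opE act_comm sl2_bracket_he actZ. Qed.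
Lemma act_fe i j (u : M) : act M i sl2_f (opE j u) = opE j (act M i sl2_f u) - act M (i + j) sl2_h u.
Proof. by rewrite /opE act_comm sl2_bracket_fe actN. Qed.

Lemma act_sl2 j x (u : M) :
  act M j x u = x 0 1 *: opE j u + (x 0 0 *: act M j sl2_h u + x 1 0 *: act M j sl2_f u).
Proof. by rewrite {1}(sl2_decomp x) actP actP actZ. Qed.

Definition espan (u : M) : {vspace M} := generated (fun f => exists j, f = opE j) u.

Definition lowest (lam : nat -> K) (u : M) :=
  forall j, act M j sl2_f u = 0 /\ act M j sl2_h u = lam j *: u.

Definition wcond (A : seq nat) (u : M) :=
  forall r s, (bnd [seq a.-1 | a <- A] r < s)%N -> ypow opE r s u = 0.

Lemma espan_opE j u w : w \in espan u -> opE j w \in espan u.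
Proof.
move=> wu; apply: (subvP (generated_stable _ (f := opE j) _)); first by exists j.
exact: memv_img.
Qed.

Lemma espan_stable j u : (opE j @: espan u <= espan u)%VS.
Proof. by apply: generated_stable; exists j. Qed.

Lemma truncated_opE n : truncated n M -> forall j, (n <= j)%N -> opE j = 0.
Proof. by move=> tM j nj; apply: tM. Qed.

Lemma espan_pact n u w : truncated n M -> w \in espan u ->
  exists p : {mpoly K[n]}, w = pact opE p u.
Proof.
move=> tM; move: w; apply: generated_ind.
- by exists 0; rewrite pact0.
- by move=> c _ _ [p ->] [q ->]; exists (c *: p + q); rewrite pactP.
- by exists 1; rewrite pact1.
move=> _ _ [j ->] [p ->]; exists (pvar K n j * p).
by rewrite (pactM opE_comm) (pact_pvar (truncated_opE tM)).
Qed.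

Lemma pact_espan n u (p : {mpoly K[n]}) : pact opE p u \in espan u.
Proof.
rewrite /pact; apply: memv_suml => m _; apply: memvZ.
rewrite /monact; elim: (enum _) => /= [|i s IH]; first exact: generated_self.
by elim: (m i) => //= k IH'; apply: espan_opE.
Qed.

Lemma wcond_annih n A u (H : {vspace M}) : truncated n M -> (size A <= n)%N ->
  (forall j, (opE j @: H <= H)%VS) ->
  (forall r s, (bnd [seq a.-1 | a <- A] r < s)%N -> ypow opE r s u \in H) ->
  cond (pvar K n) (size A) [seq a.-1 | a <- A] (annih opE H u).
Proof.
move=> tM sA stH h.
have := @pvar_level K n (annih opE H u) [seq a.-1 | a <- A].
rewrite size_map; apply=> //; first exact: (annih_ideal _ opE_comm _ stH).
move=> r s rs; rewrite /annih (pact_lvl opE_comm (truncated_opE tM)); exact: h.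
Qed.

Lemma spans_dim n (J : {mpoly K[n]} -> Prop) m (H : {vspace M}) (u : M) : spans J m ->
  (forall p, J p -> annih opE H u p) -> truncated n M ->
  (\dim (espan u + H) <= m + \dim H)%N.
Proof.
move=> [bs [sb hb]] JH tM.
have : (espan u + H <= <<[seq pact opE b u | b <- bs]>> + H)%VS.
  rewrite subv_add addvSr andbT; apply/subvP => w /(espan_pact tM) [p ->].
  have [c /JH pc] := hb p.
  rewrite -(subrK (\sum_(i < size bs) c i *: bs`_i) p) pactD addrC.
  apply: memv_add => //; rewrite pact_sum; apply: memv_suml => i _.
  rewrite pactZ memvZ // memv_span //; apply/mapP; exists bs`_i => //.
  by rewrite mem_nth.
move=> /dimvS /leq_trans; apply; apply: leq_trans (dimv_add_leqif _ _).1 _.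
rewrite leq_add2r; apply: leq_trans (dim_span _) _.
by rewrite size_map.
Qed.

(** Bounds the codimension of H in [espan u + H] when the relations hold only modulo H. With the
    generators of the expected kernel placed in H, this bounds the kernel of the surjection from
    above. *)
Lemma wcond_dim n A u (H : {vspace M}) : truncated n M -> (size A <= n)%N ->
  all (leq 1) A -> (forall j, (opE j @: H <= H)%VS) ->
  (forall r s, (bnd [seq a.-1 | a <- A] r < s)%N -> ypow opE r s u \in H) ->
  (\dim (espan u + H) <= \prod_(a <- A) a + \dim H)%N.
Proof.
move=> tM sA A1 stH h; apply: (@spans_dim n (annih opE H u)) => //.
have := cond_spans (@pvar_gen K n) (annih_ideal _ opE_comm _ stH) _ (wcond_annih tM sA stH h).
rewrite size_map big_map => /(_ erefl).
rewrite (eq_big_seq id) // => a /(allP A1).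
by case: a.
Qed.

End Module.

Section Hom.
Variables (M N : current_module K) (n : nat) (A : seq nat) (v : M) (u : N) (lam : nat -> K).
Hypotheses (tM : truncated n M) (tN : truncated n N) (sA : (size A <= n)%N)
  (A1 : all (leq 1) A) (cM : espan v = fullv) (dM : (\prod_(a <- A) a <= \dim {:M})%N)
  (vA : wcond A v) (uA : wcond A u) (lv : lowest lam v) (lu : lowest lam u).

Lemma wcond_annih_sub (p : {mpoly K[n]}) : pact (opE M) p v = 0 -> pact (opE N) p u = 0.
Proof.
(* The intersection J of the two annihilators satisfies the relations too, so
   P/J has dimension at most dim M, and J is the annihilator of v. *)
move=> pv0.
pose J (q : {mpoly K[n]}) := annih (opE M) 0%VS v q /\ annih (opE N) 0%VS u q.
have st0 (M' : current_module K) j : (opE M' j @: 0 <= 0)%VS by rewrite limg0.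
have iM := annih_ideal n (@opE_comm M) v (st0 M).
have iN := annih_ideal n (@opE_comm N) u (st0 N).
have idJ : ideal J.
  split=> [|q q' [h1 h2] [h1' h2']|q q' [h1 h2]].
  - by split; [apply: (ideal0 iM)|apply: (ideal0 iN)].
  - by split; [apply: (idealD iM)|apply: (idealD iN)].
  - by split; [apply: (idealM iM)|apply: (idealM iN)].
have mem0 (M' : current_module K) (A' : seq nat) (w : M') : wcond A' w ->
   forall r s, (bnd [seq a.-1 | a <- A'] r < s)%N -> ypow (opE M') r s w \in 0%VS.
  by move=> h r s rs; rewrite h // mem0v.
have cJ : cond (pvar K n) (size A) [seq a.-1 | a <- A] J.
  have [c1 c2] := wcond_annih tM sA (st0 M) (mem0 _ _ _ vA).
  have [c1' c2'] := wcond_annih tN sA (st0 N) (mem0 _ _ _ uA).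
  split=> [j sj|r s rs]; first by split; [apply: c1|apply: c1'].
  by split; [apply: c2|apply: c2'].
have [bs [sb hb]] := cond_spans (@pvar_gen K n) idJ (size_map _ _) cJ.
have prodE : (\prod_(x <- [seq a.-1 | a <- A]) x.+1 = \prod_(a <- A) a)%N.
  by rewrite big_map; apply: eq_big_seq => a /(allP A1); case: a.
rewrite prodE in sb.
pose X := [seq pact (opE M) b v | b <- bs].
have fX : <<X>>%VS = fullv.
  apply/eqP; rewrite eqEsubv subvf -cM; apply/subvP => w /(espan_pact tM) [q ->].
  have [c [h _]] := hb q; move: h; rewrite /annih memv0.
  rewrite -scaleN1r addrC pactP scaleN1r addrC subr_eq0 => /eqP ->.
  rewrite pact_sum; apply: memv_suml => i _; rewrite pactZ memvZ // memv_span //.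
  by apply/mapP; exists bs`_i => //; rewrite mem_nth.
(* The images of at most dim M spanning elements of P/J span M, hence form a basis. A polynomial
   killing v then has zero coefficients in them and lies in J, so it kills u. *)
have frX : free X.
  rewrite /free eqn_leq dim_span fX size_map /=; exact: leq_trans sb dM.
have [c [hM hN]] := hb p.
move: hM; rewrite /annih memv0 -scaleN1r addrC pactP scaleN1r addrC pv0 sub0r oppr_eq0 => /eqP h.
have c0 (i : 'I_(size bs)) : c i = 0.
  have sX : size bs = size X by rewrite size_map.
  have /freeP fr := (frX : free (in_tuple X)).
  have := fr (fun i : 'I_(size X) => c i) _ (cast_ord sX i); apply.
  rewrite -[RHS]h pact_sum (reindex (cast_ord sX)) /=; last first.
    by apply: onW_bij; exists (cast_ord (esym sX)) => j; apply: val_inj.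
  by apply: eq_bigr => j _; rewrite pactZ (nth_map 0).
move: hN; rewrite /annih big1 ?subr0 ?memv0 => [/eqP //|i _].
by rewrite c0 scale0r.
Qed.

(** The map p v |-> p u is well defined by [wcond_annih_sub] and commutes with the e_j. It commutes
    with h_j and f_j because these can be moved past the e_i down to the generators, where both
    sides agree through the common weight lam. *)
Lemma wcond_hom : exists th : current_hom M N, th v = u.
Proof.
have pq (w : M) : exists p : {mpoly K[n]}, w = pact (opE M) p v.
  by apply: espan_pact => //; rewrite cM memvf.
pose P w := projT1 (cid (pq w)).
have PE w : w = pact (opE M) (P w) v by rewrite /P; case: cid.
pose g w := pact (opE N) (P w) u.
have gE (p : {mpoly K[n]}) : g (pact (opE M) p v) = pact (opE N) p u.
  have : pact (opE N) (-1 *: p + P (pact (opE M) p v)) u = 0.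
    by apply: wcond_annih_sub; rewrite pactP -PE scaleN1r addNr.
  by rewrite pactP scaleN1r addrC => /eqP; rewrite subr_eq0 => /eqP.
have gl : linear g.
  move=> c w w'; have -> : c *: w + w' = pact (opE M) (c *: P w + P w') v by rewrite pactP -!PE.
  by rewrite gE pactP.
pose gL := GRing.isLinear.Build K M N _ g gl.
pose gf : {linear M -> N} := HB.pack g gL.
pose th : 'Hom(M, N) := linfun gf.
have thE w : th w = g w by rewrite lfunE.
have thv : th v = u by rewrite thE -{1}(pact1 n (opE M) v) gE pact1.
have thP c w w' : th (c *: w + w') = c *: th w + th w' by rewrite linearP.
have thD w w' : th (w + w') = th w + th w' by rewrite linearD.
have thB w w' : th (w - w') = th w - th w' by rewrite linearB.
have thZ c w : th (c *: w) = c *: th w by rewrite linearZ.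
have the j w : th (opE M j w) = opE N j (th w).
  rewrite !thE {1}(PE w) -(pact_pvar (truncated_opE tM)) -(pactM (@opE_comm M)) gE.
  by rewrite (pactM (@opE_comm N)) pact_pvar //; apply: truncated_opE.
(* The two statements are proved together, since moving f_j past e_i produces h_{i+j}. *)
have thh w : (forall j, th (act M j sl2_h w) = act N j sl2_h (th w)) /\
   (forall j, th (act M j sl2_f w) = act N j sl2_f (th w)).
  have : w \in espan v by rewrite cM memvf.
  move: w; apply: generated_ind.
  - by split=> j; rewrite !linear0.
  - by move=> c w w' [h1 h2] [h1' h2']; split=> j; rewrite linearP !thP linearP ?h1 ?h1' ?h2 ?h2'.
  - split=> j; have [f0 h0] := lv j; have [f0' h0'] := lu j.
      by rewrite h0 thv h0' linearZ /= thv.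
    by rewrite f0 thv f0' linear0.
  move=> _ w [i ->] [h1 h2]; split=> j.
    by rewrite act_he the act_he thD thZ the the h1.
  by rewrite act_fe the act_fe thB the h2 h1.
have tha j x w : th (act M j x w) = act N j x (th w).
  by rewrite act_sl2 (act_sl2 (M := N)) thD thZ thD !thZ the (thh w).1 (thh w).2.
by exists (CurrentHom tha).
Qed.

End Hom.
End Sl2.

(** * Tensor products *)

Section TensorSpace.
Variables (K : fieldType).
Implicit Types U W X : vectType K.

Lemma coordsP U c (u u' : U) : coords (c *: u + u') = c *: coords u + coords u'.
Proof. exact: passmx.rVof_linear. Qed.

Lemma tensPl U W c (u u' : U) (w : W) :
  tens (c *: u + u') w = c *: tens u w + tens u' w.
Proof. by rewrite /tens coordsP linearP /= mulmxDl -scalemxAl. Qed.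
Lemma tensPr U W c (u : U) (w w' : W) :
  tens u (c *: w + w') = c *: tens u w + tens u w'.
Proof. by rewrite /tens coordsP mulmxDr -scalemxAr. Qed.

Lemma tens0l U W (w : W) : tens (0 : U) w = 0.
Proof. by have := tensPl (-1) 0 0 w (U := U); rewrite scaler0 addr0 scaleN1r addNr. Qed.
Lemma tens0r U W (u : U) : tens u (0 : W) = 0.
Proof. by have := tensPr (-1) u 0 0 (W := W); rewrite scaler0 addr0 scaleN1r addNr. Qed.
Lemma tensDl U W (u u' : U) (w : W) : tens (u + u') w = tens u w + tens u' w.
Proof. by have := tensPl 1 u u' w; rewrite !scale1r. Qed.
Lemma tensDr U W (u : U) (w w' : W) : tens u (w + w') = tens u w + tens u w'.
Proof. by have := tensPr 1 u w w'; rewrite !scale1r. Qed.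
Lemma tensZl U W c (u : U) (w : W) : tens (c *: u) w = c *: tens u w.
Proof. by have := tensPl c u 0 w; rewrite tens0l !addr0. Qed.
Lemma tensZr U W c (u : U) (w : W) : tens u (c *: w) = c *: tens u w.
Proof. by have := tensPr c u w 0; rewrite tens0r !addr0. Qed.
Lemma tens_suml U W (I : Type) (r : seq I) (P : pred I) (F : I -> U) (w : W) :
  tens (\sum_(i <- r | P i) F i) w = \sum_(i <- r | P i) tens (F i) w.
Proof. by elim/big_rec2: _ => [|i x y _ <-]; rewrite ?tens0l ?tensDl. Qed.
Lemma tens_sumr U W (I : Type) (r : seq I) (P : pred I) (F : I -> W) (u : U) :
  tens u (\sum_(i <- r | P i) F i) = \sum_(i <- r | P i) tens u (F i).
Proof. by elim/big_rec2: _ => [|i x y _ <-]; rewrite ?tens0r ?tensDr. Qed.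

Lemma tens_ind U W (Q : tensv U W -> Prop) : Q 0 ->
  (forall c T T', Q T -> Q T' -> Q (c *: T + T')) ->
  (forall u w, Q (tens u w)) -> forall T, Q T.
Proof.
move=> Q0 QP Qt T; rewrite [T]matrix_sum_delta.
have QD T1 T2 : Q T1 -> Q T2 -> Q (T1 + T2) by move=> *; rewrite -[T1]scale1r; apply: QP.
apply: big_ind => // i _; apply: big_ind => // j _.
by rewrite -tens_basis -tensZl.
Qed.

Lemma tens_neq0 U W (u : U) (w : W) : u != 0 -> w != 0 -> tens u w != 0.
Proof.
rewrite -[u == 0](passmx.rVof_eq0 (vbasisP _)) -[w == 0](passmx.rVof_eq0 (vbasisP _)).
rewrite -!/(coords _) => /eqP u0 /eqP w0; apply/eqP => /matrixP uw0.
have [i ui] : exists i, coords u 0 i != 0.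
  apply/existsP; apply: contra_notT u0 => /existsPn h; apply/rowP => i.
  by rewrite [RHS]mxE; apply/eqP/negPn/h.
have [j wj] : exists j, coords w 0 j != 0.
  apply/existsP; apply: contra_notT w0 => /existsPn h; apply/rowP => j.
  by rewrite [RHS]mxE; apply/eqP/negPn/h.
have := uw0 i j; rewrite mxE big_ord1 [_^T _ _]mxE [RHS]mxE => /eqP.
by rewrite mulf_eq0 (negPf ui) (negPf wj).
Qed.

Lemma dim_tensv U W : \dim {:tensv U W} = (\dim {:U} * \dim {:W})%N.
Proof. by rewrite dimvf [RHS]/= dim_matrix. Qed.

(** Reads b only on pairs of basis vectors, so the result is linear for any b; bilinearity is asked
    for only in [tens_liftE]. *)
Definition tens_lift_fun U W X (b : U -> W -> X) (T : tensv U W) : X :=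
  \sum_i \sum_j T i j *: b (vbasis {:U})`_i (vbasis {:W})`_j.

Fact tens_lift_fun_linear U W X (b : U -> W -> X) : linear (tens_lift_fun b).
Proof.
move=> c T T'; rewrite /tens_lift_fun scaler_sumr -big_split; apply: eq_bigr => i _ /=.
rewrite scaler_sumr -big_split; apply: eq_bigr => j _ /=.
by rewrite !mxE scalerDl scalerA.
Qed.
HB.instance Definition _ U W X (b : U -> W -> X) := GRing.isSemilinear.Build K (tensv U W) X _
  (tens_lift_fun b) (GRing.semilinear_linear (tens_lift_fun_linear b)).

Definition tens_lift U W X (b : U -> W -> X) : 'Hom(tensv U W, X) := linfun (tens_lift_fun b).

Lemma tens_liftE U W X (b : U -> W -> X) u w :
  (forall w, linear (b^~ w)) -> (forall u, linear (b u)) -> tens_lift b (tens u w) = b u w.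
Proof.
move=> b1 b2; rewrite lfunE /= /tens_lift_fun.
have z1 w' : b 0 w' = 0 by have := b1 w' (-1) 0 0; rewrite scaler0 addr0 scaleN1r addNr.
have z2 u' : b u' 0 = 0 by have := b2 u' (-1) 0 0; rewrite scaler0 addr0 scaleN1r addNr.
have D1 w' : {morph b^~ w' : x y / x + y >-> x + y}.
  by move=> x y; have := b1 w' 1 x y; rewrite !scale1r.
have D2 u' : {morph b u' : x y / x + y >-> x + y}.
  by move=> x y; have := b2 u' 1 x y; rewrite !scale1r.
have uE : u = \sum_i coords u 0 i *: (vbasis {:U})`_i by rewrite -/(passmx.vecof _ _) passmx.rVofK ?vbasisP.
have wE : w = \sum_i coords w 0 i *: (vbasis {:W})`_i by rewrite -/(passmx.vecof _ _) passmx.rVofK ?vbasisP.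
rewrite {2}uE (big_morph (b^~ w) (D1 w) (z1 w)); apply: eq_bigr => i _.
rewrite -[_ *: (vbasis {:U})`_i]addr0 b1 z1 addr0 {2}wE.
rewrite (big_morph (b _) (D2 _) (z2 _)) scaler_sumr; apply: eq_bigr => j _.
rewrite -[_ *: (vbasis {:W})`_j]addr0 b2 z2 addr0 scalerA.
by rewrite mxE big_ord1 [_^T _ _]mxE.
Qed.

Lemma tens_liftP U W X (b b' : U -> W -> X) c (b'' : U -> W -> X) T :
  (forall u w, b'' u w = c *: b u w + b' u w) ->
  tens_lift b'' T = c *: tens_lift b T + tens_lift b' T.
Proof.
move=> h; rewrite !lfunE /= /tens_lift_fun scaler_sumr -big_split; apply: eq_bigr => i _ /=.
rewrite scaler_sumr -big_split; apply: eq_bigr => j _ /=.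
by rewrite h scalerDr !scalerA mulrC.
Qed.

Definition tens_map U W U' W' (f : 'Hom(U, U')) (g : 'Hom(W, W')) : 'Hom(tensv U W, tensv U' W') :=
  tens_lift (fun u w => tens (f u) (g w)).

Lemma tens_mapE U W U' W' (f : 'Hom(U, U')) (g : 'Hom(W, W')) u w :
  tens_map f g (tens u w) = tens (f u) (g w).
Proof.
by rewrite /tens_map tens_liftE // => x c y z; rewrite linearP ?tensPl ?tensPr.
Qed.

Lemma tens_map_inj U W U' W' (f : 'Hom(U, U')) (g : 'Hom(W, W')) :
  lker f == 0%VS -> lker g == 0%VS -> lker (tens_map f g) == 0%VS.
Proof.
move=> f0 g0; apply/lker0P/(can_inj (g := tens_map (f^-1)%VF (g^-1)%VF)).
apply: tens_ind; first by rewrite !linear0.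
  by move=> c T T' h h'; rewrite !linearP /= h h'.
by move=> u w; rewrite !tens_mapE !lker0_lfunK.
Qed.

Lemma dim_tens_sub U W (U1 : {vspace U}) (W1 : {vspace W}) (Q : {vspace tensv U W}) :
  (forall u w, u \in U1 -> w \in W1 -> tens u w \in Q) -> (\dim U1 * \dim W1 <= \dim Q)%N.
Proof.
move=> h; pose f : 'Hom(subvs_of U1, U) := linfun (@vsval _ _ U1).
pose g : 'Hom(subvs_of W1, W) := linfun (@vsval _ _ W1).
have f0 : lker f == 0%VS by apply/lker0P => x y; rewrite !lfunE; apply: subvs_inj.
have g0 : lker g == 0%VS by apply/lker0P => x y; rewrite !lfunE; apply: subvs_inj.
have := limg_dim_eq (f := tens_map f g) (U := fullv).
rewrite (eqP (tens_map_inj f0 g0)) capv0 => /(_ erefl).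
rewrite dim_tensv !dimvf [RHS]/= => <-; apply: dimvS.
apply/subvP => _ /memv_imgP [T _ ->]; move: T; apply: tens_ind.
- by rewrite linear0 mem0v.
- by move=> c T T' hT hT'; rewrite linearP memvD ?memvZ.
by move=> u w; rewrite tens_mapE; apply: h; rewrite lfunE; apply: subvsP.
Qed.

End TensorSpace.

Section TensorModule.
Variable K : numFieldType.
Implicit Types M N L : current_module K.

Lemma tens_actT M N j x (u : M) (w : N) :
  act (tens_module M N) j x (tens u w) = tens (act M j x u) w + tens u (act N j x w).
Proof. by rewrite /= add_lfunE !tens_endE !id_lfunE. Qed.

Lemma hom_tens M N M' N' (f : current_hom M M') (g : current_hom N N') :
  exists th : current_hom (tens_module M N) (tens_module M' N'),
    (forall u w, th (tens u w) = tens (f u) (g w)) /\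
    (lker f == 0%VS -> lker g == 0%VS -> lker th == 0%VS).
Proof.
have h j x T : tens_map f g (act (tens_module M N) j x T) =
    act (tens_module M' N') j x (tens_map f g T).
  move: T; apply: tens_ind; first by rewrite !linear0.
    by move=> c T T' hT hT'; rewrite !linearP /= hT hT'.
  by move=> u w; rewrite tens_mapE !tens_actT linearD [LHS]/= !tens_mapE !hom_act.
exists (@CurrentHom _ (tens_module M N) (tens_module M' N') (tens_map f g) h); split=> [u w|]; first exact: tens_mapE.
exact: tens_map_inj.
Qed.

Lemma hom_assoc M N L : exists th : current_hom (tens_module (tens_module M N) L)
     (tens_module M (tens_module N L)),
  forall u w x, th (tens (tens u w) x) = tens u (tens w x).
Proof.
pose b0 (x : L) (u : M) (w : N) : tensv M (tensv N L) := tens u (tens w x).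
have b01 x w : linear (b0 x ^~ w) by move=> c u u'; rewrite /b0 tensPl.
have b02 x u : linear (b0 x u) by move=> c w w'; rewrite /b0 tensPl tensPr.
pose b (T : tensv M N) (x : L) := tens_lift (b0 x) T.
have b1 x : linear (b ^~ x) by move=> c T T'; rewrite /b linearP.
have b2 T : linear (b T).
  move=> c x x'; rewrite /b; apply: tens_liftP => u w.
  by rewrite /b0 !tensPr.
have bE u w x : tens_lift b (tens (tens u w) x) = tens u (tens w x).
  by rewrite tens_liftE // /b tens_liftE.
have h j x T : tens_lift b (act (tens_module (tens_module M N) L) j x T) =
    act (tens_module M (tens_module N L)) j x (tens_lift b T).
  move: T; apply: tens_ind; first by rewrite !linear0.
    by move=> c T T' hT hT'; rewrite !linearP /= hT hT'.
  move=> T y; move: T; apply: tens_ind; first by rewrite tens0l !linear0.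
    by move=> c T T' hT hT'; rewrite tensPl !linearP /= hT hT'.
  move=> u w; rewrite bE tens_actT tens_actT tensDl !linearD [LHS]/= !bE tens_actT tens_actT.
  by rewrite tensDr addrA.
by exists (@CurrentHom _ (tens_module (tens_module M N) L) (tens_module M (tens_module N L)) (tens_lift b) h) => u w x; apply: bE.
Qed.

Lemma hom_swap M N : exists th : current_hom (tens_module M N) (tens_module N M),
  forall u w, th (tens u w) = tens w u.
Proof.
pose b (u : M) (w : N) : tensv N M := tens w u.
have bE u w : tens_lift b (tens u w) = tens w u.
  by rewrite tens_liftE // => x c y z; rewrite /b ?tensPl ?tensPr.
have h j x T : tens_lift b (act (tens_module M N) j x T) =
    act (tens_module N M) j x (tens_lift b T).
  move: T; apply: tens_ind; first by rewrite !linear0.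
    by move=> c T T' hT hT'; rewrite !linearP /= hT hT'.
  by move=> u w; rewrite bE !tens_actT linearD [LHS]/= !bE addrC.
by exists (@CurrentHom _ (tens_module M N) (tens_module N M) (tens_lift b) h) => u w; apply: bE.
Qed.

(** M is any module with a map to the trivial one, so that this removes both the unit [triv_module]
    and an empty column [cmod 0]. *)
Lemma hom_unit M N (f : current_hom M (triv_module K)) :
  exists th : current_hom (tens_module M N) N, forall u w, th (tens u w) = (f u : K) *: w.
Proof.
pose b (u : M) (w : N) : N := (f u : K) *: w.
have bE u w : tens_lift b (tens u w) = (f u : K) *: w.
  rewrite tens_liftE // => x c y z; rewrite /b.
    by rewrite linearP /= scalerDl scalerA.
  by rewrite scalerDr !scalerA mulrC.
have h j x T : tens_lift b (act (tens_module M N) j x T) = act N j x (tens_lift b T).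
  move: T; apply: tens_ind; first by rewrite !linear0.
    by move=> c T T' hT hT'; rewrite !linearP /= hT hT'.
  move=> u w; rewrite tens_actT linearD /= !bE hom_act /= lfunE /= scale0r add0r.
  by rewrite linearZ.
by exists (@CurrentHom _ (tens_module M N) N (tens_lift b) h) => u w; apply: bE.
Qed.

Lemma hom_comp M N L (g : current_hom N L) (f : current_hom M N) :
  exists th : current_hom M L, forall u, th u = g (f u).
Proof.
have h j x u : (g \o f)%VF (act M j x u) = act L j x ((g \o f)%VF u).
  by rewrite !comp_lfunE !hom_act.
by exists (CurrentHom h) => u; rewrite comp_lfunE.
Qed.

Lemma hom_id M : exists th : current_hom M M, forall u, th u = u.
Proof.
have h j x u : (\1 : 'End(M))%VF (act M j x u) = act M j x ((\1 : 'End(M))%VF u).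
  by rewrite !id_lfunE.
by exists (CurrentHom h) => u; rewrite id_lfunE.
Qed.

(** A preorder on pointed modules. Only the existence of such maps matters, as it compares the
    dimensions of the generated submodules ([pmap_dim]); tensor factors can then be permuted and
    regrouped without naming isomorphisms. *)
Definition pmap M N (u : M) (w : N) := exists th : current_hom M N, th u = w.

Lemma pmap_refl M (u : M) : pmap u u.
Proof. by have [th h] := hom_id M; exists th. Qed.
Lemma pmap_trans N M L (w : N) (u : M) (x : L) : pmap u w -> pmap w x -> pmap u x.
Proof. by move=> [f <-] [g <-]; have [th h] := hom_comp g f; exists th. Qed.
Lemma pmap_tens M N M' N' (u : M) (w : N) (u' : M') (w' : N') :
  pmap u u' -> pmap w w' ->
  pmap (tens u w : tens_module M N) (tens u' w' : tens_module M' N').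
Proof. by move=> [f <-] [g <-]; have [th [h _]] := hom_tens f g; exists th. Qed.
Lemma pmap_swap M N (u : M) (w : N) :
  pmap (tens u w : tens_module M N) (tens w u : tens_module N M).
Proof. by have [th h] := hom_swap M N; exists th. Qed.
Lemma pmap_assoc M N L (u : M) (w : N) (x : L) :
  pmap (tens (tens u w : tens_module M N) x : tens_module (tens_module M N) L)
       (tens u (tens w x : tens_module N L) : tens_module M (tens_module N L)).
Proof. by have [th h] := hom_assoc M N L; exists th. Qed.
Lemma pmap_assocV M N L (u : M) (w : N) (x : L) :
  pmap (tens u (tens w x : tens_module N L) : tens_module M (tens_module N L))
       (tens (tens u w : tens_module M N) x : tens_module (tens_module M N) L).
Proof.
apply: pmap_trans (pmap_swap _ _) _.
apply: pmap_trans (pmap_tens (pmap_swap _ _) (pmap_refl _)) _.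
apply: pmap_trans (pmap_assoc _ _ _) _.
apply: pmap_trans (pmap_swap _ _) _.
exact: pmap_tens (pmap_swap _ _) (pmap_refl _).
Qed.
Lemma pmap_CA M N L (u : M) (w : N) (x : L) :
  pmap (tens u (tens w x : tens_module N L) : tens_module M (tens_module N L))
       (tens w (tens u x : tens_module M L) : tens_module N (tens_module M L)).
Proof.
apply: pmap_trans (pmap_assocV _ _ _) _.
apply: pmap_trans (pmap_tens (pmap_swap _ _) (pmap_refl _)) _.
exact: pmap_assoc.
Qed.

Lemma hom_espan M N (th : current_hom M N) (u : M) : (th @: espan u = espan (th u))%VS.
Proof.
apply/eqP; rewrite eqEsubv; apply/andP; split.
  apply/subvP => _ /memv_imgP [w wu ->]; move: w wu; apply: generated_ind.
  - by rewrite linear0 mem0v.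
  - by move=> c w w' hw hw'; rewrite linearP memvD ?memvZ.
  - exact: generated_self.
  by move=> _ w [j ->] hw; rewrite hom_act espan_opE.
apply: generated_sub; first by rewrite memv_img // generated_self.
move=> _ [j ->]; apply/subvP => _ /memv_imgP [_ /memv_imgP [w wu ->] ->].
by rewrite -hom_act memv_img // espan_opE.
Qed.

Lemma pmap_dim M N (u : M) (w : N) : pmap u w -> (\dim (espan w) <= \dim (espan u))%N.
Proof. by move=> [th <-]; rewrite -hom_espan -(limg_ker_dim th (espan u)) leq_addl. Qed.

Lemma truncated_tens n M N : truncated n M -> truncated n N -> truncated n (tens_module M N).
Proof.
move=> tM tN j x nj; apply/lfunP => T; move: T; apply: tens_ind; first by rewrite !linear0.
  by move=> c T T' h h'; rewrite !linearP /= h h'.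
by move=> u w; rewrite tens_actT tM // tN // !lfunE /= tens0l tens0r addr0.
Qed.

Lemma truncated_leq n m M : (n <= m)%N -> truncated n M -> truncated m M.
Proof. by move=> nm tM j x mj; apply: tM; apply: leq_trans mj. Qed.

Lemma lowest_tens M N lam mu (u : M) (w : N) : lowest lam u -> lowest mu w ->
  lowest (fun j => lam j + mu j) (tens u w : tens_module M N).
Proof.
move=> lu lw j; rewrite !tens_actT; have [-> ->] := lu j; have [-> ->] := lw j.
by rewrite tens0l tens0r addr0 tensZl tensZr scalerDl.
Qed.

Section Ypow.
Variables (M N : current_module K).

Lemma triangular_exchange (V : nmodType) s (F : nat -> nat -> V) :
  \sum_(j < s) \sum_(t < s - j) F j t = \sum_(t < s) \sum_(j < s - t) F j t.
Proof.
have w (G : nat -> nat -> V) : \sum_(j < s) \sum_(t < s - j) G j t =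
    \sum_(j < s) \sum_(t < s | (j + t < s)%N) G j t.
  apply: eq_bigr => j _; rewrite (big_ord_widen s (G j)) ?leq_subr //.
  by apply: eq_bigl => t; rewrite ltn_subRL.
rewrite w (w (fun t j => F j t)) (exchange_big_dep xpredT) //=; apply: eq_bigr => j _.
by apply: eq_bigl => t; rewrite addnC.
Qed.

(** The binomial formula: on a tensor product e(z) is the sum of its commuting actions on the two
    factors. *)
Lemma ypow_tens r s (u : M) (w : N) :
  ypow (opE (tens_module M N)) r s (tens u w) =
  \sum_(i < r.+1) 'C(r, i)%:R *: \sum_(t < s.+1)
     tens (ypow (opE M) i t u) (ypow (opE N) (r - i) (s - t) w).
Proof.
pose f i t := ypow (opE M) i t u; pose g i t := ypow (opE N) i t w.
pose cv i j s := \sum_(t < s.+1) tens (f i t) (g j (s - t)%N).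
have cvE i j t : cv i j t = \sum_(q < t.+1) tens (f i (t - q)%N) (g j q).
  rewrite /cv (reindex_inj rev_ord_inj) /=; apply: eq_bigr => q _.
  by rewrite subSS subKn // -ltnS.
(* Product rule: one more factor e(z) raises either the first or the second exponent. The two double
   sums are matched by exchanging summations over a triangle. *)
have step i j t : \sum_(q < t) opE (tens_module M N) q (cv i j (t - q.+1)%N)
    = cv i.+1 j t + cv i j.+1 t.
  transitivity (\sum_(q < t) (\sum_(p < t - q) tens (opE M q (f i (t - q.+1 - p)%N)) (g j p) +
      \sum_(p < t - q) tens (f i p) (opE N q (g j (t - q.+1 - p)%N)))).
    apply: eq_bigr => q _; have qt : ((t - q.+1).+1 = t - q)%N by have := ltn_ord q; lia.
    rewrite linear_sum /=; under eq_bigr do rewrite tens_actT.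
    rewrite big_split qt /=; congr (_ + _).
    rewrite (reindex_inj rev_ord_inj) /=; apply: eq_bigr => p _.
    by have := ltn_ord p => pt; congr (tens (opE M q (f i _)) (g j _)); lia.
  rewrite big_split /=; congr (_ + _).
    rewrite (triangular_exchange t (fun q p => tens (opE M q (f i (t - q.+1 - p)%N)) (g j p))) cvE big_ord_recr /= subnn.
    rewrite [f i.+1 0]/f /= big_ord0 tens0l addr0; apply: eq_bigr => p _.
    rewrite [f i.+1 _]/f /= tens_suml; apply: eq_bigr => q _.
    by congr (tens (opE M q (f i _)) _); lia.
  rewrite (triangular_exchange t (fun q p => tens (f i p) (opE N q (g j (t - q.+1 - p)%N)))) /cv big_ord_recr /= subnn.
  rewrite [g j.+1 0]/g /= big_ord0 tens0r addr0; apply: eq_bigr => p _.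
  rewrite [g j.+1 _]/g /= tens_sumr; apply: eq_bigr => q _.
  by congr (tens _ (opE N q (g j _))); lia.
rewrite -[RHS]/(\sum_(i < r.+1) 'C(r, i)%:R *: cv i (r - i)%N s).
elim: r s => [|r IH] s.
  rewrite big_ord1 bin0 scale1r /cv /f /g /=.
  case: s => [|s]; first by rewrite big_ord1.
  rewrite big_ord_recl subn0 /= tens0r add0r big1 // => t _.
  by rewrite tens0l.
rewrite /=; under eq_bigr => q _ do rewrite IH linear_sum.
rewrite exchange_big /=.
under eq_bigr => i _.
  under eq_bigr do rewrite linearZ.
  rewrite -scaler_sumr step scalerDr; over.
rewrite /= big_split /= addrC.
rewrite [in RHS]big_ord_recl bin0 subn0.
under [in RHS]eq_bigr => i _ do rewrite lift0 binS natrD scalerDl subSS.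
rewrite [in RHS]big_split /= addrA; congr (_ + _).
rewrite big_ord_recl bin0 subn0; congr (_ + _).
rewrite [in RHS]big_ord_recr /= bin_small // scale0r addr0.
apply: eq_bigr => i _; rewrite /bump leq0n add1n; congr (_ *: cv _ _ _).
by have := ltn_ord i; lia.
Qed.

Definition dbound L (u : L) (D : nat -> nat) :=
  forall r s, (D r < s)%N -> ypow (opE L) r s u = 0.

Lemma dbound_tens (u : M) (w : N) D1 D2 D : dbound u D1 -> dbound w D2 ->
  (forall i j, (D1 i + D2 j <= D (i + j))%N) ->
  dbound (tens u w : tens_module M N) D.
Proof.
move=> b1 b2 h r s rs; rewrite ypow_tens big1 // => i _; rewrite big1 ?scaler0 // => t _.
have ir : (i <= r)%N by rewrite -ltnS ltn_ord.
have := h i (r - i)%N; rewrite subnKC // => hi.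
have [it|ti] := ltnP (D1 i) t; first by rewrite b1 // tens0l.
by rewrite (b2 _ (s - t)%N) ?tens0r //; lia.
Qed.

(** If the binomial term i = p alone can reach degree s, the coefficient of z^s is the product of
    the top coefficients of its two factors, up to the binomial coefficient. *)
Lemma ypow_tens_lead (u : M) (w : N) D1 D2 p k s : dbound u D1 -> dbound w D2 ->
  (p <= k)%N -> s = (D1 p + D2 (k - p))%N ->
  (forall i, (i <= k)%N -> i != p -> (D1 i + D2 (k - i) < s)%N) ->
  ypow (opE (tens_module M N)) k s (tens u w) =
    'C(k, p)%:R *: tens (ypow (opE M) p (D1 p) u) (ypow (opE N) (k - p) (D2 (k - p)%N) w).
Proof.
move=> b1 b2 pk sE h; have pk' : (p < k.+1)%N by [].
rewrite ypow_tens (bigD1 (Ordinal pk')) //= [X in _ + X]big1 ?addr0; last first.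
  move=> i; rewrite -val_eqE /= => ip; rewrite big1 ?scaler0 // => t _.
  have ik : (i <= k)%N by rewrite -ltnS ltn_ord.
  have hi := h i ik ip.
  have [it|ti] := ltnP (D1 i) t; first by rewrite b1 // tens0l.
  by rewrite (b2 _ (s - t)%N) ?tens0r //; lia.
congr (_ *: _); have ps : (D1 p < s.+1)%N by lia.
rewrite (bigD1 (Ordinal ps)) //= [X in _ + X]big1 ?addr0; last first.
  move=> t; rewrite -val_eqE /= => tp.
  have [it|ti] := ltnP (D1 p) t; first by rewrite b1 // tens0l.
  by rewrite (b2 _ (s - t)%N) ?tens0r //; lia.
by congr (tens _ (ypow _ _ _ _)); lia.
Qed.

End Ypow.
End TensorModule.

(** * Relations in fusion products *)

Section Graded.
Variables (K : numFieldType) (M : current_module K) (v : M) (lam : nat -> K).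
Hypothesis lv : lowest lam v.

Notation F := (filt v).
Notation G := (gr_module v).

Definition eword (w : seq nat) (u : M) : M := foldr (fun j => opE M j) u w.

Definition eword_span s : {vspace M} :=
  spanS (fun u => exists2 w, (sumn w <= s)%N & u = eword w v).

Lemma eword_span_leq s t : (s <= t)%N -> (eword_span s <= eword_span t)%VS.
Proof.
move=> st; apply: spanS_sub => _ [w ws ->]; apply: mem_spanS.
by exists w => //; apply: leq_trans st.
Qed.

Lemma eword_span_e j s u : u \in eword_span s -> opE M j u \in eword_span (j + s).
Proof.
move: u; apply: spanS_ind; first by rewrite linear0 mem0v.
  by move=> c u w hu hw; rewrite linearP memvD ?memvZ.
by move=> _ [w ws ->]; apply: mem_spanS; exists (j :: w) => //=; rewrite leq_add2l.
Qed.

(** The commutators [h_i, e_k] = 2 e_{i+k} and [f_i, e_k] = -h_{i+k} preserve the total degree in t.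
    So h and f can be moved through a word to v, where they act by scalars, and the filtration needs
    words in the e_j only. *)
Lemma eword_span_act j x s u : u \in eword_span s -> act M j x u \in eword_span (j + s).
Proof.
suff H : u \in eword_span s -> forall j, act M j (sl2_h K) u \in eword_span (j + s) /\
    act M j (sl2_f K) u \in eword_span (j + s).
  move=> us; rewrite act_sl2; have [h f] := H us j.
  by rewrite memvD ?memvZ ?memvD ?memvZ //; apply: eword_span_e.
move: u; apply: spanS_ind; first by move=> i; rewrite !linear0 !mem0v.
  move=> c u w hu hw i; have [h1 h2] := hu i; have [h3 h4] := hw i.
  by rewrite !linearP !memvD ?memvZ.
move=> _ [w ws ->] i; suff H : forall i, act M i (sl2_h K) (eword w v) \in eword_span (i + sumn w) /\
    act M i (sl2_f K) (eword w v) \in eword_span (i + sumn w).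
  have [h f] := H i; have sE : (i + sumn w <= i + s)%N by rewrite leq_add2l.
  by split; apply: (subvP (eword_span_leq sE)).
elim: w {i s ws} => [|k w IH] i /=.
  have [-> ->] := lv i; rewrite mem0v memvZ //; apply: mem_spanS; by exists [::].
have [h f] := IH i; have [h' f'] := IH (i + k)%N; split.
  rewrite act_he; apply: memvD.
    by rewrite addnCA; apply: eword_span_e.
  rewrite addnA; apply: memvZ; apply: eword_span_e; apply: mem_spanS.
  by exists w.
rewrite act_fe; apply: memvB; first by rewrite addnCA; apply: eword_span_e.
by rewrite addnA.
Qed.

Lemma filt_eword s : F s = eword_span s.
Proof.
apply/eqP; rewrite eqEsubv; apply/andP; split.
  apply: spanS_sub => _ [w ws ->]; apply: (subvP (eword_span_leq ws)).
  elim: w {ws} => [|[j x] w IH] /=; first by apply: mem_spanS; exists [::].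
  exact: eword_span_act.
apply: spanS_sub => _ [w ws ->]; apply: mem_spanS; exists [seq (j, sl2_e K) | j <- w].
  by rewrite /unzip1 -map_comp map_id.
by elim: w {ws} => //= j w ->.
Qed.

Notation top := (filt_top v).

Lemma gr_class_sum s u : u \in F s ->
  [ffun t : 'I_top.+1 => if t == s :> nat then u else 0] \in filt_sum v.
Proof.
move=> us; apply/mem_pointwise => t; rewrite ffunE.
by case: eqP => [->|] //; rewrite mem0v.
Qed.

Lemma gr_class_act j x s u : u \in F s ->
  act G j x (gr_class v s u) = gr_class v (j + s) (act M j x u).
Proof.
move=> us; rewrite /gr_class [LHS]gr_actE ?gr_class_sum //; congr (gr_pi v _).
rewrite /grade_act lfunE /=; apply/ffunP => t; rewrite !ffunE.
case: leqP => jt; last by case: eqP => // ts; move: jt; rewrite ts ltnNge leq_addr.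
rewrite inordK; last by apply: leq_ltn_trans (leq_subr _ _) (ltn_ord t).
rewrite (_ : (t - j == s)%N = (t == j + s :> nat)); last by rewrite -(eqn_add2l j) subnKC.
by case: ifP; rewrite ?linear0.
Qed.

Lemma gr_class_eq0 s u : u \in filt_pred v s -> gr_class v s u = 0.
Proof.
move=> us; apply/eqP; rewrite subquot_pi_ker ?filt_sumS //.
  by apply/mem_pointwise => t; rewrite ffunE; case: eqP => [->|_]; rewrite ?mem0v.
by apply: gr_class_sum; apply: (subvP (filt_predS v s)).
Qed.

Lemma gr_classP s c u w : gr_class v s (c *: u + w) = c *: gr_class v s u + gr_class v s w.
Proof.
rewrite /gr_class -linearP; congr (gr_pi v _); apply/ffunP => t; rewrite !ffunE.
by case: ifP => _ //; rewrite scaler0 addr0.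
Qed.

Lemma gr_class0 s : gr_class v s 0 = 0.
Proof. by apply: gr_class_eq0; rewrite mem0v. Qed.

Lemma gr_ind (Q : G -> Prop) : Q 0 -> (forall x y, Q x -> Q y -> Q (x + y)) ->
  (forall s u, u \in F s -> Q (gr_class v s u)) -> forall x, Q x.
Proof.
move=> Q0 QD Qc x; have [w /mem_pointwise wF <-] := subquot_pi_surj x.
have -> : w = \sum_(s < top.+1) [ffun t : 'I_top.+1 => if t == s :> nat then w s else 0].
  apply/ffunP => t; rewrite sum_ffunE (bigD1 t) //= ffunE eqxx big1 ?addr0 // => s st.
  by rewrite ffunE [t == s :> nat]eq_sym [s == t :> nat](negPf st).
by rewrite linear_sum; apply: big_ind => // s _; apply: Qc.
Qed.

Lemma gr_eword w : foldr (fun j => opE G j) (gr_class v 0 v) w = gr_class v (sumn w) (eword w v).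
Proof.
elim: w => //= j w ->; rewrite /opE gr_class_act // filt_eword.
by apply: mem_spanS; exists w.
Qed.

Lemma gr_cyclic : espan (gr_class v 0 v) = fullv.
Proof.
apply/eqP; rewrite eqEsubv subvf; apply/subvP => x _; move: x; apply: gr_ind.
- exact: mem0v.
- by move=> x y; apply: memvD.
move=> s u; rewrite filt_eword; move: u; apply: spanS_ind.
- by rewrite gr_class0 mem0v.
- by move=> c u w hu hw; rewrite gr_classP memvD ?memvZ.
move=> _ [w ws ->]; move: ws; rewrite leq_eqVlt => /orP [/eqP <-|ws].
  rewrite -gr_eword; elim: w => [|j w IH]; first exact: generated_self.
  exact: (espan_opE j IH).
rewrite gr_class_eq0 ?mem0v //; case: s ws => // s ws.
by rewrite /= filt_eword; apply: mem_spanS; exists w.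
Qed.

(** For j > 0 the class of h_j v is taken in degree j, but h_j v is a multiple of v, which lies in
    F_0; hence only the weight of h_0 survives. *)
Lemma gr_lowest : lowest (fun j => if j == 0%N then lam 0 else 0) (gr_class v 0 v : G).
Proof.
have v0 : v \in F 0 by rewrite filt_eword; apply: mem_spanS; exists [::].
move=> j; rewrite !gr_class_act // addn0; have [-> ->] := lv j; rewrite gr_class0; split=> //.
case: j => [|j] /=; first by rewrite -[_ *: v]addr0 gr_classP gr_class0 addr0.
rewrite scale0r gr_class_eq0 //=; apply: memvZ.
by rewrite (subvP (filt_mono v (leq0n j))).
Qed.

(** If x_j is a combination of the x_k with k < j, it maps F_s into F_{j+s-1} and so acts by zero on
    the graded module. For j = 0 the combination is empty and x_0 vanishes. *)
Lemma gr_truncated n :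
  (forall j x u, (n <= j)%N -> exists c : nat -> K, act M j x u = \sum_(k < j) c k *: act M k x u) ->
  truncated n G.
Proof.
move=> h j x nj; apply/lfunP => y; rewrite [RHS]lfunE /=; move: y; apply: gr_ind.
- by rewrite linear0.
- by move=> y y' hy hy'; rewrite linearD /= hy hy' addr0.
move=> s u us; rewrite [LHS]gr_class_act //; have [c ->] := h j x u nj.
case: j {nj} c => [|j] c; first by rewrite big_ord0 gr_class0.
apply: gr_class_eq0; rewrite addSn /=; apply: memv_suml => k _; apply: memvZ.
have kj : (k + s <= j + s)%N by rewrite leq_add2r -ltnS ltn_ord.
apply: (subvP (filt_mono v kj)); apply: (subvP (filt_act v k x s)).
exact: memv_img.
Qed.

Lemma ypow_lt (E : nat -> 'End(M)) r s u : (s < r)%N -> ypow E r s u = 0.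
Proof.
elim: r s => // r IH s sr /=; rewrite big1 // => j _.
by rewrite IH ?linear0 //; have := ltn_ord j; lia.
Qed.

Lemma ypow_filt r s : (r <= s)%N -> ypow (opE M) r s v \in F (s - r).
Proof.
elim: r s => [|r IH] s rs /=.
  case: s {rs} => [|s]; rewrite ?mem0v // filt_eword.
  by apply: mem_spanS; exists [::].
apply: memv_suml => j _; have [sr|sr] := ltnP (s - j.+1) r.
  by rewrite ypow_lt // linear0 mem0v.
have -> : (s - r.+1 = j + (s - j.+1 - r))%N by have := ltn_ord j; lia.
apply: (subvP (filt_act v j _ _)); apply: memv_img; exact: IH.
Qed.

(** Because e_j comes with z^{j+1}, the coefficient of z^s in e(z)^r has degree s - r in t. *)
Lemma gr_ypow r s : ypow (opE G) r s (gr_class v 0 v) =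
  if (r <= s)%N then gr_class v (s - r) (ypow (opE M) r s v) else 0.
Proof.
elim: r s => [|r IH] s.
  by case: s => [|s] //=; rewrite gr_class0.
rewrite !ypowS.
have E (j : 'I_s) : opE G j (ypow (opE G) r (s - j.+1) (gr_class v 0 v)) =
    if (r < s)%N then gr_class v (s - r.+1) (opE M j (ypow (opE M) r (s - j.+1) v)) else 0.
  rewrite IH; case: (leqP r (s - j.+1)) => sr.
    rewrite /opE gr_class_act ?ypow_filt // (_ : r < s)%N; last by have := ltn_ord j; lia.
    by congr (gr_class v _ _); have := ltn_ord j; lia.
  rewrite linear0 ypow_lt //; rewrite linear0 gr_class0; by case: ifP.
under eq_bigr do rewrite E.
case: ifP => rs; last by rewrite big1.
have cD : {morph gr_class v (s - r.+1) : x y / x + y >-> x + y}.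
  by move=> x y; have := gr_classP (s - r.+1) 1 x y; rewrite !scale1r.
by rewrite (big_morph _ cD (gr_class0 _)).
Qed.

(** Quantifying over H says that the coefficient of z^s in e(z)^r v is a combination of the earlier
    ones. Those lie in lower filtration degree, so the coefficient vanishes in the graded module. *)
Lemma gr_wcond A :
  (forall (H : {vspace M}) r s, (bnd [seq a.-1 | a <- A] r < s)%N ->
     (forall t, (t < s)%N -> ypow (opE M) r t v \in H) -> ypow (opE M) r s v \in H) ->
  wcond A (gr_class v 0 v : G).
Proof.
move=> h r s rs; rewrite gr_ypow; case: leqP => // rs'.
apply: gr_class_eq0; apply: (h _ _ _ rs) => t ts.
have [tr|tr] := ltnP t r; first by rewrite ypow_lt // mem0v.
case E: (s - r)%N => [|d] /=; first by lia.
have dE : (t - r <= d)%N by lia.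
exact: (subvP (filt_mono v dE)) _ (ypow_filt tr).
Qed.

Lemma dim_pointwise (U : nat -> {vspace M}) :
  \dim (pointwise v U) = (\sum_(s < top.+1) \dim (U s))%N.
Proof.
pose dl_fun (s : 'I_top.+1) (u : M) : grade_space v := [ffun t => if t == s then u else 0].
have dl_lin s : linear (dl_fun s).
  move=> c u w; apply/ffunP => t; rewrite !ffunE.
  by case: ifP => _ //; rewrite scaler0 addr0.
pose dlL s := GRing.isLinear.Build K M (grade_space v) _ (dl_fun s) (dl_lin s).
pose dl s : 'Hom(M, grade_space v) := linfun (HB.pack (dl_fun s) (dlL s) : {linear M -> grade_space v}).
have dlE s u t : dl s u t = if t == s then u else 0 by rewrite lfunE /= ffunE.
have -> : pointwise v U = (\sum_(s < top.+1) (dl s @: U s))%VS.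
  apply/eqP; rewrite eqEsubv; apply/andP; split.
    apply/subvP => w /mem_pointwise wU.
    have -> : w = \sum_(s < top.+1) dl s (w s).
      apply/ffunP => t; rewrite sum_ffunE (bigD1 t) //= dlE eqxx big1 ?addr0 // => s st.
      by rewrite dlE eq_sym (negPf st).
    by apply: memv_sumr => s _; apply: memv_img.
  apply/subv_sumP => s _; apply/subvP => _ /memv_imgP [u us ->].
  by apply/mem_pointwise => t; rewrite dlE; case: eqP => [->|_]; rewrite ?mem0v.
have /directvP -> : directv (\sum_(s < top.+1) (dl s @: U s)).
  apply/directv_sum_independent => us usU us0 i _.
  have E s t : t != s -> us s t = 0.
    move=> ts; have /memv_imgP [u _ ->] := usU s isT.
    by rewrite dlE (negPf ts).
  apply/ffunP => t; have [->|ti] := eqVneq t i; last by rewrite E // ffunE.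
  have : (\sum_s us s) i = 0 by rewrite us0 ffunE.
  rewrite sum_ffunE (bigD1 i) //= big1 ?addr0 => [->|s si]; first by rewrite ffunE.
  by rewrite E // eq_sym.
apply: eq_bigr => s _ /=; apply: limg_dim_eq; apply/eqP; rewrite -subv0.
apply/subvP => u; rewrite memv_cap memv_ker => /andP [_ /eqP u0].
by have := dlE s u s; rewrite u0 ffunE eqxx => <-; rewrite mem0v.
Qed.

(** The sum of dim F_s - dim F_{s-1} telescopes to the dimension of the last F_s, which is stable
    under the e_j and contains the cyclic vector v. *)
Lemma dim_gr : espan v = fullv -> \dim {:G} = \dim {:M}.
Proof.
move=> cv; have -> : \dim {:G} = \dim (filt_sum v :\: filt_pred_sum v)%VS by rewrite dimvf.
have := dimv_cap_compl (filt_sum v) (filt_pred_sum v).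
rewrite (capv_idPr (filt_sumS v)) !dim_pointwise.
rewrite big_ord_recl dimv0 add0n big_ord_recr /= addnC => /eqP.
rewrite addnC eqn_add2l => /eqP ->.
congr (\dim _); apply/eqP; rewrite eqEsubv subvf -cv.
apply: generated_sub; first by rewrite filt_eword; apply: mem_spanS; exists [::].
move=> _ [j ->]; apply: subv_trans (filt_act v j (sl2_e K) top) _.
by rewrite filt_topP // leq_addl.
Qed.

End Graded.

(** * Generating series on tensor products of evaluation modules *)

Section Sequences.
Variables (K : numFieldType).

(* Multiplication by 1 - a z of the generating series of [f]. *)
Definition lop (V : lmodType K) (a : K) (f : nat -> V) (s : nat) : V :=
  if s is t.+1 then f t.+1 - a *: f t else f 0%N.

Definition sdeg (V : lmodType K) (f : nat -> V) D := forall s, (D < s)%N -> f s = 0.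

Lemma lop_deg (V : lmodType K) a (f : nat -> V) D : sdeg f D -> sdeg (lop a f) D.+1.
Proof.
move=> h [|s] //; rewrite ltnS => Ds; rewrite /= (h s.+1) ?(h s) ?scaler0 ?subrr //.
exact: ltnW.
Qed.

Lemma iter_lop_deg (V : lmodType K) a m (f : nat -> V) D :
  sdeg f D -> sdeg (iter m (lop a) f) (m + D).
Proof. by move=> h; elim: m => //= m IH; apply: lop_deg. Qed.

Lemma lop_ext (V : lmodType K) a (f g : nat -> V) : f =1 g -> lop a f =1 lop a g.
Proof. by move=> h [|s] /=; rewrite !h. Qed.

Lemma iter_lop_ext (V : lmodType K) a m (f g : nat -> V) :
  f =1 g -> iter m (lop a) f =1 iter m (lop a) g.
Proof. by move=> h; elim: m => //= m IH; apply: lop_ext. Qed.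

Lemma lop_sum (V : lmodType K) a I (r : seq I) (c : I -> K) (F : I -> nat -> V) s :
  lop a (fun s => \sum_(i <- r) c i *: F i s) s = \sum_(i <- r) c i *: lop a (F i) s.
Proof.
case: s => //= s; rewrite scaler_sumr -sumrB; apply: eq_bigr => i _.
by rewrite scalerBr !scalerA mulrC.
Qed.

Lemma lop_low (V : vectType K) a (H : {vspace V}) (f : nat -> V) s :
  (forall t, (t < s)%N -> f t \in H) ->
  (forall t, (t < s)%N -> lop a f t \in H) /\ lop a f s - f s \in H.
Proof.
move=> h; split=> [[|t] ts /=|].
- exact: h.
- by rewrite memvB ?memvZ ?h // ltnW.
case: s h => [|s] h /=; first by rewrite subrr mem0v.
by rewrite addrAC subrr sub0r memvN memvZ // h.
Qed.

Definition sconv (U W : vectType K) (f : nat -> U) (g : nat -> W) s : tensv U W :=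
  \sum_(t < s.+1) tens (f t) (g (s - t)%N).

Lemma sconv_deg (U W : vectType K) (f : nat -> U) (g : nat -> W) D D' :
  sdeg f D -> sdeg g D' -> sdeg (sconv f g) (D + D').
Proof.
move=> hf hg s Ds; rewrite /sconv big1 // => t _.
have [Dt|tD] := ltnP D t; first by rewrite hf // tens0l.
by rewrite (hg (s - t)%N) ?tens0r //; lia.
Qed.

Lemma tensNr (U W : vectType K) (u : U) (w w' : W) : tens u (w - w') = tens u w - tens u w'.
Proof. by rewrite tensDr -scaleN1r tensZr scaleN1r. Qed.
Lemma tensNl (U W : vectType K) (u u' : U) (w : W) : tens (u - u') w = tens u w - tens u' w.
Proof. by rewrite tensDl -scaleN1r tensZl scaleN1r. Qed.

Lemma lop_sconvl (U W : vectType K) a (f : nat -> U) (g : nat -> W) :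
  lop a (sconv f g) =1 sconv (lop a f) g.
Proof.
case=> [|s]; first by rewrite /= /sconv !big_ord1.
rewrite /= /sconv [in RHS]big_ord_recl [in LHS]big_ord_recl -addrA; congr (_ + _).
rewrite scaler_sumr -sumrB; apply: eq_bigr => t _.
by rewrite /= /bump leq0n add1n subSS tensNl tensZl.
Qed.

Lemma lop_sconvr (U W : vectType K) a (f : nat -> U) (g : nat -> W) :
  lop a (sconv f g) =1 sconv f (lop a g).
Proof.
case=> [|s]; first by rewrite /= /sconv !big_ord1.
rewrite /= /sconv [in RHS]big_ord_recr [in LHS]big_ord_recr /= subnn addrAC; congr (_ + _).
rewrite scaler_sumr -sumrB; apply: eq_bigr => t _.
by rewrite subSn ?tensNr ?tensZr // -ltnS.
Qed.

Lemma iter_lop_sconvl (U W : vectType K) a m (f : nat -> U) (g : nat -> W) :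
  iter m (lop a) (sconv f g) =1 sconv (iter m (lop a) f) g.
Proof.
elim: m => //= m IH s; rewrite (lop_ext a IH); exact: lop_sconvl.
Qed.

(* Multiplication by the product of the (1 - z_i z)^min(R, a_i - 1), for
   [S] the list of the (a_i, z_i). *)
Fixpoint lops (V : lmodType K) (S : seq (nat * K)) R (f : nat -> V) : nat -> V :=
  if S is p :: S' then iter (minn R p.1.-1) (lop p.2) (lops S' R f) else f.

Lemma lops_ext (V : lmodType K) S R (f g : nat -> V) : f =1 g -> lops S R f =1 lops S R g.
Proof. by move=> h; elim: S => //= p S IH; apply: iter_lop_ext. Qed.

Lemma lops_sconvr (U W : vectType K) S R (f : nat -> U) (g : nat -> W) :
  lops S R (sconv f g) =1 sconv f (lops S R g).
Proof.
elim: S => //= p S IH; elim: (minn _ _) => //= m IHm s.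
rewrite (lop_ext p.2 IHm); exact: lop_sconvr.
Qed.

Lemma lops_sum (V : lmodType K) S R I (r : seq I) (c : I -> K) (F : I -> nat -> V) s :
  lops S R (fun s => \sum_(i <- r) c i *: F i s) s = \sum_(i <- r) c i *: lops S R (F i) s.
Proof.
elim: S s => //= p S IH; elim: (minn _ _) => //= m IHm s.
by rewrite (lop_ext p.2 IHm) lop_sum.
Qed.

(** The multiplying polynomial has constant term 1, so it changes the s-th coefficient only by a
    combination of earlier ones. Where the product vanishes, this is a recurrence. *)
Lemma lops_low (V : vectType K) S R (H : {vspace V}) (f : nat -> V) s :
  (forall t, (t < s)%N -> f t \in H) ->
  (forall t, (t < s)%N -> lops S R f t \in H) /\ lops S R f s - f s \in H.
Proof.
move=> h; elim: S => /= [|p S IH]; first by rewrite subrr mem0v.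
elim: (minn _ _) => //= m [h1 h2]; have [h3 h4] := lop_low p.2 h1; split=> //.
by rewrite -(subrK (iter m (lop p.2) (lops S R f) s) (lop _ _ _)) -addrA memvD.
Qed.

End Sequences.

Section EvTensor.
Variable K : numFieldType.
Implicit Types S : seq (nat * K).

Lemma irr_mx_e a : irr_mx a (sl2_e K) = irr_e K a.
Proof. by rewrite /irr_mx /= !mxE /= !scale0r !addr0 scale1r. Qed.
Lemma irr_mx_h a : irr_mx a (sl2_h K) = irr_h K a.
Proof. by rewrite /irr_mx /= !mxE /= !subr0 !scale0r !addr0 add0r scale1r. Qed.
Lemma irr_mx_f a : irr_mx a (sl2_f K) = irr_f K a.
Proof. by rewrite /irr_mx /= !mxE /= !scale0r !add0r scale1r. Qed.

Lemma ev_lowest_lowest a (z : K) :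
  lowest (fun j => (1 - a%:R) * z ^+ j) (ev_lowest a z).
Proof.
move=> j; rewrite /= !ev_actE irr_mx_f irr_mx_h; split.
  rewrite [X in _ *: X](_ : _ = 0) ?scaler0 //; apply/matrixP => k l; rewrite !mxE.
  rewrite big1 // => i _; rewrite !mxE; case: (i == 0 :> nat) / eqP => [->|_]; last by rewrite mulr0.
  by rewrite mul0n mul0rn mul0r.
rewrite mulrC -scalerA; congr (_ *: _); apply/matrixP => k l; rewrite !mxE.
rewrite (bigD1 k) //= big1 ?addr0 => [|i ik].
  by rewrite !mxE eqxx mulr1n; case: (k == 0 :> nat) / eqP => [->|_]; rewrite ?mulr0.
by rewrite !mxE eq_sym (negPf ik) mulr0n mul0r.
Qed.

Lemma ev_tensor_lowestP S :
  lowest (fun j => \sum_(p <- S) (1 - p.1%:R) * p.2 ^+ j) (ev_tensor_lowest S).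
Proof.
elim: S => [|[a z] S IH] j /=.
  by rewrite !lfunE big_nil scale0r.
have := lowest_tens (ev_lowest_lowest a z) IH j; rewrite /= big_cons; exact.
Qed.

Lemma dim_ev_tensor S : \dim {:ev_tensor S} = (\prod_(p <- S) p.1)%N.
Proof.
elim: S => [|[a z] S IH]; first by rewrite big_nil dimvf.
by rewrite big_cons /= dim_tensv IH dimvf /= dim_matrix mulr1.
Qed.

Lemma ev_act_sum a (z : K) N (c : nat -> K) x (u : ev_module a z) :
  \sum_(k < N) c k *: act (ev_module a z) k x u = (\sum_(k < N) c k * z ^+ k) *: (irr_mx a x *m u).
Proof.
by rewrite scaler_suml; apply: eq_bigr => k _; rewrite /= ev_actE scalerA.
Qed.

Lemma tens_act_sum (M M' : current_module K) N (c : nat -> K) x (u : M) (w : M') :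
  \sum_(k < N) c k *: act (tens_module M M') k x (tens u w) =
    tens (\sum_(k < N) c k *: act M k x u) w + tens u (\sum_(k < N) c k *: act M' k x w).
Proof.
rewrite tens_suml tens_sumr -big_split; apply: eq_bigr => k _.
by rewrite tens_actT scalerDr tensZl tensZr.
Qed.

Lemma ev_tensor_vanish S N (c : nat -> K) :
  (forall z, z \in unzip2 S -> \sum_(k < N) c k * z ^+ k = 0) ->
  forall x (u : ev_tensor S), \sum_(k < N) c k *: act (ev_tensor S) k x u = 0.
Proof.
elim: S => [|[a z] S IH] h x.
  by move=> u; rewrite big1 // => k _; rewrite /= lfunE /= scaler0.
apply: tens_ind.
- by rewrite big1 // => k _; rewrite linear0 scaler0.
- move=> d T T' hT hT'.
  under eq_bigr do rewrite linearP scalerDr scalerA [_ * d]mulrC -scalerA.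
  by rewrite big_split -scaler_sumr /= hT hT' scaler0 addr0.
move=> u w; rewrite tens_act_sum ev_act_sum h ?inE ?eqxx // scale0r tens0l add0r.
by rewrite IH ?tens0r // => z' z'S; apply: h; rewrite inE z'S orbT.
Qed.

(** The monic polynomial t^{j-n} (t - z_1) ... (t - z_n), with n = [size S], vanishes at every
    evaluation point and expresses x_j through the lower x_k. *)
Lemma ev_tensor_monic S j x (u : ev_tensor S) : (size S <= j)%N -> exists c : nat -> K,
  act (ev_tensor S) j x u = \sum_(k < j) c k *: act (ev_tensor S) k x u.
Proof.
move=> Sj; pose p : {poly K} := 'X^(j - size S) * \prod_(z <- unzip2 S) ('X - z%:P).
have mp : p \is monic by rewrite monicMl ?monicXn // monic_prod_XsubC.
have sp : size p = j.+1.
  rewrite /p size_monicM ?monicXn //; last by rewrite monic_neq0 // monic_prod_XsubC.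
  by rewrite size_polyXn size_prod_XsubC size_map; lia.
exists (fun k => - p`_k).
have p0 z : z \in unzip2 S -> \sum_(k < j.+1) p`_k * z ^+ k = 0.
  move=> zS; rewrite -sp -horner_coef; apply/eqP; rewrite -/(root _ _) rootM.
  by rewrite root_prod_XsubC zS orbT.
have := ev_tensor_vanish p0 x u; rewrite big_ord_recr /= (_ : p`_j = 1) ?scale1r; last first.
  by have := monicP mp; rewrite /lead_coef sp.
move=> /eqP; rewrite addrC addr_eq0 => /eqP ->.
by rewrite -sumrN; apply: eq_bigr => k _; rewrite scaleNr.
Qed.

Lemma irr_e_iter a (k : nat) :
  iter k (mulmx (irr_e K a)) (\col_(i < a) (i == 0 :> nat)%:R) = \col_(i < a) (i == k :> nat)%:R.
Proof.
elim: k => //= k ->; apply/matrixP => i l; rewrite !mxE.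
have [ka|ak] := ltnP k a; last first.
  rewrite big1 => [|m _]; last by rewrite !mxE (ltn_eqF (leq_trans (ltn_ord m) ak)) mulr0.
  by rewrite (ltn_eqF (leq_trans (ltn_ord i) (leqW ak))).
rewrite (bigD1 (Ordinal ka)) //= big1 ?addr0 => [|m mk].
  by rewrite !mxE eqxx mulr1.
rewrite !mxE; case: (m =P k :> nat) => [mk'|]; last by rewrite mulr0.
by case/eqP: mk; apply: val_inj.
Qed.

(** As the points are distinct, interpolation gives a combination of the e_k that acts as e on the
    first factor and by zero on the others. Subtracting the action on the first factor then yields
    [tens v1 w] for all w by induction, and applying e to the first factor yields the rest. *)
Lemma ev_tensor_cyclic S : uniq (unzip2 S) -> espan (ev_tensor_lowest S) = fullv.
Proof.
elim: S => [|[a z] S IH] /=.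
  move=> _; apply/eqP; rewrite eqEsubv subvf; apply/subvP => u _.
  have -> : u = (u : K) *: (1 : K^o) by rewrite /GRing.scale /= mulr1.
  apply: memvZ; exact: generated_self.
case/andP => zS uS; set v1 := ev_lowest a z; set v2 := ev_tensor_lowest S.
set T := tens_module _ _; set U := espan _.
pose q : {poly K} := \prod_(y <- unzip2 S) ('X - y%:P).
have q0 : q.[z] != 0 by rewrite -/(root _ _) root_prod_XsubC.
pose p := (q.[z])^-1 *: q.
have eU j t : t \in U -> opE T j t \in U by apply: espan_opE.
have XU (u : ev_module a z) (w : ev_tensor S) : (tens u w : T) \in U ->
    (tens (irr_e K a *m u : ev_module a z) w : T) \in U.
  move=> uwU.
  have : \sum_(k < size p) p`_k *: act T k (sl2_e K) (tens u w) \in U.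
    by apply: memv_suml => k _; apply: memvZ; apply: eU.
  rewrite tens_act_sum ev_act_sum -horner_coef /p hornerZ mulVf // scale1r irr_mx_e.
  rewrite ev_tensor_vanish ?tens0r ?addr0 // => y yS.
  rewrite -horner_coef hornerZ [q.[y]](_ : _ = 0) ?mulr0 //.
  by apply/eqP; rewrite -/(root _ _) root_prod_XsubC.
have v1U (w : ev_tensor S) : (tens v1 w : T) \in U.
  have : w \in espan v2 by rewrite IH // memvf.
  move: w; apply: generated_ind.
  - by rewrite tens0r mem0v.
  - by move=> c w w' hw hw'; rewrite tensPr memvD ?memvZ.
  - exact: generated_self.
  move=> _ w [j ->] hw; have := eU j _ hw; rewrite /opE tens_actT.
  rewrite addrC => h; rewrite -(addrK (tens (act (ev_module a z) j (sl2_e K) v1) w) (tens _ _)).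
  by rewrite memvB // /= ev_actE irr_mx_e tensZl memvZ // XU.
apply/eqP; rewrite eqEsubv subvf; apply/subvP => t _; move: t; apply: tens_ind.
- exact: mem0v.
- by move=> c t t' ht ht'; rewrite memvD ?memvZ.
move=> u w; have -> : u = \sum_(k < a) (u : 'cV_a) k 0 *: (iter k (mulmx (irr_e K a)) (v1 : 'cV_a)).
  apply/matrixP => i l; rewrite summxE (bigD1 i) //= big1 ?addr0 => [|k ki].
    by rewrite irr_e_iter !mxE eqxx mulr1 ord1.
  by rewrite irr_e_iter !mxE eq_sym [k == i :> nat](negPf ki) mulr0.
rewrite tens_suml; apply: memv_suml => k _; rewrite tensZl; apply: memvZ.
by elim: (k : nat) => [|m IHm] /=; [apply: v1U | apply: XU].
Qed.

Definition ashift a (f : nat -> 'cV[K]_a) s : 'cV[K]_a := if s is t.+1 then irr_e K a *m f t else 0.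

Lemma lop_ashift a z (f : nat -> 'cV[K]_a) : lop z (ashift f) =1 ashift (lop z f).
Proof.
case=> [|[|s]] //=; first by rewrite scaler0 subr0.
by rewrite mulmxBr -scalemxAr.
Qed.

(** At an evaluation point c the series e(z) is e z/(1 - c z), so multiplying by 1 - c z turns one
    factor e(z) into e z, which is the operation [ashift]. *)
Lemma ev_ypow_lop a (z : K) r (v : 'cV[K]_a) :
  lop z (fun s => ypow (opE (ev_module a z)) r.+1 s v) =1
  ashift (fun s => ypow (opE (ev_module a z)) r s v).
Proof.
have E s t : opE (ev_module a z) s t = z ^+ s *: (irr_e K a *m t).
  by rewrite /opE /= ev_actE irr_mx_e.
case=> [|s]; first by rewrite /= big_ord0.
rewrite [LHS]/lop !ypowS big_ord_recl subn1 /= E expr0 scale1r -addrA.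
rewrite -[RHS]addr0; congr (_ + _); rewrite scaler_sumr -sumrB big1 // => j _.
by rewrite !E /= /bump leq0n add1n subSS exprS scalerA subrr.
Qed.

(** At the point c, (1 - c z)^m e(z)^r is (e z)^r (1 - c z)^{m-r}. *)
Lemma ev_ypow_deg a (z : K) m r (v : 'cV[K]_a) : (r <= m)%N ->
  sdeg (iter m (lop z) (fun s => ypow (opE (ev_module a z)) r s v)) m.
Proof.
elim: r m => [|r IH] m rm.
  rewrite -[X in sdeg _ X]addn0; apply: iter_lop_deg; by case.
case: m rm => // m rm; rewrite iterSr.
have E : iter m (lop z) (lop z (fun s => ypow (opE (ev_module a z)) r.+1 s v)) =1
    ashift (iter m (lop z) (fun s => ypow (opE (ev_module a z)) r s v)).
  move=> s; rewrite (iter_lop_ext z m (ev_ypow_lop z r v)).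
  elim: m {rm} s => //= m IHm s; rewrite (lop_ext z IHm); exact: lop_ashift.
by case=> // s ms; rewrite E /= IH ?mulmx0.
Qed.

Lemma ev_ypow_eq0 a (z : K) r s : (a.-1 < r)%N ->
  ypow (opE (ev_module a z)) r s (ev_lowest a z) = 0.
Proof.
move=> ar; have [c ->] : exists c : K, ypow (opE (ev_module a z)) r s (ev_lowest a z) =
    c *: (iter r (mulmx (irr_e K a)) (ev_lowest a z : 'cV_a) : 'cV_a).
  elim: r s {ar} => [|r IH] s.
    by case: s => [|s]; [exists 1; rewrite scale1r|exists 0; rewrite scale0r].
  pose c j := projT1 (cid (IH j)).
  have cE j : ypow (opE (ev_module a z)) r j (ev_lowest a z) = c j *:
     (iter r (mulmx (irr_e K a)) (ev_lowest a z : 'cV_a) : 'cV_a) by rewrite /c; case: cid.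
  exists (\sum_(j < s) z ^+ j * c (s - j.+1)%N); rewrite ypowS scaler_suml.
  by apply: eq_bigr => j _; rewrite cE linearZ /= /opE /= ev_actE irr_mx_e scalerA mulrC.
rewrite irr_e_iter [X in _ *: X](_ : _ = 0) ?scaler0 //.
apply/matrixP => i l; rewrite !mxE (_ : (i == r :> nat) = false) //.
by apply/negbTE; rewrite neq_ltn; apply/orP; left; have := ltn_ord i; lia.
Qed.

(** R is separate from r because all binomial terms, with exponents at most r on each factor, must
    be multiplied by one and the same polynomial. On a factor of dimension a, powers beyond a - 1
    vanish, so the exponent min(R, a - 1) clears the denominators. *)
Lemma ev_tensor_deg S R r : (r <= R)%N ->
  sdeg (lops S R (fun s => ypow (opE (ev_tensor S)) r s (ev_tensor_lowest S)))
    (bnd [seq p.1.-1 | p <- S] R).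
Proof.
elim: S r => [|[a z] S IH] r rR.
  rewrite /bnd big_nil /=; case: r {rR} => [|r]; first by case.
  move=> s _; rewrite /= big1 // => j _; by rewrite /opE /= lfunE.
rewrite /bnd /= big_cons -/(bnd _ R).
pose Y1 i s := ypow (opE (ev_module a z)) i s (ev_lowest a z).
pose Y2 i s := ypow (opE (ev_tensor S)) i s (ev_tensor_lowest S).
have E : iter (minn R a.-1) (lop z) (lops S R (fun s => ypow (opE (ev_tensor ((a, z) :: S))) r s
     (ev_tensor_lowest ((a, z) :: S)))) =1
   (fun s => \sum_(i < r.+1) 'C(r, i)%:R *: sconv (iter (minn R a.-1) (lop z) (Y1 i)) (lops S R (Y2 (r - i)%N)) s).
  move=> s.
  pose F (i : 'I_r.+1) := sconv (Y1 i) (Y2 (r - i)%N).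
  have E0 : (fun s => ypow (opE (ev_tensor ((a, z) :: S))) r s (ev_tensor_lowest ((a, z) :: S))) =1
     (fun s => \sum_(i < r.+1) 'C(r, i)%:R *: F i s).
    by move=> s'; rewrite [LHS]ypow_tens.
  apply: (etrans (lops_ext ((a, z) :: S) R E0 s)); rewrite lops_sum; apply: eq_bigr => i _; congr (_ *: _).
  rewrite /= /F (iter_lop_ext z _ (lops_sconvr S R (Y1 i) (Y2 (r - i)%N))).
  exact: iter_lop_sconvl.
move=> s Ds; rewrite [LHS]E big1 // => i _.
have ir : (i <= r)%N by rewrite -ltnS ltn_ord.
rewrite (sconv_deg _ _ Ds) ?scaler0 //; last first.
  by apply: IH; apply: leq_trans (leq_subr _ _) rR.
have [ia|ai] := leqP i a.-1; first by apply: ev_ypow_deg; rewrite leq_min ia andbT (leq_trans ir).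
have Y0 : Y1 i =1 (fun=> 0) by move=> t; apply: ev_ypow_eq0.
move=> t _; rewrite (iter_lop_ext z _ Y0).
by elim: (minn _ _) t => // m IHm [|t] /=; rewrite !IHm ?scaler0 ?subr0.
Qed.

(** Multiplied by a polynomial with constant term 1, the series e(z)^r v has degree at most [bnd];
    hence its later coefficients are combinations of earlier ones. *)
Lemma ev_tensor_recurrence S (H : {vspace ev_tensor S}) r s :
  (bnd [seq p.1.-1 | p <- S] r < s)%N ->
  (forall t, (t < s)%N -> ypow (opE (ev_tensor S)) r t (ev_tensor_lowest S) \in H) ->
  ypow (opE (ev_tensor S)) r s (ev_tensor_lowest S) \in H.
Proof.
move=> rs h; have [_] := lops_low S r h.
by rewrite (ev_tensor_deg (leqnn r) rs) sub0r memvN.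
Qed.

End EvTensor.

(** * Weight, truncation, dimension and relations of fusion products *)

Section Fusion.
Variables (K : numFieldType) (A : seq nat) (z : seq K).
Hypothesis ptz : fusion_points A z.

Let sz : size z = size A. Proof. by case/andP: ptz => /eqP. Qed.
Let z1 : unzip1 (zip A z) = A. Proof. by rewrite unzip1_zip // sz. Qed.
Let z2 : unzip2 (zip A z) = z. Proof. by rewrite unzip2_zip // sz. Qed.

Definition fusion_weight (B : seq nat) (j : nat) : K :=
  if j == 0%N then \sum_(a <- B) (1 - a%:R) else 0.

Lemma fusion_lowest : lowest (fusion_weight A) (fusion_vec A z).
Proof.
have wE : \sum_(a <- A) (1 - a%:R) = \sum_(p <- zip A z) (1 - p.1%:R) * p.2 ^+ 0 :> K.
  by rewrite -[in LHS]z1 big_map; under [in RHS]eq_bigr do rewrite expr0 mulr1.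
move=> j; rewrite /fusion_weight wE.
exact: gr_lowest (ev_tensor_lowestP (zip A z)) j.
Qed.

Lemma fusion_cyclic : espan (fusion_vec A z) = fullv.
Proof. exact: gr_cyclic (ev_tensor_lowestP (zip A z)). Qed.

Lemma fusion_truncated : truncated (size A) (fusion A z).
Proof.
apply: gr_truncated => j x u Aj; apply: ev_tensor_monic.
by rewrite size_zip sz minnn.
Qed.

Lemma fusion_dim : \dim {:fusion A z} = (\prod_(a <- A) a)%N.
Proof.
have pE : (\prod_(a <- A) a = \prod_(p <- zip A z) p.1)%N by rewrite -[in LHS]z1 big_map.
rewrite pE -dim_ev_tensor; apply: (dim_gr (ev_tensor_lowestP (zip A z))).
by apply: ev_tensor_cyclic; rewrite z2; case/andP: ptz.
Qed.

Lemma fusion_wcond : wcond A (fusion_vec A z).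
Proof.
apply: (gr_wcond (ev_tensor_lowestP (zip A z))) => H r s rs h.
apply: ev_tensor_recurrence h; move: rs.
have -> : [seq p.1.-1 | p <- zip A z] = [seq a.-1 | a <- A] by rewrite -[in RHS]z1 -map_comp.
exact.
Qed.

End Fusion.

(** * Column modules *)

Section Columns.
Variable K : numFieldType.
Implicit Types (M N : current_module K) (ds : seq nat).

Definition wt (m : nat) (j : nat) : K := if j == 0%N then - m%:R else 0.

Lemma lowest_eq M (u : M) lam mu : lam =1 mu -> lowest lam u -> lowest mu u.
Proof. by move=> h lu j; rewrite -h; apply: lu. Qed.

Lemma fusion_lowest_wt A (z : seq K) : fusion_points A z -> all (leq 1) A ->
  lowest (wt (\sum_(a <- A) a.-1)) (fusion_vec A z).
Proof.
move=> ptz A1; apply: lowest_eq (fusion_lowest ptz) => j.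
rewrite /fusion_weight /wt; case: eqP => // _; rewrite natr_sum -sumrN.
apply: eq_big_seq => a /(allP A1); case: a => // a _.
by rewrite -natr1 opprD addrCA subrr addr0.
Qed.

Lemma fusion_pmap A (z : seq K) n N (u : N) : fusion_points A z -> all (leq 1) A ->
  truncated n N -> wcond A u -> lowest (wt (\sum_(a <- A) a.-1)) u ->
  pmap (fusion_vec A z) u.
Proof.
move=> ptz A1 tN uA lu.
apply: (@wcond_hom K _ _ (maxn n (size A)) A _ _ (wt (\sum_(a <- A) a.-1))) => //.
- exact: truncated_leq (leq_maxr _ _) (fusion_truncated ptz).
- exact: truncated_leq (leq_maxl _ _) tN.
- exact: leq_maxr.
- exact: fusion_cyclic.
- by rewrite fusion_dim.
- exact: fusion_wcond.
exact: fusion_lowest_wt.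
Qed.

Lemma hom_inj_dim M N (th : current_hom M N) (u : M) : espan u = fullv ->
  (\dim {:M} <= \dim (espan (th u)))%N -> lker th == 0%VS.
Proof.
move=> cu; rewrite -hom_espan cu -dimv_eq0 => h.
have := limg_ker_dim th fullv; rewrite capfv => E.
by rewrite -leqn0 -(leq_add2r (\dim (limg th))) add0n E.
Qed.

(** Moving f_j past e_{d-1} gives -h_{j+d-1}, which kills u since j + d - 1 > 0. Moving h_j past it
    gives 2 e_{j+d-1}, which vanishes by truncation unless j = 0 and then raises the weight by
    two. *)
Lemma lowest_top M m d (u : M) : lowest (wt m) u -> truncated d M -> (2 <= d <= m)%N ->
  lowest (wt (m - 2)) (opE M d.-1 u).
Proof.
move=> lu tM /andP [d2 dm] j; have [fj hj] := lu j.
rewrite act_fe act_he fj hj linear0 sub0r; have [_ ->] := lu (j + d.-1)%N.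
have z0 : wt m (j + d.-1) = 0 by rewrite /wt; case: eqP => //; lia.
rewrite z0 scale0r oppr0; split=> //; rewrite linearZ /= /wt.
case: j {fj hj z0} => [|j] /=.
  by rewrite -scalerDl natrB ?opprB 1?addrC //; lia.
by rewrite {2}/opE tM ?lfunE /= ?scaler0 ?scale0r ?addr0 //; lia.
Qed.

(** Any distinct points would serve; the integers 0, ..., d-1 are distinct in characteristic
    zero. *)
Definition colpts (d : nat) : seq K := [seq k%:R | k <- iota 0 d].

Lemma colptsP d : fusion_points (nseq d 2) (colpts d).
Proof.
rewrite /fusion_points /colpts size_map size_iota size_nseq eqxx /=.
by rewrite map_inj_uniq ?iota_uniq // => x y /eqP; rewrite eqr_nat => /eqP.
Qed.

Definition cmod (d : nat) : current_module K := fusion (nseq d 2) (colpts d).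
Definition cvec (d : nat) : cmod d := fusion_vec (nseq d 2) (colpts d).
Definition ctop (d : nat) : cmod d := opE (cmod d) d.-1 (cvec d).

Lemma nseq2_gt0 d : all (leq 1) (nseq d 2). Proof. by rewrite all_nseq orbT. Qed.

Lemma cmod_truncated d : truncated d (cmod d).
Proof. by have := fusion_truncated (colptsP d); rewrite size_nseq. Qed.
Lemma cmod_cyclic d : espan (cvec d) = fullv.
Proof. exact: fusion_cyclic. Qed.
Lemma sum_nseq2 d : (\sum_(a <- nseq d 2) a.-1 = d)%N.
Proof. by rewrite big_nseq iter_addn_0 mul1n. Qed.
Lemma cmod_lowest d : lowest (wt d) (cvec d).
Proof. by have := fusion_lowest_wt (colptsP d) (nseq2_gt0 d); rewrite sum_nseq2. Qed.
Lemma cmod_dim d : \dim {:cmod d} = (2 ^ d)%N.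
Proof. by rewrite fusion_dim ?colptsP // big_nseq -[RHS]muln1 -iter_muln. Qed.
Lemma bnd_nseq2 d r : bnd [seq a.-1 | a <- nseq d 2] r = (minn r 1 * d)%N.
Proof. by rewrite /bnd map_nseq big_nseq iter_addn_0. Qed.
Lemma cmod_dbound d : dbound (cvec d) (fun r => (minn r 1 * d)%N).
Proof. by move=> r s; rewrite -bnd_nseq2; apply: fusion_wcond (colptsP d) r s. Qed.

Lemma cmod_pmap d n N (u : N) : truncated n N -> lowest (wt d) u ->
  dbound u (fun r => (minn r 1 * d)%N) -> pmap (cvec d) u.
Proof.
move=> tN lu bu; apply: (fusion_pmap (colptsP d) (nseq2_gt0 d) tN).
  by move=> r s; rewrite bnd_nseq2; apply: bu.
by rewrite sum_nseq2.
Qed.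

Lemma ctop_cond d : cond (pvar K d.+2) d.+2 (nseq d.+2 1) (annih (opE (cmod d.+2)) 0%VS (cvec d.+2)).
Proof.
have := @wcond_annih K (cmod d.+2) d.+2 (nseq d.+2 2) (cvec d.+2) 0%VS (@cmod_truncated d.+2).
rewrite size_nseq map_nseq; apply=> // [j|r s]; first by rewrite limg0.
have := @cmod_dbound d.+2 r s; rewrite -bnd_nseq2 map_nseq => h /h ->.
exact: mem0v.
Qed.

Lemma nseq_leq1 d : path leq 1 (nseq d 1).
Proof. by elim: d. Qed.

(** [cond_colon] with x = y = 1: the annihilator of e_{d+1} w_{d+2} satisfies the relations with
    entries 0, 1, ..., 1, which are those of W(d). *)
Lemma ctop_pmap d : pmap (cvec d) (ctop d.+2).
Proof.
have t := @cmod_truncated d.+2.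
apply: (cmod_pmap t).
  have := lowest_top (cmod_lowest d.+2) t (leqnn d.+2 : (2 <= d.+2 <= d.+2)%N).
  by rewrite subn2.
have idJ := annih_ideal d.+2 (@opE_comm K (cmod d.+2)) (cvec d.+2) (H := 0%VS)
  (fun j => eq_ind_r (fun U => (U <= 0)%VS) (subvv 0) (limg0 _)).
have c := cond_colon idJ (size_nseq d 1) (nseq_leq1 d.+1) (ctop_cond d).
have idc := ideal_colon (pvar K d.+2 d.+1 ^+ 1) idJ.
have [_ h] := cond_grow idc (leqnSn d.+1) c.
move=> r s rs; have := h r s; rewrite /bnd big_cons subnn minn0 add0n big_nseq iter_addn_0 => /(_ rs).
rewrite /colon expr1 /annih memv0 (pactM (@opE_comm _ _)) (pact_pvar (truncated_opE t)).
by rewrite (pact_lvl (@opE_comm _ _) (truncated_opE t)) => /eqP.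
Qed.

(** By [cond_adjoin], the quotient of W(d+2) by the submodule of e_{d+1} w_{d+2} satisfies the
    relations with entries 0, 2, 1, ..., 1. Its dimension is at most 3 * 2^d, which leaves at least
    2^d for the submodule, the dimension of W(d). *)
Lemma ctop_hom d : exists th : current_hom (cmod d) (cmod d.+2),
  th (cvec d) = ctop d.+2 /\ lker th == 0%VS.
Proof.
have [th thE] := ctop_pmap d; exists th; split=> //.
apply: (hom_inj_dim (cmod_cyclic d)); rewrite thE cmod_dim.
have t := @cmod_truncated d.+2.
have idJ := annih_ideal d.+2 (@opE_comm K (cmod d.+2)) (cvec d.+2) (H := 0%VS)
  (fun j => eq_ind_r (fun U => (U <= 0)%VS) (subvv 0) (limg0 _)).
have al : all (leq 1) (nseq d 1) by rewrite all_nseq orbT.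
have c := cond_adjoin idJ (size_nseq d 1) al (ltn0Sn 0) (ctop_cond d).
have ida := ideal_adjoin (pvar K d.+2 d.+1 ^+ 1) idJ.
have sz : size [:: 0%N, 2%N & nseq d 1] = d.+2 by rewrite /= size_nseq.
have := cond_spans (@pvar_gen K d.+2) ida sz c.
rewrite !big_cons big_nseq iter_muln_1 => sp.
have sub p : adjoin (annih (opE (cmod d.+2)) 0%VS (cvec d.+2)) (pvar K d.+2 d.+1 ^+ 1) p ->
    annih (opE (cmod d.+2)) (espan (ctop d.+2)) (cvec d.+2) p.
  move=> [q]; rewrite /annih memv0 expr1 -scaleN1r addrC pactP scaleN1r addrC subr_eq0 => /eqP ->.
  rewrite (pactM (@opE_comm _ _)) (pact_pvar (truncated_opE t)).
  exact: pact_espan.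
have := spans_dim sp sub t; rewrite cmod_cyclic sumfv cmod_dim !expnS; move: (2 ^ d)%N (\dim _) => x y; lia.
Qed.

Fixpoint zmod ds : current_module K :=
  if ds is d :: ds' then tens_module (cmod d) (zmod ds') else triv_module K.
Fixpoint zvec ds : zmod ds :=
  if ds is d :: ds' then tens (cvec d) (zvec ds') else (1 : K^o).
Fixpoint ztop ds : zmod ds :=
  if ds is d :: ds' then tens (ctop d) (ztop ds') else (1 : K^o).

Lemma zmod_truncated n ds : all (geq n) ds -> truncated n (zmod ds).
Proof.
elim: ds => [|d ds IH] /=; first by move=> _ j x _; apply/lfunP => u; rewrite !lfunE.
move=> /andP [dn dsn]; apply: truncated_tens (IH dsn).
exact: truncated_leq dn (@cmod_truncated d).
Qed.

Lemma zmod_lowest ds : lowest (wt (sumn ds)) (zvec ds).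
Proof.
elim: ds => [|d ds IH] /=.
  by move=> j; rewrite /= !lfunE /wt oppr0; split=> //; case: eqP => _; rewrite scale0r.
apply: lowest_eq (lowest_tens (cmod_lowest d) IH) => j; rewrite /wt.
by case: eqP => _; rewrite ?addr0 // natrD opprD.
Qed.

(** Row lengths of the Young diagram with columns ds; for ds conjugate to A they are the a_j - 1. *)
Definition row ds (t : nat) : nat := count (leq t.+1) ds.
Definition cbound n ds r := (\sum_(t < n) minn r (row ds t))%N.

Lemma sum_ltn n d : (d <= n)%N -> (\sum_(t < n) (t < d) = d)%N.
Proof.
elim: n d => [|n IH] [|d] // dn; first by rewrite big_ord0.
  by rewrite big1.
by rewrite big_ord_recl /= -[in RHS](IH d dn).
Qed.

Lemma zmod_dbound n ds : all (geq n) ds -> dbound (zvec ds) (cbound n ds).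
Proof.
elim: ds => [|d ds IH] /=.
  move=> _ [|r] s; first by case: s.
  by move=> _; rewrite ypowS big1 // => j _; rewrite /opE /= lfunE.
move=> /andP [dn dsn]; apply: dbound_tens (@cmod_dbound d) (IH dsn) _ => i j.
have -> : (minn i 1 * d = \sum_(t < n) minn i 1 * (t < d))%N.
  by rewrite -big_distrr /= sum_ltn.
rewrite /cbound -big_split /=; apply: leq_sum => t _; rewrite /row /=.
by case: (t < d)%N; lia.
Qed.

Lemma sum_row n ds : all (geq n) ds -> (\sum_(t < n) row ds t = sumn ds)%N.
Proof.
elim: ds => [|d ds IH] /=; first by rewrite big1.
by move=> /andP [dn /IH <-]; rewrite /row /= big_split /= sum_ltn.
Qed.

(** In [cbound], row 0 is bounded by r and every other row by its full length. The total length of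
    the other rows is the sum of the d - 1. *)
Lemma cbound_simple n ds : all (geq n) ds ->
  dbound (zvec ds) (fun r => (r + \sum_(d <- ds) d.-1)%N).
Proof.
move=> dsn r s rs; apply: (zmod_dbound dsn); apply: leq_ltn_trans rs.
rewrite /cbound; elim: n ds dsn => [|n _] ds dsn; first by rewrite big_ord0.
rewrite big_ord_recl leq_add ?geq_minl //.
elim: ds dsn => [|d ds IH] /=; first by rewrite big1 // => t _; rewrite /row /= minn0.
move=> /andP [dn dsn]; rewrite big_cons; apply: leq_trans (leq_add (leqnn d.-1) (IH dsn)).
have -> : (d.-1 = \sum_(t < n) (t.+1 < d))%N.
  rewrite (eq_bigr (fun t : 'I_n => ((t < d.-1)%N : nat))); last by move=> t _; case: (d).
  by rewrite sum_ltn //; case: (d) dn.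
rewrite -big_split /=; apply: leq_sum => t _; rewrite /row /= /bump /=.
by lia.
Qed.

Lemma pmap_zcat ds ds' :
  pmap (zvec (ds ++ ds')) (tens (zvec ds) (zvec ds') : tens_module (zmod ds) (zmod ds')).
Proof.
elim: ds => [|d ds IH] /=.
  pose b (w : zmod ds') : tens_module (triv_module K) (zmod ds') := tens (1 : K^o) w.
  have bl : linear b by move=> c u w; rewrite /b tensPr.
  pose bL := GRing.isLinear.Build K _ _ _ b bl.
  pose bf : {linear _ -> _} := HB.pack b bL.
  have h j x u : (linfun bf) (act (zmod ds') j x u) = act (tens_module (triv_module K) (zmod ds')) j x (linfun bf u).
    rewrite (lfunE bf) (lfunE bf u); rewrite -[RHS]/(act (tens_module (triv_module K) (zmod ds')) j x (tens (1 : K^o) u)).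
    by rewrite tens_actT /= lfunE tens0l add0r.
  by exists (@CurrentHom _ (zmod ds') (tens_module (triv_module K) (zmod ds')) _ h); rewrite lfunE.
apply: pmap_trans (pmap_tens (pmap_refl _) IH) _.
exact: pmap_assocV.
Qed.

Lemma pmap_zcatV ds ds' :
  pmap (tens (zvec ds) (zvec ds') : tens_module (zmod ds) (zmod ds')) (zvec (ds ++ ds')).
Proof.
elim: ds => [|d ds IH] /=.
  have [id_ idE] := hom_id (triv_module K).
  have [th thE] := hom_unit (zmod ds') id_.
  by exists th; rewrite thE idE scale1r.
apply: pmap_trans (pmap_assoc _ _ _) _.
exact: pmap_tens (pmap_refl _) IH.
Qed.

Lemma pmap_zcons0 ds : pmap (zvec (0%N :: ds)) (zvec ds).
Proof.
have [th thE] : pmap (cvec 0) (1 : triv_module K).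
  have lw := zmod_lowest [::]; have bw := @zmod_dbound 0 [::] isT.
  apply: (cmod_pmap (n := 0) _ lw); first by move=> j x _; apply/lfunP => u; rewrite !lfunE.
  by move=> r s rs; apply: bw; rewrite /cbound big_ord0; move: rs; rewrite muln0.
have [th' h] := hom_unit (zmod ds) th.
by exists th'; rewrite h thE scale1r.
Qed.

Lemma pmap_zperm ds ds' : perm_eq ds ds' -> pmap (zvec ds) (zvec ds').
Proof.
have ins x l1 l2 : pmap (zvec (x :: l1 ++ l2)) (zvec (l1 ++ x :: l2)).
  elim: l1 => [|y l1 IH] /=; first exact: pmap_refl.
  apply: pmap_trans (pmap_CA _ _ _) _.
  exact: pmap_tens (pmap_refl _) IH.
elim: ds ds' => [|d ds IH] ds' p.
  by have := perm_size p; case: ds' {p} => // _; apply: pmap_refl.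
have dds' : d \in ds' by rewrite -(perm_mem p) mem_head.
case/splitPr: dds' p => l1 l2 p; apply: pmap_trans (ins d l1 l2).
apply: pmap_tens (pmap_refl _) (IH _ _).
by move: p; rewrite -[d :: l2]cat1s perm_sym perm_catCA /= perm_cons perm_sym.
Qed.

Lemma cvec_neq0 d : cvec d != 0.
Proof.
apply/eqP => v0; have := cmod_dim d; rewrite -cmod_cyclic.
have -> : espan (cvec d) = 0%VS.
  apply/eqP; rewrite -subv0; apply: generated_sub; first by rewrite v0 mem0v.
  by move=> f _; rewrite limg0.
by rewrite dimv0 => /esym/eqP; rewrite expn_eq0.
Qed.

Lemma zvec_neq0 ds : zvec ds != 0.
Proof.
elim: ds => [|d ds IH] /=; first exact: oner_neq0.
exact: tens_neq0 (cvec_neq0 d) IH.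
Qed.

Lemma lowest_fe M m (u : M) j : lowest (wt m) u ->
  act M 0 (sl2_f K) (iter j.+1 (opE M 0) u) = (j.+1%:R * (m%:R - j%:R)) *: iter j (opE M 0) u.
Proof.
move=> lu; have hE i : act M 0 (sl2_h K) (iter i (opE M 0) u) =
    (i.*2%:R - m%:R) *: iter i (opE M 0) u.
  elim: i => [|i IH] /=; first by have [_ ->] := lu 0%N; rewrite sub0r.
  rewrite act_he IH linearZ /= -scalerDl; congr (_ *: _).
  by rewrite doubleS -[(i.*2).+2]addn2 (natrD K i.*2 2) addrAC.
elim: j => [|j IH]; rewrite [iter _.+1 _ _]iterS act_fe hE.
  by have [-> _] := lu 0%N; rewrite linear0 /= mul1r !sub0r !subr0 scaleNr opprK.
rewrite IH linearZ /= -scalerBl; congr (_ *: _).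
by rewrite -addnn natrD -!natr1; ring.
Qed.

Lemma iter_espan M m j (u : M) : iter j (opE M m) u \in espan u.
Proof. by elim: j => [|j IH] /=; [apply: generated_self | apply: espan_opE]. Qed.

(** The operator f_0 maps the span of u, ..., e_0^{k+1} u onto a space containing the span of u,
    ..., e_0^k u, and it kills u. So each step up to k = m adds a dimension. *)
Lemma dim_espan_lowest M m (u : M) : lowest (wt m) u -> u != 0 -> (m < \dim (espan u))%N.
Proof.
move=> lu u0; pose U k := <<[seq iter j (opE M 0) u | j <- iota 0 k.+1]>>%VS.
have mU j k : (j <= k)%N -> iter j (opE M 0) u \in U k.
  by move=> jk; apply: memv_span; apply/mapP; exists j; rewrite // mem_iota.
suff H k : (k <= m)%N -> (k < \dim (U k))%N.
  apply: leq_trans (H m (leqnn m)) _; apply: dimvS; apply/span_subvP => w /mapP [j _ ->].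
  exact: iter_espan.
elim: k => [|k IH] km.
  have <- : \dim <[u]> = 1%N by rewrite dim_vline u0.
  by apply: dimvS; rewrite -memvE; apply: (mU 0%N).
rewrite -(limg_ker_dim (act M 0 (sl2_f K))) -add1n leq_add //.
  have <- : \dim <[u]> = 1%N by rewrite dim_vline u0.
  apply: dimvS; rewrite -memvE memv_cap (mU 0%N) //= memv_ker; apply/eqP.
  exact: (lu 0%N).1.
apply: leq_trans (IH (ltnW km)) _; apply: dimvS; apply/span_subvP => w /mapP [j].
rewrite mem_iota /= add0n => jk ->.
have c0 : (j.+1%:R * (m%:R - j%:R) : K) != 0.
  by rewrite mulf_neq0 ?pnatr_eq0 // subr_eq0 eqr_nat; lia.
have -> : iter j (opE M 0) u = (j.+1%:R * (m%:R - j%:R))^-1 *: act M 0 (sl2_f K) (iter j.+1 (opE M 0) u).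
  by rewrite (lowest_fe j lu) scalerA mulVf // scale1r.
by apply: memvZ; apply: memv_img; apply: mU.
Qed.

Lemma ypow_espan M r s (u : M) : ypow (opE M) r s u \in espan u.
Proof.
elim: r s => [|r IH] s; first by case: s => [|s] /=; [apply: generated_self|apply: mem0v].
by rewrite ypowS; apply: memv_suml => j _; apply: espan_opE.
Qed.

Lemma hom_ypow M N (th : current_hom M N) r s (u : M) :
  th (ypow (opE M) r s u) = ypow (opE N) r s (th u).
Proof.
elim: r s => [|r IH] s; first by case: s => [|s] //=; rewrite linear0.
by rewrite !ypowS linear_sum; apply: eq_bigr => j _; rewrite -IH; apply: hom_act.
Qed.

Lemma truncated_dbound M q (u : M) : truncated q M -> dbound u (fun r => (r * q)%N).
Proof.
move=> tM; elim=> [|r IH] s rs; first by case: s rs.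
rewrite ypowS big1 // => j _; have [jq|qj] := ltnP j q; last by rewrite (truncated_opE tM) // lfunE.
by rewrite IH ?linear0 //; move: rs; rewrite mulSn; lia.
Qed.

Lemma ypow_top M q r (u : M) : truncated q.+1 M ->
  ypow (opE M) r (r * q.+1) u = iter r (opE M q) u.
Proof.
move=> tM; elim: r => [|r IH]; first by rewrite mul0n.
have qs : (q < r.+1 * q.+1)%N by rewrite mulSn leq_addr.
rewrite ypowS (bigD1 (Ordinal qs)) //=.
have -> : (r.+1 * q.+1 - q.+1 = r * q.+1)%N by rewrite mulSn addKn.
rewrite IH big1 ?addr0 // => j; rewrite -val_eqE /= => jq.
have [qj|jq'] := ltnP q j; first by rewrite (truncated_opE tM) // lfunE.
by rewrite (truncated_dbound u tM) ?linear0 //; move: (mulSn r q.+1) jq jq'; lia.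
Qed.

Lemma cbound_leq n ds r : all (geq n) ds -> (cbound n ds r <= sumn ds)%N.
Proof. by move=> dsn; rewrite -(sum_row dsn); apply: leq_sum => t _; rewrite geq_minr. Qed.

(** If every column has at least q boxes, the first q rows have length [size ds]; each unit by which
    r falls short of [size ds] costs one in each of these rows. *)
Lemma cbound_drop n ds q r : all (geq n) ds -> all (leq q) ds -> (r <= size ds)%N ->
  (cbound n ds r + q * (size ds - r) <= sumn ds)%N.
Proof.
move=> dsn qds rs; case: (posnP (size ds)) => [s0|s0].
  by rewrite s0 sub0n muln0 addn0 cbound_leq.
have qn : (q <= n)%N.
  case: ds dsn qds s0 {rs} => //= d ds /andP [dn _] /andP [qd _] _; exact: leq_trans qd dn.
rewrite -(sum_row dsn) -{1}(sum_ltn qn) big_distrl -big_split /=; apply: leq_sum => t _.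
case: ltnP => tq; last by rewrite mul0n addn0 geq_minr.
have -> : row ds t = size ds.
  apply/eqP; rewrite -all_count; apply/allP => d /(allP qds); exact: leq_trans.
by rewrite mul1n (minn_idPl rs) subnKC.
Qed.

Lemma cbound_size n ds r : all (geq n) ds -> (size ds <= r)%N -> cbound n ds r = sumn ds.
Proof.
move=> dsn sr; rewrite -(sum_row dsn); apply: eq_bigr => t _; apply/minn_idPr.
exact: leq_trans (count_size _ _) sr.
Qed.

(** To reach degree [sumn ds] with as many factors e(z) as columns, each column must receive exactly
    one; the factorial counts the assignments. *)
Lemma ypow_ztop ds : all (leq 1) ds ->
  ypow (opE (zmod ds)) (size ds) (sumn ds) (zvec ds) = (size ds)`!%:R *: ztop ds.
Proof.
elim: ds => [|d ds IH]; first by rewrite scale1r.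
move=> /andP [d1 ds1]; rewrite -[size _]/(size ds).+1 -[sumn _]/(d + sumn ds)%N.
rewrite -[zmod _]/(tens_module (cmod d) (zmod ds)) -[zvec _]/(tens (cvec d) (zvec ds)).
rewrite -[ztop _]/(tens (ctop d) (ztop ds)); set n := sumn ds.
have dsn : all (geq n) ds.
  rewrite /n; elim: (ds) => //= x l IHl; rewrite leq_addr /=.
  by apply: sub_all IHl => y /= yl; apply: leq_trans yl (leq_addl _ _).
have one : ypow (opE (cmod d)) 1 d (cvec d) = ctop d.
  rewrite ypowS; case: (d) d1 => // d' _.
  rewrite big_ord_recr /= subnn /= big1 ?add0r // => j _.
  by case E: (d'.+1 - j.+1)%N => [|k] /=; rewrite ?linear0 //; have := ltn_ord j; lia.
have sz1 : ((size ds).+1 - 1 = size ds)%N by rewrite subn1.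
rewrite (ypow_tens_lead (p := 1) (@cmod_dbound d) (zmod_dbound dsn)) //; first last.
- case=> [|[|i]] // is_ _.
    by rewrite min0n mul0n add0n subn0 cbound_size //; lia.
  rewrite (minn_idPr _) // mul1n ltn_add2l.
  have := @cbound_drop n ds 1 ((size ds).+1 - i.+2)%N dsn ds1; rewrite -/n.
  by move=> /(_ ltac:(lia)); lia.
- by rewrite minnn mul1n sz1 cbound_size.
rewrite minnn mul1n sz1 bin1 one cbound_size // IH // tensZr scalerA factS natrM.
by congr (_ *: tens _ _).
Qed.

(** A factor e(z) taken from the columns loses at least q+2 in degree and gains at most q+1 on N. A
    surplus factor on the columns gains nothing there and loses q+1 on N. So the split with
    [size ds] factors on the columns is the unique leading one. *)
Lemma ypow_lead N q ds j (u : N) : all (leq q.+2) ds -> truncated q.+1 N ->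
  ypow (opE (tens_module (zmod ds) N)) (size ds + j) (sumn ds + j * q.+1) (tens (zvec ds) u) =
    ('C(size ds + j, size ds) * (size ds)`!)%:R *: tens (ztop ds) (iter j (opE N q) u).
Proof.
move=> qds tN; set n := sumn ds.
have dsn : all (geq n) ds.
  rewrite /n; elim: (ds) => //= x l IHl; rewrite leq_addr /=.
  by apply: sub_all IHl => y /= yl; apply: leq_trans yl (leq_addl _ _).
rewrite (ypow_tens_lead (p := size ds) (zmod_dbound dsn) (truncated_dbound u tN)).
- rewrite addKn cbound_size // ypow_top // ypow_ztop ?tensZl ?scalerA ?natrM //.
  by apply: sub_all qds => d; apply: leq_trans.
- exact: leq_addr.
- by rewrite addKn cbound_size.
move=> i is_ ip; have [ilt|igt] : (i < size ds)%N \/ (size ds < i)%N by lia.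
  have := cbound_drop dsn qds (ltnW ilt); rewrite -/n.
  have -> : (size ds + j - i = (size ds - i) + j)%N by lia.
  move: (cbound _ _ _) => c; rewrite mulnDl mulSn.
  by rewrite [((size ds - i) * _)%N]mulnC; move: (q.+1 * _)%N (j * _)%N => x y; lia.
have := cbound_leq i dsn; rewrite -/n => h.
apply: leq_ltn_trans (leq_add h (leqnn _)) _; rewrite ltn_add2l ltn_pmul2r //; lia.
Qed.

Lemma ctop_hom2 d : (2 <= d)%N -> exists th : current_hom (cmod (d - 2)) (cmod d),
  th (cvec (d - 2)) = ctop d /\ lker th == 0%VS.
Proof.
case: d => [|[|d]] // _; move E: (d.+2 - 2)%N => d'.
have -> : d' = d by lia.
exact: ctop_hom.
Qed.

Lemma ztop_hom ds : all (leq 2) ds -> exists th : current_hom (zmod [seq (d - 2)%N | d <- ds]) (zmod ds),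
  th (zvec [seq (d - 2)%N | d <- ds]) = ztop ds /\ lker th == 0%VS.
Proof.
elim: ds => [|d ds IH].
  move=> _; have [th h] := hom_id (triv_module K); exists th; rewrite h; split=> //.
  by apply/lker0P => x y; rewrite !h.
case/andP=> /ctop_hom2 [f [fE f0]] /IH [g [gE g0]].
have [th [h1 h2]] := hom_tens f g; exists th; split; last exact: h2.
by apply: (etrans (h1 _ _)); rewrite fE gE.
Qed.

Lemma hom_inj_espan M N (th : current_hom M N) (u : M) : lker th == 0%VS ->
  \dim (espan (th u)) = \dim (espan u).
Proof. by move=> /eqP th0; rewrite -hom_espan limg_dim_eq // th0 capv0. Qed.

(** The vector w_{d+1} (x) w_1 has the weight of w_{d+2} and, for r >= 1, the same bound (d+1) + 1,
    so it satisfies the relations of W(d+2). *)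
Lemma cvec_split d : pmap (cvec d.+2) (tens (cvec d.+1) (cvec 1) : tens_module (cmod d.+1) (cmod 1)).
Proof.
apply: (cmod_pmap (n := d.+1)).
- apply: truncated_tens; first exact: cmod_truncated.
  exact: truncated_leq (@cmod_truncated 1).
- apply: lowest_eq (lowest_tens (cmod_lowest d.+1) (cmod_lowest 1)) => j; rewrite /wt.
  by case: eqP => _; rewrite ?addr0 // -opprD -natrD addn1.
have m1 x : minn x 1 = (0 < x)%N by case: x.
apply: dbound_tens (@cmod_dbound _) (@cmod_dbound _) _ => i j; rewrite !m1 addn_gt0.
by case: (0 < i)%N; case: (0 < j)%N; rewrite ?mul1n ?mul0n ?addn1 ?addn0.
Qed.

(* [cmod d] is M^(2,...,2); for [ds] conjugate to A it is [zmod ds] that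
   contains a copy of M^A, and [colprod n ds] is then the product of the a_i. *)
Definition colprod n ds := (\prod_(t < n) (row ds t).+1)%N.

Lemma row_cat ds ds' t : row (ds ++ ds') t = (row ds t + row ds' t)%N.
Proof. exact: count_cat. Qed.
Lemma row_nseq m d t : row (nseq m d) t = ((t < d) * m)%N.
Proof. exact: count_nseq. Qed.

Lemma colprod_perm n ds ds' : perm_eq ds ds' -> colprod n ds = colprod n ds'.
Proof. by move=> /permP p; apply: eq_bigr => t _; rewrite /row p. Qed.

Lemma prod_shift2 n (F H : nat -> nat) : (1 < n)%N -> (forall t, H t = F t.+2) ->
  (forall t, (n <= t)%N -> F t = 0%N) ->
  (\prod_(t < n) (F t).+1 = (F 0%N).+1 * ((F 1%N).+1 * \prod_(t < n) (H t).+1))%N.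
Proof.
case: n => [|[|n]] // _ HF Fn; rewrite [in LHS]big_ord_recl [in LHS]big_ord_recl.
rewrite [in RHS]big_ord_recr [in RHS]big_ord_recr /= !HF (Fn n.+2) ?(Fn n.+3) // !muln1.
by congr (_ * (_ * _))%N; apply: eq_bigr => t _; rewrite HF.
Qed.

(** Splitting d+2 into d+1 and 1 moves one box from row d+1 to row 0. With s = [size bs] the factors
    of these rows satisfy (s+m+2)(s+2) = (s+m+3)(s+1) + (m+1). Taking two boxes off each column
    deletes rows 0 and 1, and rows 1 and d+1 are equally long, so the common cofactor is the product
    for the shortened columns. *)
Lemma colprod_rec n d bs m : all (geq n) (d.+2 :: bs) -> all (leq d.+2) bs ->
  colprod n (d.+2 :: bs ++ nseq m 1) =
    (colprod n [:: d.+1, 1%N & bs ++ nseq m 1] +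
     m.+1 * colprod n [seq (x - 2)%N | x <- d.+2 :: bs])%N.
Proof.
move=> /= /andP [dn bsn] dbs; rewrite /colprod.
have n2 : (1 < n)%N by apply: leq_trans dn.
have n0 : (0 < n)%N by apply: ltnW.
have rb t : (t <= d.+1)%N -> row bs t = size bs.
  move=> td; apply/eqP; rewrite -all_count; apply/allP => x /(allP dbs); exact: leq_trans.
pose F t := row (d.+2 :: bs ++ nseq m 1) t.
have F0 : F 0%N = (size bs + m).+1 by rewrite /F /row /= -/(row _ _) row_cat row_nseq rb ?mul1n.
have F1 t : (0 < t <= d.+1)%N -> F t = (size bs).+1.
  case/andP=> t0 td; rewrite /F /row /= -/(row _ _) row_cat row_nseq rb // ltnS td.
  by case: t t0 {td} => // t _; rewrite addn0.
have dn' : (d.+1 < n)%N by [].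
pose i0 : 'I_n := Ordinal n0; pose i1 : 'I_n := Ordinal n2; pose id : 'I_n := Ordinal dn'.
pose G t := row [:: d.+1, 1%N & bs ++ nseq m 1] t.
set P := (\prod_(t < n | (t != i0) && (t != id)) (F t).+1)%N.
have EF : (\prod_(t < n) (F t).+1 = (F 0%N).+1 * ((F d.+1).+1 * P))%N.
  by rewrite (bigD1 i0) //= (bigD1 id).
have EG : (\prod_(t < n) (G t).+1 = (G 0%N).+1 * ((G d.+1).+1 * P))%N.
  rewrite (bigD1 i0) //= (bigD1 id) //=; congr (_ * (_ * _))%N.
  apply: eq_bigr => t /andP []; rewrite -!val_eqE /= => ti0 tid; rewrite /F /G /row /=; lia.
rewrite -/(colprod n _) [LHS]EF [X in (X + _)%N]EG F0 F1 ?leqnn //.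
have -> : G 0%N = (size bs + m).+2 by rewrite /G /row /= -/(row _ _) row_cat row_nseq rb ?mul1n.
have -> : G d.+1 = size bs by rewrite /G /row /= -/(row _ _) row_cat row_nseq rb ?ltnn /= ?mul0n ?addn0.
pose H t := row [seq (x - 2)%N | x <- d.+2 :: bs] t.
have HF t : H t = F t.+2.
  rewrite /H /F /row /= count_cat count_map count_nseq /= mul0n addn0; congr addn; first by lia.
  by apply: eq_count => x /=; lia.
have Fn t : (n <= t)%N -> F t = 0%N.
  move=> nt; apply/eqP; rewrite -leqn0 leqNgt -has_count; apply/hasPn => x.
  rewrite inE mem_cat => xB; rewrite -leqNgt; apply: leq_trans nt.
  case/or3P: xB => [/eqP -> //|/(allP bsn) //|/nseqP [-> _]]; exact: n0.
have EH := prod_shift2 n2 HF Fn.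
have EP : colprod n [seq (x - 2)%N | x <- d.+2 :: bs] = P.
  apply/eqP; rewrite -(eqn_pmul2l (ltn0Sn (F 1%N))) -(eqn_pmul2l (ltn0Sn (F 0%N))).
  by rewrite -EH EF (F1 1%N) ?(F1 d.+1) ?leqnn.
move: EP; rewrite /colprod /= => ->; ring.
Qed.

Lemma colprod_ones n m : (colprod n (nseq m 1) <= m.+1)%N.
Proof.
case: n => [|n]; first by rewrite /colprod big_ord0.
rewrite /colprod big_ord_recl row_nseq mul1n big1 ?muln1 // => t _.
by rewrite row_nseq.
Qed.

Lemma pmap_zcons0s k ds : pmap (zvec (nseq k 0%N ++ ds)) (zvec ds).
Proof.
elim: k => [|k IH]; first exact: pmap_refl.
exact: pmap_trans (pmap_zcons0 _) IH.
Qed.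

Lemma cols_perm ds : exists bs m k, perm_eq ds (nseq k 0%N ++ bs ++ nseq m 1%N) /\
  (sorted leq bs /\ all (leq 2) bs).
Proof.
exists (sort leq [seq d <- ds | (1 < d)%N]), (count (pred1 1%N) ds), (count (pred1 0%N) ds).
split; last first.
  split; first by apply: sort_sorted; apply: leq_total.
  by rewrite all_sort filter_all.
apply/permP => a; rewrite !count_cat !count_nseq.
rewrite (permP (permEl (perm_sort leq _))) count_filter.
elim: ds => [|d ds IH] /=; first by rewrite !muln0.
rewrite IH; case: d => [|[|d]] /=; rewrite ?eqxx /= ?andbF ?andbT; case: (a _); rewrite ?mul1n ?mul0n; lia.
Qed.

(** Only e_0 acts on M2. In e_i (w (x) e_0^j v2) the part on M2 is therefore zero or of the same
    kind with j+1. As all j are assumed, subtracting it puts [espan w1] (x) e_0^j v2 into the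
    kernel, and a second such argument lets the e_i act on the second factor. *)
Lemma dim_tens_kernel M1 M2 N (X : tens_module M1 M2) (th : current_hom (tens_module M1 M2) N)
    (w1 : M1) (v2 : M2) : truncated 1 M2 ->
  (forall j, (tens w1 (iter j (opE M2 0) v2) : tens_module M1 M2) \in (espan X :&: lker th)%VS) ->
  (\dim (espan w1) * \dim (espan v2) <= \dim (espan X :&: lker th))%N.
Proof.
move=> tr1; set R := (espan X :&: lker th)%VS => w1R.
have eR j T : T \in R -> opE (tens_module M1 M2) j T \in R.
  rewrite /R !memv_cap !memv_ker => /andP [TX /eqP T0].
  by rewrite (espan_opE j TX) (hom_act th) T0 linear0 eqxx.
have sub u w a b : tens a b + tens u w \in R -> tens u w \in R -> tens a b \in R.
  by move=> h1 h2; rewrite -(addrK (tens u w) (tens a b)) memvB.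
have iR j u : u \in espan w1 -> tens u (iter j (opE M2 0) v2) \in R.
  move=> uw; move: u uw j; apply: generated_ind => //.
  - by move=> j; rewrite tens0l mem0v.
  - by move=> c u w hu hw j; rewrite tensPl memvD ?memvZ.
  move=> _ u [i ->] hu j; have := eR i _ (hu j); rewrite {1}/opE tens_actT => h.
  apply: sub h _; case: i => [|i]; first exact: (hu j.+1).
  by rewrite tr1 // lfunE /= tens0r mem0v.
apply: dim_tens_sub => u w uw wv; move: w wv u uw; apply: generated_ind.
- by move=> u _; rewrite tens0r mem0v.
- by move=> c w w' hw hw' u uw; rewrite tensPr memvD ?memvZ ?hw ?hw'.
- exact: (iR 0%N).
move=> _ w [i ->] hw u uw; have := eR i _ (hw u uw); rewrite {1}/opE tens_actT addrC => h.
by apply: sub h _; apply: hw; apply: (espan_opE i uw).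
Qed.

(* Splitting the least column d >= 2 into d-1 and 1 gives a quotient of the
   module generated by [zvec ds]; the kernel contains the leading coefficients
   computed in [ypow_lead], which generate the tensor product of a copy of the
   module for the columns d-2 with a module of dimension m+1, where m is the
   number of columns equal to 1. *)
Lemma espan_zvec_dim n ds : all (geq n) ds -> (colprod n ds <= \dim (espan (zvec ds)))%N.
Proof.
(* The sum of squares decreases both when a column d >= 2 is split into d-1 and 1 and when columns
   are shortened by two. *)
have [N] := ubnP (\sum_(d <- ds) d ^ 2)%N; elim: N n ds => // N IH n ds; rewrite ltnS => dN dsn.
have [bs [m [k [p [bs_sort bs2]]]]] := cols_perm ds.
rewrite (colprod_perm n p).
have zr t : row (nseq k 0%N ++ bs ++ nseq m 1%N) t = row (bs ++ nseq m 1%N) t.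
  by rewrite row_cat row_nseq mul0n.
have -> : colprod n (nseq k 0%N ++ bs ++ nseq m 1%N) = colprod n (bs ++ nseq m 1%N).
  by apply: eq_bigr => t _; rewrite zr.
apply: leq_trans (pmap_dim (pmap_trans (pmap_zperm p) (pmap_zcons0s _ _))).
have sE : (\sum_(d <- ds) d ^ 2 = \sum_(d <- bs ++ nseq m 1%N) d ^ 2)%N.
  by rewrite (perm_big _ p) /= big_cat big_nseq /= iter_addn_0 add0n.
have {zr} dsn' : all (geq n) (bs ++ nseq m 1%N).
  by move: dsn; rewrite (perm_all _ p) (all_cat _ (nseq k _)) => /andP [_ ->].
case: bs bs_sort bs2 p sE dsn' => [|d bs] bs_sort bs2 p sE dsn'.
  apply: leq_trans (colprod_ones n m) _; apply: dim_espan_lowest; last exact: zvec_neq0.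
  by have := zmod_lowest (nseq m 1); rewrite sumn_nseq mul1n.
case: d bs_sort bs2 p sE dsn' => [|[|d]] // bs_sort bs2 p sE dsn'.
have dbs : all (leq d.+2) bs := order_path_min leq_trans bs_sort.
have bsn : all (geq n) (d.+2 :: bs) by move: dsn'; rewrite (all_cat _ (d.+2 :: bs)) => /andP [-> _].
rewrite (colprod_rec m bsn dbs).
pose X : tens_module (zmod (d.+2 :: bs)) (zmod (nseq m 1%N)) := tens (zvec (d.+2 :: bs)) (zvec (nseq m 1%N)).
apply: leq_trans (pmap_dim (pmap_zcat (d.+2 :: bs) (nseq m 1%N))); rewrite -/X.
have [th thE] : pmap X (zvec [:: d.+1, 1%N & bs ++ nseq m 1%N]).
  apply: pmap_trans (pmap_zcatV _ _) _.
  apply: pmap_trans (pmap_tens (cvec_split d) (pmap_refl _)) _.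
  exact: pmap_assoc.
have B1 : (colprod n [:: d.+1, 1%N & bs ++ nseq m 1%N] <= \dim (th @: espan X))%N.
  rewrite hom_espan thE; apply: IH.
    apply: leq_trans dN; rewrite sE /= !big_cons; lia.
  move: dsn' => /= /andP [dn ->]; rewrite andbT; apply/andP; split; first exact: ltnW.
  by apply: leq_trans dn.
have [I [IE I0]] := ztop_hom bs2.
pose w1 := ztop (d.+2 :: bs); pose v2 := zvec (nseq m 1%N).
have tr1 : truncated 1 (zmod (nseq m 1%N)) by apply: zmod_truncated; rewrite all_nseq orbT.
have w1R j : (tens w1 (iter j (opE (zmod (nseq m 1%N)) 0) v2) :
    tens_module (zmod (d.+2 :: bs)) (zmod (nseq m 1%N))) \in (espan X :&: lker th)%VS.
  have E := ypow_lead j v2 bs2 tr1; set p' := size (d.+2 :: bs) in E.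
  have c0 : (('C(p' + j, p') * p'`!)%:R : K) != 0.
    by rewrite pnatr_eq0 -lt0n muln_gt0 bin_gt0 leq_addr fact_gt0.
  rewrite -[tens w1 _](scalerK c0) -E; apply: memvZ.
  rewrite memv_cap ypow_espan memv_ker (hom_ypow th) -/X thE.
  (* Splitting keeps the number of boxes and adds a column, so the bound of [cbound_simple] falls
     one short of the degree of this coefficient, which therefore vanishes in the quotient. *)
  rewrite (cbound_simple (n := maxn n 1)) ?eqxx //.
    apply/allP => x; rewrite !inE mem_cat => xB; rewrite leq_max.
    case/or4P: xB => [/eqP ->|/eqP -> //|xb|/nseqP [-> _] //]; rewrite ?orbT //.
      by have /andP [/= dn _] := bsn; rewrite ltnW.
    by have /andP [_ /allP /(_ x xb) /= ->] := bsn.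
  rewrite !big_cons big_cat big_nseq iter_addn_0 /p' /= mul0n addn0 muln1.
  have : (\sum_(x <- bs) x.-1 + size bs <= sumn bs)%N.
    elim: (bs) dbs => [|x l IHl] /=; first by rewrite big_nil.
    by move=> /andP [dx /IHl]; rewrite big_cons; lia.
  by lia.
have D1 : (colprod n [seq (x - 2)%N | x <- d.+2 :: bs] <= \dim (espan w1))%N.
  rewrite /w1 -IE (hom_inj_espan _ I0); apply: IH.
    apply: leq_trans dN; rewrite sE big_cat big_map !big_cons -addSn.
    apply: leq_trans (leq_addr _ _); apply: leq_add; first by rewrite subn2 /= ltn_sqr; lia.
    by apply: leq_sum => x _; rewrite leq_sqr leq_subr.
  by rewrite all_map; apply: sub_all bsn => x /= xn; apply: leq_trans (leq_subr _ _) xn.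
have D2 : (m < \dim (espan v2))%N.
  apply: dim_espan_lowest; last exact: zvec_neq0.
  by have := zmod_lowest (nseq m 1); rewrite sumn_nseq mul1n.
have D := dim_tens_kernel tr1 w1R.
rewrite -(limg_ker_dim th (espan X)) addnC leq_add //.
by apply: leq_trans D; rewrite mulnC leq_mul.
Qed.

End Columns.

(** * The embedding *)

Section Conjugate.
Implicit Types A : seq nat.

Definition cols A l0 m : seq nat := [seq count (ltn l) A | l <- iota l0 m].

Lemma count_iota_lt y l0 m : count (gtn y) (iota l0 m) = minn m (y - l0).
Proof.
elim: m l0 => [|m IH] l0 /=; first by rewrite min0n.
by rewrite IH /=; case: (ltnP l0 y) => h; lia.
Qed.

(** For increasing A the entries exceeding l come last, so entry x is row [size A - x - 1] of the
    diagram whose columns count them; both sides say that the box in this row and column l is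
    present. *)
Lemma col_nth A l x : sorted leq A -> (x < size A)%N ->
  (size A - x.+1 < count (ltn l) A)%N = (l < nth 0%N A x)%N.
Proof.
move=> sA xA; have nthS := sorted_leq_nth leq_trans leqnn 0%N sA.
case: (ltnP l (nth 0%N A x)) => lx.
  apply: leq_trans (_ : count (ltn l) (drop x A) <= _)%N; last first.
    by rewrite -{2}(cat_take_drop x A) count_cat leq_addl.
  suff -> : count (ltn l) (drop x A) = size (drop x A) by rewrite size_drop; lia.
  apply/eqP; rewrite -all_count; apply/(all_nthP 0%N) => y; rewrite size_drop => yA.
  rewrite nth_drop; apply: leq_trans lx _; apply: nthS; rewrite ?inE //; lia.
apply/negbTE; rewrite -leqNgt -{1}(cat_take_drop x.+1 A) count_cat.
have -> : count (ltn l) (take x.+1 A) = 0%N.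
  apply/eqP; rewrite -leqn0 leqNgt -has_count; apply/(has_nthP 0%N) => -[y].
  rewrite size_takel // => yx; rewrite nth_take //=; apply/negP; rewrite -leqNgt.
  apply: leq_trans lx; apply: nthS; rewrite ?inE //; lia.
by rewrite add0n -(size_drop x.+1 A) count_size.
Qed.

Lemma row_cols A l0 m x : sorted leq A -> (x < size A)%N ->
  row (cols A l0 m) (size A - x.+1) = minn m (nth 0%N A x - l0).
Proof.
move=> sA xA; rewrite /row /cols count_map -count_iota_lt; apply: eq_count => l /=.
exact: col_nth.
Qed.

Lemma sum_rev_nth (A : seq nat) (F : nat -> nat) :
  (\sum_(a <- A) F a = \sum_(t < size A) F (nth 0%N A (size A - t.+1)))%N.
Proof.
by rewrite (big_nth 0%N) big_mkord (reindex_inj rev_ord_inj).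
Qed.

Lemma prod_rev_nth (A : seq nat) (F : nat -> nat) :
  (\prod_(a <- A) F a = \prod_(t < size A) F (nth 0%N A (size A - t.+1)))%N.
Proof.
by rewrite (big_nth 0%N) big_mkord (reindex_inj rev_ord_inj).
Qed.

(* [ds] is the partition conjugate to that of the a - 1 for a in A, up to order and zeros. *)
Definition conjugate A ds := all (geq (size A)) ds /\
  forall x, (x < size A)%N -> row ds (size A - x.+1) = (nth 0%N A x).-1.

Lemma conjugate_bnd A ds r : conjugate A ds -> bnd [seq a.-1 | a <- A] r = cbound (size A) ds r.
Proof.
move=> [_ h]; rewrite /bnd big_map sum_rev_nth; apply: eq_bigr => t _.
have tA := ltn_ord t; rewrite -h; last by lia.
by congr (minn r (row ds _)); lia.
Qed.

Lemma conjugate_sum A ds : conjugate A ds -> (\sum_(a <- A) a.-1 = sumn ds)%N.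
Proof.
move=> [dsn h]; rewrite -(sum_row dsn) sum_rev_nth; apply: eq_bigr => t _.
have tA := ltn_ord t; rewrite -h; last by lia.
by congr (row ds _); lia.
Qed.

Lemma conjugate_prod A ds : all (leq 1) A -> conjugate A ds ->
  (\prod_(a <- A) a = colprod (size A) ds)%N.
Proof.
move=> A1 [dsn h]; rewrite (prod_rev_nth A id); apply: eq_bigr => t _.
have tA := ltn_ord t; have -> : (t : nat) = (size A - (size A - t.+1).+1)%N by lia.
have xA : (size A - t.+1 < size A)%N by lia.
rewrite h; last by lia.
have -> : (size A - (size A - (size A - t.+1).+1).+1 = size A - t.+1)%N by lia.
by rewrite prednK //; apply: (all_nthP 0%N A1).
Qed.

End Conjugate.

Section Realization.
Variable K : numFieldType.
Implicit Types M N : current_module K.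

Lemma fusion_zmod A (z : seq K) ds : fusion_points A z -> all (leq 1) A -> conjugate A ds ->
  exists th : current_hom (fusion A z) (zmod K ds), th (fusion_vec A z) = zvec K ds /\ lker th == 0%VS.
Proof.
move=> ptz A1 cA; have [dsn _] := cA.
have [th thE] : pmap (fusion_vec A z) (zvec K ds).
  apply: (fusion_pmap ptz A1 (zmod_truncated dsn)).
    by move=> r s; rewrite (conjugate_bnd _ cA); apply: zmod_dbound.
  by rewrite (conjugate_sum cA); apply: zmod_lowest.
exists th; split=> //; apply: (hom_inj_dim (fusion_cyclic A z)); rewrite thE.
by rewrite fusion_dim // (conjugate_prod A1 cA); apply: espan_zvec_dim.
Qed.

Lemma fusion_zmod2 A (z : seq K) ds1 ds2 : fusion_points A z -> all (leq 1) A ->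
  conjugate A (ds1 ++ ds2) ->
  exists th : current_hom (fusion A z) (tens_module (zmod K ds1) (zmod K ds2)),
    th (fusion_vec A z) = tens (zvec K ds1) (zvec K ds2) /\ lker th == 0%VS.
Proof.
move=> ptz A1 cA; have [f [fE f0]] := fusion_zmod ptz A1 cA.
have [g gE] := pmap_zcat K ds1 ds2; have [th h] := hom_comp g f.
exists th; split; first by rewrite h fE gE.
apply: (hom_inj_dim (fusion_cyclic A z)); rewrite h fE gE.
apply: leq_trans (pmap_dim (pmap_zcatV K ds1 ds2)).
by rewrite -fE (hom_inj_espan _ f0) fusion_cyclic.
Qed.

Lemma espanZ M c (u : M) : c != 0 -> espan (c *: u) = espan u.
Proof.
have sub (d : K) (w : M) : (espan (d *: w) <= espan w)%VS.
  apply: generated_sub; first by apply: memvZ; apply: generated_self.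
  by move=> _ [j ->]; apply: espan_stable.
move=> c0; apply/eqP; rewrite eqEsubv sub /=.
by have := sub c^-1 (c *: u); rewrite scalerK.
Qed.

End Realization.

Section Main.
Variables (K : numFieldType) (n : nat) (A : seq nat) (i : nat) (zA zB z1 z2 : seq K).
Hypotheses (sA : size A = n) (soA : sorted leq A) (A2 : (2 <= entry A 1)%N)
  (i_n : (1 <= i <= n - 1)%N) (ptA : fusion_points A zA) (ptB : fusion_points (seq_step A i) zB)
  (pt1 : fusion_points (seq_left A i) z1) (pt2 : fusion_points (seq_right A i) z2).
Variable phi : current_hom (fusion A zA) (fusion (seq_step A i) zB).
Hypotheses (phi_surj : limg phi = fullv)
  (phi_vec : phi (fusion_vec A zA) = fusion_vec (seq_step A i) zB).

Local Notation a := (entry A i).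
Local Notation b := (entry A i.+1).
Local Notation p := a.-1.
Local Notation q := (n - i)%N.
Let ds1 := cols A 1 p.
(** The number [sumn A] of columns is a convenient excess: columns beyond the largest entry are
    empty. *)
Let ds2 := cols A a (sumn A).

Let i0 : (0 < i)%N. Proof. by case/andP: i_n. Qed.
Let iN : (i < n)%N. Proof. by case/andP: i_n => _; lia. Qed.
Let nthA x y : (x <= y < n)%N -> (nth 0%N A x <= nth 0%N A y)%N.
Proof.
move=> /andP [xy yn]; apply: (sorted_leq_nth leq_trans leqnn 0%N soA); rewrite ?inE ?sA //.
exact: leq_ltn_trans yn.
Qed.
Let A_ge2 x : (x < n)%N -> (2 <= nth 0%N A x)%N.
Proof. by move=> xn; apply: leq_trans A2 _; apply: nthA. Qed.
Let a2 : (2 <= a)%N. Proof. by apply: A_ge2; lia. Qed.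
Let ab : (a <= b)%N. Proof. by apply: nthA; lia. Qed.
Let A1 : all (leq 1) A.
Proof. by apply/(all_nthP 0%N) => x; rewrite sA => /A_ge2; apply: leq_trans. Qed.
Let A_sum x : (nth 0%N A x <= sumn A)%N.
Proof.
elim: (A) x => [|y l IH] [|x] //=; first exact: leq_addr.
exact: leq_trans (IH x) (leq_addl _ _).
Qed.

Let count_n l : (count (ltn l) A <= n)%N. Proof. by rewrite -sA count_size. Qed.

(** For l < a_i the n-i+1 entries a_i, ..., a_n all exceed l, whereas for l >= a_i at most n-i
    entries do ([ds2_le]). This gap between the two groups of columns is what [ypow_lead] needs. *)
Lemma ds1_ge : all (leq q.+1) ds1.
Proof.
apply/allP => d /mapP [l]; rewrite mem_iota => /andP [l0 lp] ->.
have iA : (i.-1 < size A)%N by rewrite sA; lia.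
have := col_nth l soA iA; rewrite sA => h.
have lt : (n - i.-1.+1 < count (ltn l) A)%N by rewrite h -/(entry A i); lia.
by move: lt; rewrite prednK.
Qed.

Let qS : q = q.-1.+1. Proof. by lia. Qed.

Lemma ds1_ge2 : all (leq 2) ds1.
Proof. by apply: sub_all ds1_ge => d; rewrite qS; apply: leq_trans. Qed.

Lemma ds1_le : all (geq n) ds1.
Proof. by apply/allP => d /mapP [l _ ->]; apply: count_n. Qed.

Lemma ds2_le : all (geq q) ds2.
Proof.
apply/allP => d /mapP [l]; rewrite mem_iota => /andP [al _] ->.
have iA : (i.-1 < size A)%N by rewrite sA; lia.
have := col_nth l soA iA; rewrite sA prednK // -/(entry A i) => h.
by rewrite /geq /= leqNgt h -leqNgt.
Qed.

Lemma conjA : conjugate A (ds1 ++ ds2).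
Proof.
split=> [|x xA].
  by rewrite all_cat sA ds1_le; apply: sub_all ds2_le => d /= h; apply: leq_trans h _; lia.
rewrite row_cat !row_cols //; have := A_sum x; have := A_ge2 (_ : x < n)%N.
by rewrite -{1}sA => /(_ xA); lia.
Qed.

Lemma size_left : size (seq_left A i) = (n - 2)%N.
Proof. by rewrite size_cat size_nseq size_takel sA; lia. Qed.

Lemma size_right : size (seq_right A i) = q.
Proof. by rewrite size_map size_drop sA. Qed.

Lemma nth_left x : (x < n - 2)%N -> (nth 0%N (seq_left A i) x).-1 = minn p (nth 0%N A x).-1.
Proof.
move=> xn; rewrite nth_cat size_takel sA; last by lia.
case: ltnP => xi.
  rewrite nth_take //; have : (nth 0%N A x <= a)%N by apply: nthA; lia.
  by lia.
rewrite nth_nseq ifT; last by lia.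
have : (a <= nth 0%N A x)%N by apply: nthA; lia.
by lia.
Qed.

(** Capping A at a_i leaves n-i+1 entries equal to a_i. Taking two boxes off each column removes two
    of these rows, which gives A'. *)
Lemma conj_left : conjugate (seq_left A i) [seq (d - 2)%N | d <- ds1].
Proof.
split=> [|x].
  rewrite size_left all_map; apply: sub_all ds1_le => d /= h; exact: leq_sub2r.
rewrite size_left => xn; rewrite nth_left //.
have -> : row [seq (d - 2)%N | d <- ds1] (n - 2 - x.+1) = row ds1 (size A - x.+1).
  by rewrite /row count_map; apply: eq_count => d /=; rewrite sA; lia.
by rewrite row_cols ?sA //; lia.
Qed.

Lemma conj_right : conjugate (seq_right A i) ds2.
Proof.
split=> [|x]; rewrite size_right; first exact: ds2_le.
move=> xq; rewrite (nth_map 0%N) ?size_drop ?sA // nth_drop addn1 /=.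
have -> : (q - x.+1 = size A - (i + x).+1)%N by rewrite sA; lia.
by rewrite row_cols ?sA //; have := A_sum (i + x); lia.
Qed.

Lemma left1 : all (leq 1) (seq_left A i).
Proof.
rewrite all_cat all_nseq (ltnW a2) orbT andbT; apply/allP => x /mem_take.
exact: (allP A1).
Qed.
Lemma right1 : all (leq 1) (seq_right A i).
Proof. by apply/allP => x /mapP [y _ ->]; rewrite addn1. Qed.

Lemma A_split : A = take i.-1 A ++ [:: a; b] ++ drop i.+1 A.
Proof.
rewrite -{1}(cat_take_drop i.-1 A); congr cat.
rewrite (drop_nth 0%N) ?sA; last by lia.
rewrite prednK // (drop_nth 0%N) ?sA //; lia.
Qed.

Lemma step1 : all (leq 1) (seq_step A i).
Proof.
move: A1; rewrite {1}A_split !all_cat => /and3P [-> _ ->] /=.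
by rewrite andbT; lia.
Qed.

Lemma size_step : size (seq_step A i) = n.
Proof. by rewrite -sA {2}A_split !size_cat. Qed.

(** Written additively to avoid truncated subtraction. The two bounds differ only for a_i - 1 <= r <
    a_{i+1}, where that of A_{i,i+1} is smaller by one. *)
Lemma bnd_step r : (bnd [seq x.-1 | x <- A] r + minn r a.-2 + minn r b =
   bnd [seq x.-1 | x <- seq_step A i] r + minn r p + minn r b.-1)%N.
Proof.
rewrite {1}A_split /seq_step /bnd !map_cat !big_cat /= !big_cons !big_nil; lia.
Qed.

(** In the range where the bounds differ, the columns l < a_i count in full and each of the last n-i
    entries adds r - (a_i - 1). This is the degree used in [kgen]. *)
Lemma bnd_mid r : (p <= r < b)%N -> bnd [seq x.-1 | x <- A] r = (sumn ds1 + (r - p) * q)%N.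
Proof.
move=> /andP [pr rb]; rewrite -(sum_row ds1_le) /bnd big_map (sum_rev_nth A (fun x => minn r x.-1)) sA.
have -> : ((r - p) * q = \sum_(t < n) (t < q) * (r - p))%N.
  by rewrite -big_distrl /= sum_ltn ?leq_subr // mulnC.
rewrite -big_split /=; apply: eq_bigr => t _; have tn := ltn_ord t.
have -> : row ds1 t = minn p (nth 0%N A (n - t.+1) - 1).
  have -> : (t : nat) = (size A - (n - t.+1).+1)%N by rewrite sA; lia.
  rewrite row_cols ?sA //; last by lia.
  by congr (minn _ (nth _ _ _ - 1)); lia.
case: ltnP => tq.
  have : (b <= nth 0%N A (n - t.+1))%N by apply: nthA; lia.
  by rewrite mul1n; lia.
have : (nth 0%N A (n - t.+1) <= a)%N by apply: nthA; lia.
by rewrite mul0n; lia.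
Qed.

Local Notation MA := (fusion A zA).
Local Notation vA := (fusion_vec A zA).
Local Notation M1 := (fusion (seq_left A i) z1).
Local Notation M2 := (fusion (seq_right A i) z2).
Local Notation T := (tens_module M1 M2).
Local Notation v1 := (fusion_vec (seq_left A i) z1).
Local Notation v2 := (fusion_vec (seq_right A i) z2).

Definition kgen j : MA := ypow (opE MA) (p + j) (sumn ds1 + j * q) vA.
Definition kspan : {vspace MA} := (\sum_(j < (b - a).+1) espan (kgen j))%VS.

Lemma tA : truncated n MA. Proof. by rewrite -sA; apply: fusion_truncated ptA. Qed.

Lemma sum_espan_stable (M : current_module K) m (g : nat -> M) k :
  (opE M k @: (\sum_(j < m) espan (g j)) <= \sum_(j < m) espan (g j))%VS.
Proof.
rewrite limg_sum; apply/subv_sumP => j _.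
apply: subv_trans (espan_stable k (g j)) _; exact: (sumv_sup j).
Qed.

(** Each [kgen j] is a coefficient that the relations of A_{i,i+1} kill. Conversely, modulo [kspan]
    all these relations hold for v_A, so [kspan] has codimension at most dim M^{A_{i,i+1}}, which is
    the codimension of the kernel. *)
Lemma ker_phi : lker phi = kspan.
Proof.
apply/esym/eqP; rewrite eqEdim; apply/andP; split.
  apply/subv_sumP => j _; apply: generated_sub.
    rewrite memv_ker (hom_ypow phi) phi_vec; apply/eqP; apply: (fusion_wcond ptB).
    have jb : (j < (b - a).+1)%N by [].
    have pr : (p <= p + j < b)%N by lia.
    have := bnd_step (p + j); rewrite (bnd_mid pr); have -> : (p + j - p = j)%N by lia.
    by lia.
  move=> _ [k ->]; apply/subvP => _ /memv_imgP [u uk ->].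
  by move: uk; rewrite !memv_ker (hom_act phi) => /eqP ->; rewrite linear0.
have H r s : (bnd [seq x.-1 | x <- seq_step A i] r < s)%N -> ypow (opE MA) r s vA \in kspan.
  move=> Bs; have [As|As] := ltnP (bnd [seq x.-1 | x <- A] r) s.
    by rewrite (fusion_wcond ptA As) mem0v.
  have st := bnd_step r.
  have pr : (p <= r < b)%N by lia.
  have rj : (r - p < (b - a).+1)%N by lia.
  have sk : (espan (kgen (r - p)) <= kspan)%VS by apply: (sumv_sup (Ordinal rj)).
  apply: (subvP sk); rewrite /kgen.
  have -> : r = (p + (r - p))%N by lia.
  have -> : s = (sumn ds1 + (r - p) * q)%N by rewrite -(bnd_mid pr); lia.
  by rewrite addKn; apply: generated_self.
have sB : (size (seq_step A i) <= n)%N by rewrite size_step.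
have := wcond_dim tA sB step1 (sum_espan_stable (b - a).+1 kgen) H.
rewrite fusion_cyclic sumfv -(fusion_dim ptB) -phi_surj.
have := limg_ker_dim phi fullv; rewrite capfv => <-.
by rewrite addnC leq_add2l.
Qed.

Definition xgen j : T := tens v1 (iter j (opE M2 (q - 1)) v2).
Definition Eop : 'End(T) := tens_end \1%VF (act M2 (n - i - 1) (sl2_e K)).
Definition genP (f : 'End(T)) :=
  (exists2 j : nat, (j < n - 2)%N & f = act T j (sl2_e K)) \/ f = Eop.

Lemma EopE u w : Eop (tens u w) = tens u (opE M2 (q - 1) w).
Proof. by rewrite /Eop tens_endE id_lfunE. Qed.

Lemma Eop_comm j t : Eop (opE T j t) = opE T j (Eop t).
Proof.
move: t; apply: tens_ind; first by rewrite !linear0.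
  by move=> c t t' h h'; rewrite !linearP /= h h'.
move=> u w; rewrite EopE /opE !tens_actT linearD; congr (_ + _); first exact: EopE.
by rewrite [LHS]EopE; congr tens; apply: opE_comm.
Qed.

Lemma t1 : truncated (n - 2) M1. Proof. by rewrite -size_left; apply: fusion_truncated pt1. Qed.
Lemma t2 : truncated q M2. Proof. by rewrite -size_right; apply: fusion_truncated pt2. Qed.

(** With r = a_{i+1} - a_i + 1, the first entry of A'' makes its bound smaller than r(n-i), the
    degree of the coefficient e_{n-i-1}^r. Hence only the powers with j <= a_{i+1} - a_i occur. *)
Lemma xgen_top : xgen (b - a).+1 = 0.
Proof.
have q0 := qS; rewrite /xgen subn1; have tq : truncated q.-1.+1 M2 by rewrite -q0; apply: t2.
rewrite -(ypow_top (b - a).+1 v2 tq) -q0 (fusion_wcond pt2) ?tens0r //.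
have -> : [seq x.-1 | x <- seq_right A i] = [seq (x - a)%N | x <- drop i A].
  by rewrite /seq_right -map_comp; apply: eq_map => x /=; rewrite addn1.
rewrite (drop_nth 0%N) ?sA // /bnd big_cons; set c := (b - a)%N.
have : (\sum_(x <- [seq (x - a)%N | x <- drop i.+1 A]) minn c.+1 x <= c.+1 * (q - 1))%N.
  apply: leq_trans (_ : \sum_(x <- [seq (x - a)%N | x <- drop i.+1 A]) c.+1 <= _)%N.
    by apply: leq_sum => x _; rewrite geq_minl.
  rewrite big_const_seq count_predT iter_addn_0 size_map size_drop sA leq_mul2l.
  by apply/orP; right; lia.
have -> : minn c.+1 (nth 0%N A i - a) = c by rewrite -/(entry A i.+1); lia.
have -> : (c.+1 * q = c.+1 + c.+1 * (q - 1))%N by rewrite -mulnS; congr muln; lia.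
by move: (c.+1 * (q - 1))%N (\sum_(_ <- _) _)%N => x y; lia.
Qed.

(** The prescribed operators generate the same subspace as all e_k together with [Eop]: for k >= n-2
    the factor M^{A'} is killed by e_k, so e_k acts as Id (x) e_k. This is zero unless k < n-i,
    which forces i = 1 and k = n-2 = n-i-1, so that e_k is [Eop]. As [Eop] commutes with the e_k and
    sends [xgen j] to [xgen j.+1], the generated subspace is the sum of the [espan (xgen j)]. *)
Lemma generated_xgen : generated genP (tens v1 v2) = (\sum_(j < (b - a).+1) espan (xgen j))%VS.
Proof.
have opT k : (n - 2 <= k)%N -> opE T k = 0 \/ opE T k = Eop.
  move=> nk; have z1k : act M1 k (sl2_e K) = 0 by apply: t1.
  have [kq|qk] := ltnP k q.
    right; apply/lfunP => t; move: t; apply: tens_ind; first by rewrite !linear0.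
      by move=> c t t' h h'; rewrite !linearP /= h h'.
    move=> u w; rewrite EopE {1}/opE tens_actT z1k lfunE tens0l add0r.
    by congr (tens _ (opE _ _ _)); lia.
  have z2k : act M2 k (sl2_e K) = 0 by apply: t2.
  left; apply/lfunP => t; move: t; apply: tens_ind; first by rewrite !linear0.
    by move=> c t t' h h'; rewrite !linearP /= h h'.
  by move=> u w; rewrite {1}/opE tens_actT z1k z2k !lfunE tens0l tens0r addr0.
have GE : (Eop @: generated genP (tens v1 v2) <= generated genP (tens v1 v2))%VS.
  by apply: generated_stable; right.
apply/eqP; rewrite eqEsubv; apply/andP; split.
  apply: generated_sub.
    have s0 : (espan (xgen 0) <= \sum_(j < (b - a).+1) espan (xgen j))%VS by apply: (sumv_sup ord0).
    by apply: (subvP s0); apply: generated_self.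
  move=> f [[j _ ->]|->]; first exact: sum_espan_stable.
  rewrite limg_sum; apply/subv_sumP => j _.
  apply: subv_trans (_ : espan (xgen j.+1) <= _)%VS.
    apply/subvP => _ /memv_imgP [u ux ->]; move: u ux; apply: generated_ind.
    - by rewrite linear0 mem0v.
    - by move=> c u w hu hw; rewrite linearP memvD ?memvZ.
    - rewrite /xgen EopE; exact: generated_self.
    by move=> _ u [k ->] hu; rewrite Eop_comm; apply: espan_opE.
  have [jb|jb] := ltnP j (b - a); last first.
    have -> : j.+1 = (b - a).+1 by have := ltn_ord j; lia.
    rewrite xgen_top; apply: generated_sub; first exact: mem0v.
    by move=> _ [k ->]; apply: sum_espan_stable.
  have jb' : (j.+1 < (b - a).+1)%N by [].
  exact: (sumv_sup (Ordinal jb')).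
apply/subv_sumP => j _; apply: generated_sub.
  elim: (j : nat) => [|k IH]; first exact: generated_self.
  have -> : xgen k.+1 = Eop (xgen k) by rewrite /xgen EopE.
  by apply: (subvP GE); apply: memv_img.
move=> _ [k ->]; have [kn|nk] := ltnP k (n - 2); first by apply: generated_stable; left; exists k.
case: (opT k nk) => ->; last exact: GE.
by apply/subvP => _ /memv_imgP [u _ ->]; rewrite lfunE mem0v.
Qed.

Lemma embedding : exists psi : current_hom (hom_ker phi) T,
  lker psi = 0%VS /\ limg psi = generated genP (tens v1 v2).
Proof.
have [al [alE al0]] := fusion_zmod2 ptA A1 conjA.
have [f1 [f1E f10]] := fusion_zmod pt1 left1 conj_left.
have [f2 [f2E f20]] := fusion_zmod pt2 right1 conj_right.
have [I [IE I0]] := ztop_hom K ds1_ge2.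
have [g gE] := hom_comp I f1.
have g0 : lker g == 0%VS.
  by apply/lker0P => x y; rewrite !gE => /(lker0P I0) /(lker0P f10).
have [be [beE be0']] := hom_tens g f2; have be0 := be0' g0 f20.
have q0 := qS; have tz : truncated q.-1.+1 (zmod K ds2) by rewrite -q0; apply: zmod_truncated ds2_le.
have ge2 : all (leq q.-1.+2) ds1 by rewrite -q0; apply: ds1_ge.
have sds : size ds1 = p by rewrite size_map size_iota.
(* The scalar is the constant of [ypow_lead], applied with n-i-1 for q and with the a_i - 1 columns
   of [ds1]; it is nonzero in characteristic zero. *)
have key j : exists2 c : K, c != 0 & al (kgen j) = c *: be (xgen j).
  exists (('C(p + j, p) * p`!)%:R).
    by rewrite pnatr_eq0 -lt0n muln_gt0 bin_gt0 leq_addr fact_gt0.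
  rewrite /kgen (hom_ypow al) alE; have := ypow_lead j (zvec K ds2) ge2 tz.
  rewrite sds -q0 => ->; congr (_ *: _); rewrite /xgen beE gE f1E IE; congr tens.
  rewrite subn1; elim: j => [|j IH] /=; first by rewrite f2E.
  by rewrite IH; apply/esym; apply: (hom_act f2).
have imE : (al @: lker phi = be @: generated genP (tens v1 v2))%VS.
  rewrite ker_phi generated_xgen !limg_sum; apply: eq_bigr => j _.
  have [c c0 ce] := key j; rewrite !hom_espan ce; exact: espanZ.
(* The inverse of [be] is meaningful only on the image of [be]; by [imE], [al] maps the kernel of
   [phi] into it. Compatibility with the action then follows from injectivity of [be]. *)
pose psi0 : 'Hom(hom_ker phi, T) := (be^-1 \o al \o linfun (@vsval _ _ (lker phi)))%VF.
have psi0E u : be (psi0 u) = al (vsval u).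
  rewrite /psi0 !comp_lfunE (lfunE (@vsval _ _ _)) /= limg_lfunVK //.
  have : al (vsval u) \in (al @: lker phi)%VS by apply: memv_img; apply: subvsP.
  by rewrite imE; apply: subvP; apply: limgS; apply: subvf.
have psi_act j x u : psi0 (act (hom_ker phi) j x u) = act T j x (psi0 u).
  apply: (lker0P be0); rewrite psi0E (hom_act be) psi0E -(hom_act al); congr (al _).
  exact: (sub_actE (hom_ker_stable phi) j x u).
exists (@CurrentHom _ (hom_ker phi) T psi0 psi_act); split=> /=.
  apply/eqP/lker0P => x y xy; apply: subvs_inj; apply: (lker0P al0).
  by rewrite -!psi0E xy.
apply/eqP; rewrite eqEsubv -!(limg_ker0 _ _ be0) -imE; apply/andP; split; apply/subvP => t.
  move=> /memv_imgP [_ /memv_imgP [u _ ->] ->]; rewrite psi0E; apply: memv_img; exact: subvsP.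
move=> /memv_imgP [u uk ->]; have -> : u = vsval (Subvs uk) by [].
by rewrite -psi0E memv_img // memv_img // memvf.
Qed.

Lemma truncated_ker : truncated n (hom_ker phi).
Proof.
move=> j x nj; apply/lfunP => u; apply: subvs_inj.
have -> : (0 : 'End(hom_ker phi)) u = 0 by rewrite zero_lfunE.
rewrite linear0; apply: (etrans (sub_actE (hom_ker_stable phi) j x u)).
by rewrite tA // lfunE.
Qed.

Lemma truncatedT : truncated n T.
Proof.
apply: truncated_tens; first by apply: truncated_leq t1; lia.
by apply: truncated_leq t2; lia.
Qed.

End Main.

Theorem proposition2p2 (R : realType) (n : nat) (A : seq nat) (i : nat)
    (zA zB z1 z2 : seq R[i]) :
  size A = n ->
  sorted leq A ->
  (2 <= entry A 1)%N ->
  (1 <= i <= n - 1)%N ->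
  fusion_points A zA ->
  fusion_points (seq_step A i) zB ->
  fusion_points (seq_left A i) z1 ->
  fusion_points (seq_right A i) z2 ->
  forall phi : current_hom (fusion A zA) (fusion (seq_step A i) zB),
  limg phi = fullv ->
  phi (fusion_vec A zA) = fusion_vec (seq_step A i) zB ->
  let S := hom_ker phi in
  let M1 := fusion (seq_left A i) z1 in
  let M2 := fusion (seq_right A i) z2 in
  let T := tens_module M1 M2 in
  [/\ truncated n S, truncated n T &
    exists psi : current_hom S T,
      lker psi = 0%VS /\
      limg psi = generated
        (fun f : 'End(T) =>
           (exists2 j : nat, (j < n - 2)%N & f = act T j (sl2_e R[i])) \/
           f = tens_end \1%VF (act M2 (n - i - 1) (sl2_e R[i])))
        (tens (fusion_vec (seq_left A i) z1) (fusion_vec (seq_right A i) z2))].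

Proof.
move=> sA soA A2 i_n ptA ptB pt1 pt2 phi phi_surj phi_vec S M1 M2 T; split.
- exact: (truncated_ker sA ptA).
- exact: (truncatedT sA soA A2 i_n ptA ptB pt1 pt2).
exact: (embedding sA soA A2 i_n ptA ptB pt1 pt2 phi_surj phi_vec).
Qed.
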